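(* Let $Q$ be a Dynkin quiver with underlying graph $\Delta$. Then $\delta_\sigma=\delta_{B,A\oplus C}$ for any triangle $\sigma\colon A\to B\to C\to A[1]$ in $\mathcal{D}^b(Q)$.
   Context: $\Bbbk$ is an algebraically closed field. $\Delta$ is a Dynkin graph of type $\mathbb{A}_n$ ($n\ge1$), $\mathbb{D}_n$ ($n\ge4$), $\mathbb{E}_6,\mathbb{E}_7$ or $\mathbb{E}_8$ with vertex set $\Delta_0$; $\mathrm{dist}$ is the graph distance. $Q$ is a quiver with underlying graph $\Delta$, $\mathcal{D}^b(Q)$ the bounded derived category of finite dimensional representations of $Q$ over $\Bbbk$; $\mathbf{dim}\,X\in\mathbb{Z}^{Q_0}\cong K_0(\mathcal{D}^b(Q))$ is the class of $X$. $[X,Y]^i=\dim_\Bbbk\mathrm{Hom}_{\mathcal{D}^b(Q)}(X,Y[i])$ and $\langle X,Y\rangle=\sum_{i\le0}(-1)^i[X,Y]^i$. Call $(p,a),(q,b)\in\mathbb{Z}\times\Delta_0$ equivalent if $(q-p)+\mathrm{dist}(a,b)$ is even; the two classes are $(\mathbb{Z}\times\Delta_0)^{\mathbf v}$ (the one containing $(0,x_0)$ for a chosen base vertex $x_0$) and $(\mathbb{Z}\times\Delta_0)^{\mathbf m}$. The quiver $\mathbb{Z}\Delta$ has vertices $\mathbf{v}_{p,a}$, $(p,a)\in(\mathbb{Z}\times\Delta_0)^{\mathbf v}$, and an arrow $\mathbf{v}_{p,a}\to\mathbf{v}_{q,b}$ iff $a,b$ are adjacent and $q=p+1$. For $(p,a)\in(\mathbb{Z}\times\Delta_0)^{\mathbf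 m}$ the mesh $\mathbf{m}_{p,a}$ is the subquiver formed by all paths of length two from $\mathbf{v}_{p-1,a}$ to $\mathbf{v}_{p+1,a}$; $(\mathbb{Z}\Delta)_2$ is the set of meshes. The category of indecomposable objects of $\mathcal{D}^b(Q)$ is equivalent to the mesh category of $\mathbb{Z}\Delta$ (path category modulo, for each mesh, the sum of the paths of length two in it), and the $\mathbf{v}_{p,a}$ are accordingly identified with a complete set of pairwise non-isomorphic indecomposable objects of $\mathcal{D}^b(Q)$, with Auslander–Reiten translation $\tau\mathbf{v}_{p,a}=\mathbf{v}_{p-2,a}$. For a triangle $\sigma:A\to B\to C\xrightarrow{\gamma}A[1]$, $\delta_\sigma:(\mathbb{Z}\Delta)_2\to\mathbb{Z}$ is $\delta_\sigma(\mathbf{m}_{p,a})=\mathrm{rk}\,\mathrm{Hom}_{\mathcal{D}^b(Q)}(\mathbf{v}_{p+1,a},\gamma)=\mathrm{rk}\,\mathrm{Hom}_{\mathcal{D}^b(Q)}(\gamma[-1],\mathbf{v}_{p-1,a})$. For $M,N\in\mathcal{D}^b(Q)$ with $\mathbf{dim}\,M=\mathbf{dim}\,N$, $\delta_{M,N}:(\mathbb{Z}\Delta)_2\to\mathbb{Z}$ is $\delta_{M,N}(\mathbf{m}_{p,a})=\langle\mathbf{v}_{p+1,a},N\rangle-\langle\mathbf{v}_{p+1,a},M\rangle=\langle N,\mathbf{v}_{p-1,a}\rangle-\langle M,\mathbf{v}_{p-1,a}\rangle$. *)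

(* Defs.v *)
From HB Require Import structures.
From mathcomp Require Import all_boot all_order all_algebra.
From mathcomp Require Import generic_quotient zify.
From mathcomp Require Import boolp classical_sets functions cardinality fsbigop.

Set Implicit Arguments.
Unset Strict Implicit.
Unset Printing Implicit Defensive.

Import Order.TTheory GRing.Theory Num.Theory.
Local Open Scope ring_scope.
Local Open Scope quotient_scope.

Section Dimension.
Variables (k : fieldType) (V : lmodType k).

Definition has_dim (S : set V) (n : nat) : Prop :=
  exists b : {linear 'rV[k]_n -> V}, injective b /\ range b = S.

(* The junk value 0 is taken on infinite dimensional subspaces. *)
Definition dimk (S : set V) : nat := xget 0%N [set n | has_dim S n]%classic.

End Dimension.

(* Composition is written in diagrammatic order. *)
Record lincat (k : fieldType) := LinCat {
  ob :> Type;
  Mor : ob -> ob -> lmodType k;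
  idm : forall X, Mor X X;
  mcomp : forall X Y Z, Mor X Y -> Mor Y Z -> Mor X Z;
  compA : forall X Y Z T (f : Mor X Y) (g : Mor Y Z) (h : Mor Z T),
    mcomp f (mcomp g h) = mcomp (mcomp f g) h;
  comp1m : forall X Y (f : Mor X Y), mcomp (idm X) f = f;
  compm1 : forall X Y (f : Mor X Y), mcomp f (idm Y) = f;
  compPl : forall X Y Z (c : k) (f f' : Mor X Y) (g : Mor Y Z),
    mcomp (c *: f + f') g = c *: mcomp f g + mcomp f' g;
  compPr : forall X Y Z (c : k) (f : Mor X Y) (g g' : Mor Y Z),
    mcomp f (c *: g + g') = c *: mcomp f g + mcomp f g'
}.
Arguments Mor {k C} X Y : rename.
Arguments idm {k C} X : rename.
Arguments mcomp {k C X Y Z} f g : rename.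
Notation "f ;; g" := (mcomp f g) (at level 40, left associativity).

Section LinCatTheory.
Variables (k : fieldType) (C : lincat k).
Implicit Types X Y Z : C.

Lemma compDl X Y Z (f f' : Mor X Y) (g : Mor Y Z) :
  (f + f') ;; g = f ;; g + f' ;; g.
Proof. by have := compPl 1 f f' g; rewrite !scale1r. Qed.
Lemma compDr X Y Z (f : Mor X Y) (g g' : Mor Y Z) :
  f ;; (g + g') = f ;; g + f ;; g'.
Proof. by have := compPr 1 f g g'; rewrite !scale1r. Qed.
Lemma comp0m X Y Z (g : Mor Y Z) : (0 : Mor X Y) ;; g = 0.
Proof. by apply: (@addrI _ ((0 : Mor X Y) ;; g)); rewrite -compDl !addr0. Qed.
Lemma compm0 X Y Z (f : Mor X Y) : f ;; (0 : Mor Y Z) = 0.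
Proof. by apply: (@addrI _ (f ;; (0 : Mor Y Z))); rewrite -compDr !addr0. Qed.
Lemma compZl X Y Z c (f : Mor X Y) (g : Mor Y Z) : (c *: f) ;; g = c *: (f ;; g).
Proof. by have := compPl c f 0 g; rewrite comp0m !addr0. Qed.
Lemma compZr X Y Z c (f : Mor X Y) (g : Mor Y Z) : f ;; (c *: g) = c *: (f ;; g).
Proof. by have := compPr c f g 0; rewrite compm0 !addr0. Qed.
Lemma compNl X Y Z (f : Mor X Y) (g : Mor Y Z) : (- f) ;; g = - (f ;; g).
Proof. by rewrite -scaleN1r compZl scaleN1r. Qed.
Lemma compNr X Y Z (f : Mor X Y) (g : Mor Y Z) : f ;; (- g) = - (f ;; g).
Proof. by rewrite -scaleN1r compZr scaleN1r. Qed.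
Lemma compBl X Y Z (f f' : Mor X Y) (g : Mor Y Z) :
  (f - f') ;; g = f ;; g - f' ;; g.
Proof. by rewrite compDl compNl. Qed.
Lemma compBr X Y Z (f : Mor X Y) (g g' : Mor Y Z) :
  f ;; (g - g') = f ;; g - f ;; g'.
Proof. by rewrite compDr compNr. Qed.

Definition is_iso X Y (f : Mor X Y) : Prop :=
  exists g : Mor Y X, f ;; g = idm X /\ g ;; f = idm Y.
Definition isomorphic X Y : Prop := exists f : Mor X Y, is_iso f.
Definition is_zero X : Prop := idm X = 0.

Definition rk_Hom V X Y (f : Mor X Y) : nat :=
  dimk (range (fun u : Mor V X => u ;; f)).

End LinCatTheory.

Record submod (k : fieldType) (V : lmodType k) := SubMod {
  smem :> V -> Prop;
  smem0 : smem 0;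
  smemP : forall c u v, smem u -> smem v -> smem (c *: u + v)
}.

Section QuotientModule.
Variables (k : fieldType) (V : lmodType k) (S : submod V).

Lemma smemN u : S u -> S (- u).
Proof. by move=> su; rewrite -scaleN1r -[_ *: _]addr0; apply: smemP (smem0 S). Qed.
Lemma smemD u v : S u -> S v -> S (u + v).
Proof. by move=> su sv; rewrite -[u]scale1r; apply: smemP. Qed.

Definition qrel : rel V := fun u v => `[< S (u - v) >].
Lemma qrel_refl : reflexive qrel.
Proof. by move=> u; apply/asboolP; rewrite subrr; apply: smem0. Qed.
Lemma qrel_sym : symmetric qrel.
Proof. by move=> u v; apply/asboolP/asboolP => /smemN; rewrite opprB. Qed.
Lemma qrel_trans : transitive qrel.
Proof.
move=> v u w /asboolP h1 /asboolP h2; apply/asboolP.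
by have := smemD h1 h2; rewrite addrA subrK.
Qed.
Canonical qrel_equiv := EquivRel qrel qrel_refl qrel_sym qrel_trans.

Definition qmod := {eq_quot qrel}.
HB.instance Definition _ := Choice.on qmod.
HB.instance Definition _ := EqQuotient.on qmod.

Definition qpi (u : V) : qmod := \pi_qmod u.
Lemma qpiW (P : qmod -> Prop) : (forall u, P (qpi u)) -> forall x, P x.
Proof. by move=> h; elim/quotW. Qed.

Lemma qpiP u v : qpi u = qpi v <-> S (u - v).
Proof. by split=> [/eqmodP/asboolP|h]; [|apply/eqmodP/asboolP]. Qed.

Lemma qreprP u : S (repr (qpi u) - u).
Proof. by apply/qpiP; rewrite /qpi reprK. Qed.

Definition qadd (x y : qmod) : qmod := qpi (repr x + repr y).
Definition qopp (x : qmod) : qmod := qpi (- repr x).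
Definition qscale (c : k) (x : qmod) : qmod := qpi (c *: repr x).

Lemma qaddE u v : qadd (qpi u) (qpi v) = qpi (u + v).
Proof. by apply/qpiP; rewrite opprD addrACA; apply: smemD; apply: qreprP. Qed.
Lemma qoppE u : qopp (qpi u) = qpi (- u).
Proof. by apply/qpiP; rewrite -opprD; apply: smemN; apply: qreprP. Qed.
Lemma qscaleE c u : qscale c (qpi u) = qpi (c *: u).
Proof.
apply/qpiP; rewrite -scalerBr -[_ *: _]addr0.
by apply: smemP (smem0 S); apply: qreprP.
Qed.

Lemma qaddA : associative qadd.
Proof. by elim/qpiW=> x; elim/qpiW=> y; elim/qpiW=> z; rewrite !qaddE addrA. Qed.
Lemma qaddC : commutative qadd.
Proof. by elim/qpiW=> x; elim/qpiW=> y; rewrite !qaddE addrC. Qed.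
Lemma qadd0 : left_id (qpi 0) qadd.
Proof. by elim/qpiW=> x; rewrite qaddE add0r. Qed.
Lemma qaddN : left_inverse (qpi 0) qopp qadd.
Proof. by elim/qpiW=> x; rewrite qoppE qaddE addNr. Qed.
HB.instance Definition _ := GRing.isZmodule.Build qmod qaddA qaddC qadd0 qaddN.

Lemma qpiD u v : qpi (u + v) = qpi u + qpi v.
Proof. by rewrite -qaddE. Qed.

Lemma qscaleA a b x : qscale a (qscale b x) = qscale (a * b) x.
Proof. by elim/qpiW: x => x; rewrite !qscaleE scalerA. Qed.
Lemma qscale1 : left_id 1 qscale.
Proof. by elim/qpiW=> x; rewrite qscaleE scale1r. Qed.
Lemma qscaleDr : right_distributive qscale +%R.
Proof. by move=> a; elim/qpiW=> x; elim/qpiW=> y; rewrite -qpiD !qscaleE -qpiD scalerDr. Qed.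
Lemma qscaleDl x : {morph qscale^~ x : a b / a + b}.
Proof. by elim/qpiW: x => x a b; rewrite !qscaleE -qpiD scalerDl. Qed.
HB.instance Definition _ :=
  GRing.Zmodule_isLmodule.Build k qmod qscaleA qscale1 qscaleDr qscaleDl.

Lemma qpiZ c u : qpi (c *: u) = c *: qpi u.
Proof. by rewrite -qscaleE. Qed.

End QuotientModule.

Record left_system (k : fieldType) (C : lincat k) := LeftSystem {
  wmem : forall X Y : C, Mor X Y -> Prop;
  wmem1 : forall X, wmem (idm X);
  wmemM : forall X Y Z (s : Mor X Y) (t : Mor Y Z),
    wmem s -> wmem t -> wmem (s ;; t);
  wmemK : forall X Y Z (s : Mor X Y) (t : Mor Y Z),
    wmem s -> wmem (s ;; t) -> wmem t;
  wore : forall X Y Z (s : Mor X Y) (f : Mor X Z), wmem s ->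
    exists T (g : Mor Y T) (t : Mor Z T), wmem t /\ s ;; g = f ;; t;
  wcancel : forall X Y Z (s : Mor X Y) (f : Mor Y Z), wmem s -> s ;; f = 0 ->
    exists T (t : Mor Z T), wmem t /\ f ;; t = 0
}.
Arguments wmem {k C} l [X Y] f : rename.

Section Localization.
Variables (k : fieldType) (C : lincat k) (L : left_system C).
Local Notation W := (wmem L).
Implicit Types X Y Z : C.

(* X --num--> mid <--den-- Y with den in W represents num ;; den^-1. *)
Record frac X Y := Frac {
  mid : C;
  num : Mor X mid;
  den : Mor Y mid;
  denW : W den
}.
HB.instance Definition _ X Y := gen_eqMixin (frac X Y).
HB.instance Definition _ X Y := gen_choiceMixin (frac X Y).

Definition frac_eq X Y (r r' : frac X Y) : Prop :=
  exists T (u : Mor (mid r) T) (u' : Mor (mid r') T),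
    [/\ W (den r ;; u), den r ;; u = den r' ;; u' & num r ;; u = num r' ;; u'].

Lemma wcancelB X Y Z (s : Mor X Y) (f g : Mor Y Z) : W s -> s ;; f = s ;; g ->
  exists T (t : Mor Z T), W t /\ f ;; t = g ;; t.
Proof.
move=> Ws e; have [|T [t [Wt h]]] := @wcancel _ _ L _ _ _ s (f - g) Ws.
  by rewrite compBr e subrr.
by exists T, t; split=> //; apply: subr0_eq; rewrite -compBl.
Qed.

Lemma wspan X Y Z (s : Mor X Y) (f : Mor X Z) : W s -> W f ->
  exists T (g : Mor Y T) (t : Mor Z T), [/\ W t, W g & s ;; g = f ;; t].
Proof.
move=> Ws Wf; have [T [g [t [Wt e]]]] := wore f Ws.
exists T, g, t; split=> //; apply: (wmemK Ws); rewrite e; exact: wmemM.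
Qed.

Lemma frac_eq_refl X Y (r : frac X Y) : frac_eq r r.
Proof. by exists (mid r), (idm _), (idm _); split=> //; rewrite compm1; exact: denW. Qed.
Lemma frac_eq_sym X Y (r r' : frac X Y) : frac_eq r r' -> frac_eq r' r.
Proof. by case=> T [u [u' [Wu e1 e2]]]; exists T, u', u; split=> //; rewrite -e1. Qed.

Lemma wmerge X M T T' (s : Mor X M) (u : Mor M T) (w : Mor M T') :
  W s -> W (s ;; u) -> W (s ;; w) ->
  exists P (a : Mor T P) (b : Mor T' P), [/\ W a, W b & u ;; a = w ;; b].
Proof.
move=> Ws Wu Ww; have [P [a [b [Wb Wa e]]]] := wspan Wu Ww.
have [|P' [t [Wt h]]] := @wcancelB _ _ _ s (u ;; a) (w ;; b) Ws.
  by rewrite !compA.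
exists P', (a ;; t), (b ;; t); split; [exact: wmemM|exact: wmemM|].
by rewrite !compA.
Qed.

Lemma frac_eq_trans X Y (r1 r2 r3 : frac X Y) :
  frac_eq r1 r2 -> frac_eq r2 r3 -> frac_eq r1 r3.
Proof.
case=> T [u1 [u2 [Wu e1 e2]]] [T' [w2 [w3 [Ww e3 e4]]]].
have Wu' : W (den r2 ;; u2) by rewrite -e1.
have [P [a [b [Wa Wb e]]]] := wmerge (denW r2) Wu' Ww.
exists P, (u1 ;; a), (w3 ;; b); split.
- by rewrite compA; exact: wmemM.
- by rewrite !compA e1 -e3 -!compA e.
- by rewrite !compA e2 -e4 -!compA e.
Qed.

Definition frel X Y : rel (frac X Y) := fun r r' => `[< frac_eq r r' >].
Lemma frel_refl X Y : reflexive (@frel X Y).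
Proof. by move=> r; apply/asboolP; apply: frac_eq_refl. Qed.
Lemma frel_sym X Y : symmetric (@frel X Y).
Proof. by move=> r r'; apply/asboolP/asboolP; apply: frac_eq_sym. Qed.
Lemma frel_trans X Y : transitive (@frel X Y).
Proof.
by move=> r2 r1 r3 /asboolP h1 /asboolP h2; apply/asboolP/(frac_eq_trans h1 h2).
Qed.
Canonical frel_equiv X Y :=
  EquivRel (@frel X Y) (@frel_refl X Y) (@frel_sym X Y) (@frel_trans X Y).

Definition lhom X Y := {eq_quot @frel X Y}.
HB.instance Definition _ X Y := Choice.on (lhom X Y).
HB.instance Definition _ X Y := EqQuotient.on (lhom X Y).

Definition cls X Y (r : frac X Y) : lhom X Y := \pi_(lhom X Y) r.
Lemma clsP X Y (r r' : frac X Y) : cls r = cls r' <-> frac_eq r r'.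
Proof. by split=> [/eqmodP/asboolP|h]; [|apply/eqmodP/asboolP]. Qed.

Definition mkl X Y M (f : Mor X M) (s : Mor Y M) (Ws : W s) : lhom X Y :=
  cls (Frac f Ws).

Lemma mkl_ext X Y M M' (f : Mor X M) (s : Mor Y M) (Ws : W s) (u : Mor M M')
  (f' : Mor X M') (s' : Mor Y M') (Ws' : W s') :
  f' = f ;; u -> s' = s ;; u -> mkl f Ws = mkl f' Ws'.
Proof.
move=> ef es; apply/clsP; exists M', u, (idm _) => /=.
by rewrite !compm1; split=> //; rewrite -es.
Qed.

Lemma lhomW X Y (x : lhom X Y) :
  exists M (f : Mor X M) (s : Mor Y M) (Ws : W s), x = mkl f Ws.
Proof.
elim/quotW: x => -[M f s Ws]; by exists M, f, s, Ws.
Qed.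

Lemma lhomW2 X Y (x y : lhom X Y) :
  exists M (f g : Mor X M) (s : Mor Y M) (Ws : W s), x = mkl f Ws /\ y = mkl g Ws.
Proof.
have [M [f [s [Ws ->]]]] := lhomW x; have [N [g [t [Wt ->]]]] := lhomW y.
have [P [a [b [Wb Wa e]]]] := wspan Ws Wt.
exists P, (f ;; a), (g ;; b), (t ;; b), (wmemM Wt Wb).
by split; apply: mkl_ext.
Qed.

Lemma lhomW3 X Y (x y z : lhom X Y) :
  exists M (f g h : Mor X M) (s : Mor Y M) (Ws : W s),
    [/\ x = mkl f Ws, y = mkl g Ws & z = mkl h Ws].
Proof.
have [M [f [g [s [Ws [-> ->]]]]]] := lhomW2 x y.
have [N [h [t [Wt ->]]]] := lhomW z.
have [P [a [b [Wb Wa e]]]] := wspan Ws Wt.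
exists P, (f ;; a), (g ;; a), (h ;; b), (t ;; b), (wmemM Wt Wb).
by split; apply: mkl_ext.
Qed.

Lemma mkl_inj X Y M (f g : Mor X M) (s : Mor Y M) (Ws : W s) :
  mkl f Ws = mkl g Ws <-> exists T (t : Mor M T), W t /\ f ;; t = g ;; t.
Proof.
split=> [/clsP[T /= [u [u' [Wu e1 e2]]]]|[T [t [Wt e]]]].
  have [P [t [Wt e]]] := wcancelB Ws e1.
  exists P, (u ;; t); split; last by rewrite !compA e2 -!compA e.
  by apply: wmemM Wt; apply: wmemK Wu.
by apply/clsP; exists T, t, t; split=> //; apply: wmemM.
Qed.

Lemma mkl_eq X Y M M' (f : Mor X M) (s : Mor Y M) (Ws : W s)
    (f' : Mor X M') (s' : Mor Y M') (Ws' : W s') :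
  mkl f Ws = mkl f' Ws' -> exists T (u : Mor M T) (u' : Mor M' T),
    [/\ W u, W u', s ;; u = s' ;; u' & f ;; u = f' ;; u'].
Proof.
move=> /clsP[T /= [u [u' [Wu e1 e2]]]]; exists T, u, u'.
by split=> //; [apply: wmemK Wu | apply: (wmemK Ws'); rewrite -e1].
Qed.

Definition common_den X Y (x y : lhom X Y) (z : lhom X Y) : Prop :=
  exists M (f g : Mor X M) (s : Mor Y M) (Ws : W s),
    [/\ x = mkl f Ws, y = mkl g Ws & z = mkl (f + g) Ws].

(* (f, s) + (g, s) = (f + g, s), after reduction to a common denominator. *)
Definition ladd X Y (x y : lhom X Y) : lhom X Y := xget x (common_den x y).
Definition lscale X Y (c : k) (x : lhom X Y) : lhom X Y :=
  mkl (c *: num (repr x)) (denW (repr x)).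
Definition lzero X Y : lhom X Y := mkl 0 (wmem1 L Y).

Lemma laddE X Y M (f g : Mor X M) (s : Mor Y M) (Ws : W s) :
  ladd (mkl f Ws) (mkl g Ws) = mkl (f + g) Ws.
Proof.
rewrite /ladd; case: xgetP => [_ _ [N [f' [g' [t [Wt [ef eg ->]]]]]]|]; last first.
  by move=> /(_ (mkl (f + g) Ws)) []; exists M, f, g, s, Ws.
have [T [u [u' [Wu Wu' e1 e2]]]] := mkl_eq ef.
have [T' [w [w' [Ww Ww' e3 e4]]]] := mkl_eq eg.
have [P [a [b [Wb Wa e]]]] := wmerge Ws (wmemM Ws Wu) (wmemM Ws Ww).
have [|P' [c [Wc e']]] := @wcancelB _ _ _ t (u' ;; a) (w' ;; b) Wt.
  by rewrite !compA -e1 -e3 -!compA e.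
have WP : W (s ;; (u ;; a ;; c)) by do !apply: wmemM => //.
transitivity (mkl (f ;; (u ;; a ;; c) + g ;; (w ;; b ;; c)) WP).
  apply: (@mkl_ext _ _ _ _ _ _ _ (u' ;; a ;; c)).
    by rewrite compDl [in g' ;; _]e' !compA e2 e4.
  by rewrite !compA e1.
apply/esym; apply: (@mkl_ext _ _ _ _ _ _ _ (u ;; a ;; c)) => //.
by rewrite compDl -e.
Qed.

Lemma lscaleE X Y M c (f : Mor X M) (s : Mor Y M) (Ws : W s) :
  lscale c (mkl f Ws) = mkl (c *: f) Ws.
Proof.
rewrite /lscale; set r := repr _.
have : mkl (num r) (denW r) = mkl f Ws.
  by rewrite /mkl; case: r (reprK (mkl f Ws) : cls r = _).
case/mkl_eq=> T [u [u' [Wu Wu' e1 e2]]].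
have WP : W (s ;; u') by apply: wmemM.
transitivity (mkl (c *: (f ;; u')) WP).
  by apply: (@mkl_ext _ _ _ _ _ _ _ u); rewrite ?compZl ?e2.
by apply/esym; apply: (@mkl_ext _ _ _ _ _ _ _ u'); rewrite ?compZl.
Qed.

Lemma lzeroE X Y M (s : Mor Y M) (Ws : W s) : lzero X Y = mkl 0 Ws.
Proof. by apply: (@mkl_ext _ _ _ _ _ _ _ s); rewrite ?comp0m ?comp1m. Qed.

Lemma laddA X Y : associative (@ladd X Y).
Proof.
move=> x y z; have [M [f [g [h [s [Ws [-> -> ->]]]]]]] := lhomW3 x y z.
by rewrite !laddE addrA.
Qed.
Lemma laddC X Y : commutative (@ladd X Y).
Proof.
move=> x y; have [M [f [g [s [Ws [-> ->]]]]]] := lhomW2 x y.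
by rewrite !laddE addrC.
Qed.
Lemma ladd0 X Y : left_id (lzero X Y) (@ladd X Y).
Proof.
by move=> x; have [M [f [s [Ws ->]]]] := lhomW x; rewrite (lzeroE _ Ws) laddE add0r.
Qed.
Lemma laddN X Y : left_inverse (lzero X Y) (@lscale X Y (-1)) (@ladd X Y).
Proof.
move=> x; have [M [f [s [Ws ->]]]] := lhomW x.
by rewrite lscaleE laddE scaleN1r addNr (lzeroE _ Ws).
Qed.
HB.instance Definition _ X Y :=
  GRing.isZmodule.Build (lhom X Y) (@laddA X Y) (@laddC X Y) (@ladd0 X Y) (@laddN X Y).

Lemma mklD X Y M (f g : Mor X M) (s : Mor Y M) (Ws : W s) :
  mkl (f + g) Ws = mkl f Ws + mkl g Ws.
Proof. by rewrite -laddE. Qed.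

Lemma lscaleA X Y a b (x : lhom X Y) : lscale a (lscale b x) = lscale (a * b) x.
Proof. by have [M [f [s [Ws ->]]]] := lhomW x; rewrite !lscaleE scalerA. Qed.
Lemma lscale1 X Y : left_id 1 (@lscale X Y).
Proof. by move=> x; have [M [f [s [Ws ->]]]] := lhomW x; rewrite !lscaleE scale1r. Qed.
Lemma lscaleDr X Y : right_distributive (@lscale X Y) +%R.
Proof.
move=> a x y; have [M [f [g [s [Ws [-> ->]]]]]] := lhomW2 x y.
by rewrite -mklD !lscaleE -mklD scalerDr.
Qed.
Lemma lscaleDl X Y (x : lhom X Y) : {morph (@lscale X Y)^~ x : a b / a + b}.
Proof.
by move=> a b; have [M [f [s [Ws ->]]]] := lhomW x; rewrite !lscaleE -mklD scalerDl.
Qed.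
HB.instance Definition _ X Y := GRing.Zmodule_isLmodule.Build k (lhom X Y)
  (@lscaleA X Y) (@lscale1 X Y) (@lscaleDr X Y) (@lscaleDl X Y).

Lemma mklZ X Y M c (f : Mor X M) (s : Mor Y M) (Ws : W s) :
  mkl (c *: f) Ws = c *: mkl f Ws.
Proof. by rewrite -lscaleE. Qed.

Definition ore_square X Y Z (x : lhom X Y) (y : lhom Y Z) (z : lhom X Z) : Prop :=
  exists M (f : Mor X M) (s : Mor Y M) (Ws : W s)
         N (g : Mor Y N) (t : Mor Z N) (Wt : W t)
         P (a : Mor M P) (b : Mor N P) (Wb : W b),
    [/\ x = mkl f Ws, y = mkl g Wt, s ;; a = g ;; b
      & z = mkl (f ;; a) (wmemM Wt Wb)].

(* (f, s) ;; (g, t) = (f ;; a, t ;; b) where s ;; a = g ;; b with b in W. *)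
Definition lcomp X Y Z (x : lhom X Y) (y : lhom Y Z) : lhom X Z :=
  xget 0 (ore_square x y).

Lemma mkl_pir X Y M (f : Mor X M) (s s' : Mor Y M) (Ws : W s) (Ws' : W s') :
  s = s' -> mkl f Ws = mkl f Ws'.
Proof. by move=> e; apply: (@mkl_ext _ _ _ _ _ _ _ (idm _)); rewrite compm1. Qed.

Lemma lcomp_indep X Y Z M (f : Mor X M) (s : Mor Y M) (Ws : W s)
  N (g : Mor Y N) (t : Mor Z N) (Wt : W t)
  P (a : Mor M P) (b : Mor N P) (Wb : W b)
  P' (a' : Mor M P') (b' : Mor N P') (Wb' : W b') :
  s ;; a = g ;; b -> s ;; a' = g ;; b' ->
  mkl (f ;; a) (wmemM Wt Wb) = mkl (f ;; a') (wmemM Wt Wb').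
Proof.
move=> e e'; have [T [c [c' [Wc' Wc ec]]]] := wspan Wb Wb'.
have [|T' [u [Wu eu]]] := @wcancelB _ _ _ s (a ;; c) (a' ;; c') Ws.
  by rewrite !compA e e' -!compA ec.
have WP : W (t ;; (b ;; c ;; u)) by do !apply: wmemM => //.
transitivity (mkl (f ;; (a ;; c ;; u)) WP).
  by apply: (@mkl_ext _ _ _ _ _ _ _ (c ;; u)); rewrite !compA.
by apply/esym; apply: (@mkl_ext _ _ _ _ _ _ _ (c' ;; u)); rewrite ?eu !compA //
   -!compA [b ;; (c ;; u)]compA ec !compA.
Qed.

Lemma lcompE X Y Z M (f : Mor X M) (s : Mor Y M) (Ws : W s)
  N (g : Mor Y N) (t : Mor Z N) (Wt : W t)
  P (a : Mor M P) (b : Mor N P) (Wb : W b) :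
  s ;; a = g ;; b ->
  lcomp (mkl f Ws) (mkl g Wt) = mkl (f ;; a) (wmemM Wt Wb).
Proof.
move=> e; rewrite /lcomp; case: xgetP => [z _|]; last first.
  move=> /(_ (mkl (f ;; a) (wmemM Wt Wb))) [].
  by exists M, f, s, Ws, N, g, t, Wt, P, a, b, Wb.
case=> M' [f' [s' [Ws' [N' [g' [t' [Wt' [P' [a' [b' [Wb' [ef eg e' ->]]]]]]]]]]]].
have [T [u [u' [Wu Wu' e1 e2]]]] := mkl_eq ef.
have [T' [w [w' [Ww Ww' e3 e4]]]] := mkl_eq eg.
have [R [c [d [Wd ec]]]] := wore (g ;; w) (wmemM Ws Wu).
have Ed : s ;; (u ;; c) = g ;; (w ;; d) by rewrite !compA.
have Ed' : s' ;; (u' ;; c) = g' ;; (w' ;; d) by rewrite !compA -e1 -e4 ec.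
rewrite (lcomp_indep f' Ws' Wt' Wb' (wmemM Ww' Wd) e' Ed').
rewrite (lcomp_indep f Ws Wt Wb (wmemM Ww Wd) e Ed).
rewrite (compA f u c) (compA f' u' c) e2.
by apply: mkl_pir; rewrite !compA e3.
Qed.

Lemma lcompA X Y Z T (x : lhom X Y) (y : lhom Y Z) (z : lhom Z T) :
  lcomp x (lcomp y z) = lcomp (lcomp x y) z.
Proof.
have [M [f [s [Ws ->]]]] := lhomW x; have [N [g [t [Wt ->]]]] := lhomW y.
have [O [h [p [Wp ->]]]] := lhomW z.
have [P1 [c [d [Wd e1]]]] := wore g Ws.
have [P2 [a [b [Wb e2]]]] := wore h Wt.
have [P3 [c' [e [We e3]]]] := wore a Wd.
rewrite (lcompE f Ws Wt Wd e1) (lcompE g Wt Wp Wb e2).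
have E1 : s ;; (c ;; c') = g ;; a ;; e by rewrite compA e1 -!compA e3.
have E2 : t ;; d ;; c' = h ;; (b ;; e) by rewrite -compA e3 !compA e2.
rewrite (lcompE f Ws (wmemM Wp Wb) We E1).
rewrite (lcompE (f ;; c) (wmemM Wt Wd) Wp (wmemM Wb We) E2).
by rewrite compA; apply: mkl_pir; rewrite compA.
Qed.

Definition lid X : lhom X X := mkl (idm X) (wmem1 L X).

Lemma lcomp1m X Y (x : lhom X Y) : lcomp (lid X) x = x.
Proof.
have [M [f [s [Ws ->]]]] := lhomW x.
have E : idm X ;; f = f ;; idm M by rewrite comp1m compm1.
rewrite (lcompE (idm X) (wmem1 L X) Ws (wmem1 L M) E) comp1m.
by apply: mkl_pir; rewrite compm1.
Qed.
Lemma lcompm1 X Y (x : lhom X Y) : lcomp x (lid Y) = x.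
Proof.
have [M [f [s [Ws ->]]]] := lhomW x.
have E : s ;; idm M = idm Y ;; s by rewrite comp1m compm1.
rewrite (lcompE f Ws (wmem1 L Y) Ws E) compm1.
by apply: mkl_pir; rewrite comp1m.
Qed.
Lemma lcompPl X Y Z c (x x' : lhom X Y) (y : lhom Y Z) :
  lcomp (c *: x + x') y = c *: lcomp x y + lcomp x' y.
Proof.
have [M [f [f' [s [Ws [-> ->]]]]]] := lhomW2 x x'; have [N [g [t [Wt ->]]]] := lhomW y.
have [P [a [b [Wb e]]]] := wore g Ws.
rewrite -mklZ -mklD (lcompE _ Ws Wt Wb e) (lcompE f Ws Wt Wb e) (lcompE f' Ws Wt Wb e).
by rewrite -mklZ -mklD compPl.
Qed.
Lemma lcompPr X Y Z c (x : lhom X Y) (y y' : lhom Y Z) :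
  lcomp x (c *: y + y') = c *: lcomp x y + lcomp x y'.
Proof.
have [M [f [s [Ws ->]]]] := lhomW x.
have [N [g [g' [t [Wt [-> ->]]]]]] := lhomW2 y y'.
have [P [a [b [Wb e]]]] := wore g Ws.
have [P' [a' [b' [Wb' e']]]] := wore g' Ws.
have [R [d [d' [Wd' Wd ed]]]] := wspan Wb Wb'.
have E : s ;; (a ;; d) = g ;; (b ;; d) by rewrite compA e compA.
have E' : s ;; (a' ;; d') = g' ;; (b ;; d) by rewrite compA e' ed compA.
have E2 : s ;; (c *: (a ;; d) + a' ;; d') = (c *: g + g') ;; (b ;; d).
  by rewrite compPr compPl E E'.
have Wbd := wmemM Wb Wd.
rewrite -mklZ -mklD (lcompE f Ws Wt Wbd E) (lcompE f Ws Wt Wbd E') (lcompE f Ws Wt Wbd E2).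
by rewrite -mklZ -mklD compPr.
Qed.

Definition localization : lincat k :=
  LinCat lcompA lcomp1m lcompm1 lcompPl lcompPr.

Definition loc X Y (f : Mor X Y) : @Mor k localization X Y := mkl f (wmem1 L Y).

End Localization.

Record ideal (k : fieldType) (C : lincat k) := Ideal {
  imem : forall X Y : C, submod (Mor X Y);
  imemMl : forall X Y Z (f : Mor X Y) (g : Mor Y Z), imem X Y f -> imem X Z (f ;; g);
  imemMr : forall X Y Z (f : Mor X Y) (g : Mor Y Z), imem Y Z g -> imem X Z (f ;; g)
}.

Section QuotientCategory.
Variables (k : fieldType) (C : lincat k) (J : ideal C).
Implicit Types X Y Z : C.

Definition qhom X Y : lmodType k := qmod (imem J X Y).
Definition qcomp X Y Z (x : qhom X Y) (y : qhom Y Z) : qhom X Z :=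
  qpi (imem J X Z) (repr x ;; repr y).

Lemma qcompE X Y Z (f : Mor X Y) (g : Mor Y Z) :
  qcomp (qpi (imem J X Y) f) (qpi (imem J Y Z) g) = qpi (imem J X Z) (f ;; g).
Proof.
apply/qpiP; set f' := repr _; set g' := repr _.
have -> : f' ;; g' - f ;; g = (f' - f) ;; g' + f ;; (g' - g).
  by rewrite compBl compBr addrA subrK.
by apply: smemD; [apply: imemMl | apply: imemMr]; apply: qreprP.
Qed.

Lemma qcompA X Y Z T (f : qhom X Y) (g : qhom Y Z) (h : qhom Z T) :
  qcomp f (qcomp g h) = qcomp (qcomp f g) h.
Proof.
by elim/qpiW: f => f; elim/qpiW: g => g; elim/qpiW: h => h; rewrite !qcompE compA.
Qed.
Lemma qcomp1m X Y (f : qhom X Y) : qcomp (qpi _ (idm X)) f = f.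
Proof. by elim/qpiW: f => f; rewrite qcompE comp1m. Qed.
Lemma qcompm1 X Y (f : qhom X Y) : qcomp f (qpi _ (idm Y)) = f.
Proof. by elim/qpiW: f => f; rewrite qcompE compm1. Qed.
Lemma qcompPl X Y Z c (f f' : qhom X Y) (g : qhom Y Z) :
  qcomp (c *: f + f') g = c *: qcomp f g + qcomp f' g.
Proof.
elim/qpiW: f => f; elim/qpiW: f' => f'; elim/qpiW: g => g.
by rewrite -qpiZ -qpiD !qcompE -qpiZ -qpiD compPl.
Qed.
Lemma qcompPr X Y Z c (f : qhom X Y) (g g' : qhom Y Z) :
  qcomp f (c *: g + g') = c *: qcomp f g + qcomp f g'.
Proof.
elim/qpiW: f => f; elim/qpiW: g' => g'; elim/qpiW: g => g.
by rewrite -qpiZ -qpiD !qcompE -qpiZ -qpiD compPr.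
Qed.

Definition quotient_cat : lincat k :=
  LinCat qcompA qcomp1m qcompm1 qcompPl qcompPr.

Definition qcls X Y (f : Mor X Y) : @Mor k quotient_cat X Y := qpi (imem J X Y) f.

End QuotientCategory.

Record linear_cond (k : fieldType) (I : Type) (F : I -> lmodType k) := LinearCond {
  lcmem :> (forall i, F i) -> Prop;
  lcmem0 : lcmem (fun i => 0);
  lcmemP : forall c u v, lcmem u -> lcmem v -> lcmem (fun i => c *: u i + v i)
}.

Section LinearFamilies.
Variables (k : fieldType) (I : Type) (F : I -> lmodType k) (P : linear_cond F).

Record family := Family { fapp :> forall i, F i; fappP : P fapp }.
HB.instance Definition _ := gen_eqMixin family.
HB.instance Definition _ := gen_choiceMixin family.

Lemma familyP (u v : family) : (forall i, u i = v i) -> u = v.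
Proof.
case: u v => [u Pu] [v Pv] /= e.
have {}e : u = v by apply: functional_extensionality_dep.
by case: _ / e Pv => Pv; congr Family; apply: Prop_irrelevance.
Qed.

Definition fam_zero : family := Family (lcmem0 P).
Lemma fam_add_subproof (u v : family) : P (fun i => u i + v i).
Proof.
have := lcmemP 1 (fappP u) (fappP v); congr (P _).
by apply: functional_extensionality_dep => i; rewrite scale1r.
Qed.
Lemma fam_scale_subproof c (u : family) : P (fun i => c *: u i).
Proof.
have := lcmemP c (fappP u) (lcmem0 P); congr (P _).
by apply: functional_extensionality_dep => i; rewrite addr0.
Qed.
Definition fam_add (u v : family) : family := Family (fam_add_subproof u v).
Definition fam_scale c (u : family) : family := Family (fam_scale_subproof c u).

Lemma fam_addA : associative fam_add.
Proof. by move=> u v w; apply: familyP => i /=; rewrite addrA. Qed.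
Lemma fam_addC : commutative fam_add.
Proof. by move=> u v; apply: familyP => i /=; rewrite addrC. Qed.
Lemma fam_add0 : left_id fam_zero fam_add.
Proof. by move=> u; apply: familyP => i /=; rewrite add0r. Qed.
Lemma fam_addN : left_inverse fam_zero (fam_scale (-1)) fam_add.
Proof. by move=> u; apply: familyP => i /=; rewrite scaleN1r addNr. Qed.
HB.instance Definition _ :=
  GRing.isZmodule.Build family fam_addA fam_addC fam_add0 fam_addN.

Lemma fam_scaleA a b (u : family) : fam_scale a (fam_scale b u) = fam_scale (a * b) u.
Proof. by apply: familyP => i /=; rewrite scalerA. Qed.
Lemma fam_scale1 : left_id 1 fam_scale.
Proof. by move=> u; apply: familyP => i /=; rewrite scale1r. Qed.
Lemma fam_scaleDr : right_distributive fam_scale +%R.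
Proof. by move=> a u v; apply: familyP => i /=; rewrite scalerDr. Qed.
Lemma fam_scaleDl u : {morph fam_scale^~ u : a b / a + b}.
Proof. by move=> a b; apply: familyP => i /=; rewrite scalerDl. Qed.
HB.instance Definition _ := GRing.Zmodule_isLmodule.Build k family
  fam_scaleA fam_scale1 fam_scaleDr fam_scaleDl.

End LinearFamilies.

Record quiver (V : finType) := Quiver {
  arrows : finType;
  src : arrows -> V;
  tgt : arrows -> V
}.

Definition underlying_graph (V : finType) (Q : quiver V) (e : rel V) : Prop :=
  forall a b, #|[set h : arrows Q | (src h == a) && (tgt h == b)
                                 || (src h == b) && (tgt h == a)]| = e a b.

Section Representations.
Variables (k : fieldType) (V : finType) (Q : quiver V).

(* Linear maps are matrices acting on row vectors from the right. *)
Record rep := Rep {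
  rdim : V -> nat;
  ract : forall h : arrows Q, 'M[k]_(rdim (src h), rdim (tgt h))
}.

Definition rep_commutes (M N : rep) (f : forall x, 'M[k]_(rdim M x, rdim N x)) : Prop :=
  forall h : arrows Q, ract M h *m f (tgt h) = f (src h) *m ract N h.
Lemma rep_commutes0 M N : @rep_commutes M N (fun x => 0).
Proof. by move=> h; rewrite mulmx0 mul0mx. Qed.
Lemma rep_commutesP M N c f g : @rep_commutes M N f -> rep_commutes g ->
  @rep_commutes M N (fun x => c *: f x + g x).
Proof.
move=> Cf Cg h; rewrite mulmxDr mulmxDl -scalemxAr -scalemxAl.
by rewrite (Cf h) (Cg h).
Qed.

Definition rhom (M N : rep) : lmodType k := family
  (@LinearCond k V (fun x => 'M[k]_(rdim M x, rdim N x) : lmodType k) _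
     (@rep_commutes0 M N) (@rep_commutesP M N)).

Definition rmap (M N : rep) (f : rhom M N) x : 'M[k]_(rdim M x, rdim N x) := f x.

Definition mk_rhom (M N : rep) f (Cf : @rep_commutes M N f) : rhom M N :=
  @Family k V _ (@LinearCond k V (fun x => 'M[k]_(rdim M x, rdim N x) : lmodType k) _
     (@rep_commutes0 M N) (@rep_commutesP M N)) f Cf.

Lemma rmapC (M N : rep) (f : rhom M N) h :
  ract M h *m rmap f (tgt h) = rmap f (src h) *m ract N h.
Proof. exact: (fappP f h). Qed.

Lemma rhomP (M N : rep) (f g : rhom M N) : (forall x, rmap f x = rmap g x) -> f = g.
Proof. exact: familyP. Qed.

Lemma rid_subproof M : @rep_commutes M M (fun x => 1%:M).
Proof. by move=> h; rewrite mulmx1 mul1mx. Qed.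
Definition rid M : rhom M M := mk_rhom (@rid_subproof M).

Lemma rcomp_subproof M N P (f : rhom M N) (g : rhom N P) :
  @rep_commutes M P (fun x => rmap f x *m rmap g x).
Proof. by move=> h; rewrite mulmxA rmapC -!mulmxA rmapC. Qed.
Definition rcomp M N P (f : rhom M N) (g : rhom N P) : rhom M P :=
  mk_rhom (rcomp_subproof f g).

Lemma rcompA M N P R (f : rhom M N) (g : rhom N P) (h : rhom P R) :
  rcomp f (rcomp g h) = rcomp (rcomp f g) h.
Proof. by apply: rhomP => x; apply: mulmxA. Qed.
Lemma rcomp1m M N (f : rhom M N) : rcomp (rid M) f = f.
Proof. by apply: rhomP => x; apply: mul1mx. Qed.
Lemma rcompm1 M N (f : rhom M N) : rcomp f (rid N) = f.
Proof. by apply: rhomP => x; apply: mulmx1. Qed.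
Lemma rcompPl M N P c (f f' : rhom M N) (g : rhom N P) :
  rcomp (c *: f + f') g = c *: rcomp f g + rcomp f' g.
Proof. by apply: rhomP => x; rewrite /rmap /= mulmxDl -scalemxAl. Qed.
Lemma rcompPr M N P c (f : rhom M N) (g g' : rhom N P) :
  rcomp f (c *: g + g') = c *: rcomp f g + rcomp f g'.
Proof. by apply: rhomP => x; rewrite /rmap /= mulmxDr -scalemxAr. Qed.

Definition rep_cat : lincat k := LinCat rcompA rcomp1m rcompm1 rcompPl rcompPr.
Implicit Types M N P : rep_cat.

Lemma rmapM M N P (f : Mor M N) (g : Mor N P) x : rmap (f ;; g) x = rmap f x *m rmap g x.
Proof. by []. Qed.
Lemma rmapD M N (f g : Mor M N) x : rmap (f + g) x = rmap f x + rmap g x.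
Proof. by []. Qed.
Lemma rmapZ M N c (f : Mor M N) x : rmap (c *: f) x = c *: rmap f x.
Proof. by []. Qed.
Lemma rmap0 M N x : rmap (0 : Mor M N) x = 0. Proof. by []. Qed.
Lemma rmap1 M x : rmap (idm M) x = 1%:M. Proof. by []. Qed.
Lemma rmapN M N (f : Mor M N) x : rmap (- f) x = - rmap f x.
Proof. by rewrite -scaleN1r rmapZ scaleN1r. Qed.

Definition rdsum (M N : rep) : rep :=
  @Rep (fun x => (rdim M x + rdim N x)%N)
       (fun h => block_mx (ract M h) 0 0 (ract N h)).

Lemma rrow_subproof (P M N : rep) (f : rhom P M) (g : rhom P N) :
  @rep_commutes P (rdsum M N) (fun x => row_mx (rmap f x) (rmap g x)).
Proof.
by move=> h /=; rewrite mul_row_block !mulmx0 addr0 add0r mul_mx_row !rmapC.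
Qed.
Definition rrow (P M N : rep) (f : rhom P M) (g : rhom P N) : rhom P (rdsum M N) :=
  mk_rhom (rrow_subproof f g).

Lemma rcol_subproof (P M N : rep) (f : rhom M P) (g : rhom N P) :
  @rep_commutes (rdsum M N) P (fun x => col_mx (rmap f x) (rmap g x)).
Proof.
by move=> h /=; rewrite mul_block_col !mul0mx addr0 add0r mul_col_mx !rmapC.
Qed.
Definition rcol (P M N : rep) (f : rhom M P) (g : rhom N P) : rhom (rdsum M N) P :=
  mk_rhom (rcol_subproof f g).

Lemma rmap_row (P M N : rep) (f : rhom P M) (g : rhom P N) x :
  rmap (rrow f g) x = row_mx (rmap f x) (rmap g x).
Proof. by []. Qed.
Lemma rmap_col (P M N : rep) (f : rhom M P) (g : rhom N P) x :
  rmap (rcol f g) x = col_mx (rmap f x) (rmap g x).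
Proof. by []. Qed.

Record cplx := Cplx {
  cob :> int -> rep_cat;
  cd : forall i, Mor (cob i) (cob (i + 1));
  cdd : forall i, cd i ;; cd (i + 1) = 0;
  cbnd : exists b : nat, forall i, (b < `|i|)%N -> forall x, rdim (cob i) x = 0%N
}.

Definition chain_cond (X Y : cplx) (f : forall i, @Mor k rep_cat (X i) (Y i)) : Prop :=
  forall i, cd X i ;; f (i + 1) = f i ;; cd Y i.
Lemma chain_cond0 X Y : @chain_cond X Y (fun i => 0).
Proof. by move=> i; rewrite comp0m compm0. Qed.
Lemma chain_condP X Y c f g : @chain_cond X Y f -> chain_cond g ->
  @chain_cond X Y (fun i => c *: f i + g i).
Proof. by move=> Cf Cg i; rewrite compPl compPr (Cf i) (Cg i). Qed.

Definition chom (X Y : cplx) : lmodType k := family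
  (@LinearCond k int (fun i => @Mor k rep_cat (X i) (Y i)) _
     (@chain_cond0 X Y) (@chain_condP X Y)).
Definition cmap (X Y : cplx) (f : chom X Y) i : @Mor k rep_cat (X i) (Y i) := f i.
Definition mk_chom (X Y : cplx) f (Cf : @chain_cond X Y f) : chom X Y :=
  @Family k int _ (@LinearCond k int (fun i => @Mor k rep_cat (X i) (Y i)) _
     (@chain_cond0 X Y) (@chain_condP X Y)) f Cf.

Lemma cmapC (X Y : cplx) (f : chom X Y) i :
  cd X i ;; cmap f (i + 1) = cmap f i ;; cd Y i.
Proof. exact: (fappP f i). Qed.
Lemma chomP (X Y : cplx) (f g : chom X Y) : (forall i, cmap f i = cmap g i) -> f = g.
Proof. exact: familyP. Qed.

Lemma cid_subproof X : @chain_cond X X (fun i => idm (X i)).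
Proof. by move=> i; rewrite comp1m compm1. Qed.
Definition cid X : chom X X := mk_chom (@cid_subproof X).
Lemma ccomp_subproof X Y Z (f : chom X Y) (g : chom Y Z) :
  @chain_cond X Z (fun i => cmap f i ;; cmap g i).
Proof. by move=> i; rewrite compA cmapC -!compA cmapC. Qed.
Definition ccomp X Y Z (f : chom X Y) (g : chom Y Z) : chom X Z :=
  mk_chom (ccomp_subproof f g).

Lemma ccompA X Y Z T (f : chom X Y) (g : chom Y Z) (h : chom Z T) :
  ccomp f (ccomp g h) = ccomp (ccomp f g) h.
Proof. by apply: chomP => i; apply: (@compA k rep_cat). Qed.
Lemma ccomp1m X Y (f : chom X Y) : ccomp (cid X) f = f.
Proof. by apply: chomP => i; apply: (@comp1m k rep_cat). Qed.
Lemma ccompm1 X Y (f : chom X Y) : ccomp f (cid Y) = f.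
Proof. by apply: chomP => i; apply: (@compm1 k rep_cat). Qed.
Lemma ccompPl X Y Z c (f f' : chom X Y) (g : chom Y Z) :
  ccomp (c *: f + f') g = c *: ccomp f g + ccomp f' g.
Proof. by apply: chomP => i; apply: (@compPl k rep_cat). Qed.
Lemma ccompPr X Y Z c (f : chom X Y) (g g' : chom Y Z) :
  ccomp f (c *: g + g') = c *: ccomp f g + ccomp f g'.
Proof. by apply: chomP => i; apply: (@compPr k rep_cat). Qed.

Definition cplx_cat : lincat k := LinCat ccompA ccomp1m ccompm1 ccompPl ccompPr.
Implicit Types X Y Z : cplx_cat.

Lemma cmapM X Y Z (f : Mor X Y) (g : Mor Y Z) i : cmap (f ;; g) i = cmap f i ;; cmap g i.
Proof. by []. Qed.
Lemma cmapD X Y (f g : Mor X Y) i : cmap (f + g) i = cmap f i + cmap g i.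
Proof. by []. Qed.
Lemma cmapZ X Y c (f : Mor X Y) i : cmap (c *: f) i = c *: cmap f i.
Proof. by []. Qed.
Lemma cmap0 X Y i : cmap (0 : Mor X Y) i = 0. Proof. by []. Qed.
Lemma cmap1 X i : cmap (idm X) i = idm (X i). Proof. by []. Qed.
Lemma cmapN X Y (f : Mor X Y) i : cmap (- f) i = - cmap f i.
Proof. by rewrite -scaleN1r cmapZ scaleN1r. Qed.
Lemma cmapB X Y (f g : Mor X Y) i : cmap (f - g) i = cmap f i - cmap g i.
Proof. by rewrite cmapD cmapN. Qed.

Definition null_homotopic X Y (f : Mor X Y) : Prop :=
  exists h : forall i, @Mor k rep_cat (X (i + 1)) (Y i),
    forall i, cmap f (i + 1) = h i ;; cd Y i + cd X (i + 1) ;; h (i + 1).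

Lemma nullh0 X Y : null_homotopic (0 : Mor X Y).
Proof. by exists (fun i => 0) => i; rewrite comp0m compm0 addr0. Qed.
Lemma nullhP X Y c (f g : Mor X Y) :
  null_homotopic f -> null_homotopic g -> null_homotopic (c *: f + g).
Proof.
move=> [h Hh] [h' Hh']; exists (fun i => c *: h i + h' i) => i.
by rewrite cmapD cmapZ Hh Hh' compPl compPr scalerDr addrACA.
Qed.
Lemma nullhMl X Y Z (f : Mor X Y) (g : Mor Y Z) :
  null_homotopic f -> null_homotopic (f ;; g).
Proof.
move=> [h Hh]; exists (fun i => h i ;; cmap g i) => i.
by rewrite cmapM Hh compDl !compA -!compA cmapC.
Qed.
Lemma nullhMr X Y Z (f : Mor X Y) (g : Mor Y Z) :
  null_homotopic g -> null_homotopic (f ;; g).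
Proof.
move=> [h Hh]; exists (fun i => cmap f (i + 1) ;; h i) => i.
by rewrite cmapM Hh compDr !compA cmapC.
Qed.

Definition null_ideal : ideal cplx_cat :=
  @Ideal k cplx_cat (fun X Y => SubMod (@nullh0 X Y) (@nullhP X Y)) nullhMl nullhMr.

Definition homotopy_cat : lincat k := quotient_cat null_ideal.

Lemma bnd_max (X Y : cplx) : exists b : nat, forall i, (b < `|i|)%N -> forall x,
  rdim (X i) x = 0%N /\ rdim (Y i) x = 0%N.
Proof.
have [b Hb] := cbnd X; have [b' Hb'] := cbnd Y; exists (maxn b b') => i.
by rewrite gtn_max => /andP[h1 h2] x; rewrite Hb ?Hb'.
Qed.

Lemma cdsum_dd (X Y : cplx) i :
  @mcomp k rep_cat _ _ _ (rcol (rrow (cd X i) 0) (rrow 0 (cd Y i)))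
     (rcol (rrow (cd X (i + 1)) 0) (rrow 0 (cd Y (i + 1)))) = 0.
Proof.
apply: rhomP => x; rewrite rmapM !rmap_col !rmap_row !rmap0.
rewrite mul_col_mx !mul_row_col !mul0mx !mul_mx_row !mulmx0 addr0 add0r -!rmapM !cdd.
by rewrite !rmap0 !row_mx0 col_mx0.
Qed.
Lemma cdsum_bnd (X Y : cplx) : exists b : nat, forall i, (b < `|i|)%N ->
  forall x, rdim (rdsum (X i) (Y i)) x = 0%N.
Proof.
have [b Hb] := bnd_max X Y; exists b => i /Hb H x.
by rewrite /=; have [-> ->] := H x.
Qed.
Definition cdsum (X Y : cplx) : cplx :=
  @Cplx (fun i => rdsum (X i) (Y i))
    (fun i => rcol (rrow (cd X i) 0) (rrow 0 (cd Y i))) (@cdsum_dd X Y) (cdsum_bnd X Y).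

Lemma cone_dd (X Y : cplx) (f : chom X Y) i :
  @mcomp k rep_cat _ _ _
     (rcol (rrow (- cd X (i + 1)) (cmap f (i + 1))) (rrow 0 (cd Y i)))
     (rcol (rrow (- cd X (i + 1 + 1)) (cmap f (i + 1 + 1))) (rrow 0 (cd Y (i + 1)))) = 0.
Proof.
apply: rhomP => x; rewrite rmapM !rmap_col !rmap_row !rmap0 !rmapN.
rewrite mul_col_mx !mul_row_col !mul0mx !mul_mx_row !mulmx0 !add0r -!rmapM !cdd.
rewrite add_row_mx addr0 mulmxN !mulNmx opprK -!rmapM cdd cmapC addNr.
by rewrite !rmap0 !row_mx0 col_mx0.
Qed.
Lemma cone_bnd (X Y : cplx) : exists b : nat, forall i, (b < `|i|)%N ->
  forall x, rdim (rdsum (X (i + 1)) (Y i)) x = 0%N.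
Proof.
have [b Hb] := bnd_max X Y; exists b.+1 => i hi x /=.
have hi1 : (b < `|(i + 1)%R|)%N by lia.
have hi2 : (b < `|i|)%N by lia.
by have [-> _] := Hb _ hi1 x; have [_ ->] := Hb _ hi2 x.
Qed.
Definition cone (X Y : cplx) (f : chom X Y) : cplx :=
  @Cplx (fun i => rdsum (X (i + 1)) (Y i))
    (fun i => rcol (rrow (- cd X (i + 1)) (cmap f (i + 1))) (rrow 0 (cd Y i)))
    (cone_dd f) (cone_bnd X Y).

Lemma cone_in_subproof (X Y : cplx) (f : chom X Y) :
  @chain_cond Y (cone f) (fun i => rrow 0 (idm (Y i))).
Proof.
move=> i; apply: rhomP => x; rewrite !rmapM rmap_col !rmap_row !rmap0 !rmap1.
by rewrite mul_row_col mul_mx_row mul0mx add0r mul1mx mulmx0 mulmx1.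
Qed.
Definition cone_in (X Y : cplx) (f : chom X Y) : chom Y (cone f) :=
  mk_chom (cone_in_subproof f).

Definition cocycle X i x (u : 'rV[k]_(rdim (X i) x)) : Prop :=
  u *m rmap (cd X i) x = 0.
Definition coboundary X i x (u : 'rV[k]_(rdim (X (i + 1)) x)) : Prop :=
  exists w, u = w *m rmap (cd X i) x.

(* Injectivity and surjectivity of H^(i+1)(f) at every vertex x. *)
Definition quasi_iso X Y (f : Mor X Y) : Prop := forall i x,
  (forall u, cocycle u -> coboundary (u *m rmap (cmap f (i + 1)) x) -> coboundary u) /\
  (forall v, cocycle v -> exists u, cocycle u /\
     coboundary (v - u *m rmap (cmap f (i + 1)) x)).

Lemma rcdd X i x : rmap (cd X i) x *m rmap (cd X (i + 1)) x = 0.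
Proof. by rewrite -rmapM cdd. Qed.
Lemma rcmapC X Y (f : Mor X Y) i x :
  rmap (cd X i) x *m rmap (cmap f (i + 1)) x = rmap (cmap f i) x *m rmap (cd Y i) x.
Proof. by rewrite -!rmapM cmapC. Qed.

Lemma cocycle_map X Y (f : Mor X Y) i x (u : 'rV_(rdim (X i) x)) :
  cocycle u -> cocycle (u *m rmap (cmap f i) x).
Proof. by move=> Zu; rewrite /cocycle -mulmxA -rcmapC mulmxA Zu mul0mx. Qed.
Lemma cobound_map X Y (f : Mor X Y) i x (u : 'rV_(rdim (X (i + 1)) x)) :
  coboundary u -> coboundary (u *m rmap (cmap f (i + 1)) x).
Proof.
by case=> w ->; exists (w *m rmap (cmap f i) x); rewrite -!mulmxA rcmapC.
Qed.
Lemma coboundD X i x (u v : 'rV_(rdim (X (i + 1)) x)) :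
  coboundary u -> coboundary v -> coboundary (u + v).
Proof. by case=> [w ->] [w' ->]; exists (w + w'); rewrite mulmxDl. Qed.
Lemma coboundN X i x (u : 'rV_(rdim (X (i + 1)) x)) :
  coboundary u -> coboundary (- u).
Proof. by case=> [w ->]; exists (- w); rewrite mulNmx. Qed.
Lemma coboundB X i x (u v : 'rV_(rdim (X (i + 1)) x)) :
  coboundary u -> coboundary v -> coboundary (u - v).
Proof. by move=> Bu /coboundN; apply: coboundD. Qed.

Lemma cobound_nullh X Y (f : Mor X Y) i x (u : 'rV_(rdim (X (i + 1)) x)) :
  null_homotopic f -> cocycle u -> coboundary (u *m rmap (cmap f (i + 1)) x).
Proof.
case=> h Hh Zu; exists (u *m rmap (h i) x).
by rewrite Hh rmapD !rmapM mulmxDr !mulmxA Zu mul0mx addr0.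
Qed.

Lemma qis_htpy X Y (f g : Mor X Y) :
  null_homotopic (f - g) -> quasi_iso f -> quasi_iso g.
Proof.
move=> Hfg Qf i x; have [fI fS] := Qf i x.
have key u : cocycle u -> coboundary (u *m rmap (cmap f (i + 1)) x
                                       - u *m rmap (cmap g (i + 1)) x).
  move=> Zu; have := cobound_nullh Hfg Zu.
  by rewrite cmapB rmapD rmapN mulmxDr mulmxN.
split=> [u Zu Bu|v /fS[u [Zu Bu]]].
  by apply: fI => //; have := coboundD (key u Zu) Bu; rewrite subrK.
by exists u; split=> //; have := coboundD Bu (key u Zu); rewrite addrA subrK.
Qed.

Lemma qis_id X : quasi_iso (idm X).
Proof.
move=> i x; rewrite cmap1 rmap1.
split=> [u _|v Zv]; rewrite ?mulmx1 //; exists v; split=> //.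
by exists 0; rewrite mulmx1 subrr mul0mx.
Qed.

Lemma qis_comp X Y Z (f : Mor X Y) (g : Mor Y Z) :
  quasi_iso f -> quasi_iso g -> quasi_iso (f ;; g).
Proof.
move=> Qf Qg i x; have [fI fS] := Qf i x; have [gI gS] := Qg i x.
rewrite cmapM rmapM; split=> [u Zu|v /gS[u [/fS[w [Zw Bw]] Bu]]].
  by rewrite mulmxA => /(gI _ (cocycle_map _ Zu)); apply: fI.
exists w; split=> //; have := coboundD Bu (cobound_map g Bw).
by rewrite mulmxBl addrA subrK mulmxA.
Qed.

Lemma qis_cancel X Y Z (f : Mor X Y) (g : Mor Y Z) :
  quasi_iso f -> quasi_iso (f ;; g) -> quasi_iso g.
Proof.
move=> Qf Qg i x; have [fI fS] := Qf i x; have [gI gS] := Qg i x.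
rewrite cmapM rmapM in gI gS; split=> [v Zv Bv|v /gS[u [Zu Bu]]].
  have [u [Zu Bu]] := fS v Zv.
  suff Bu' : coboundary u by have := coboundD Bu (cobound_map f Bu'); rewrite subrK.
  apply: gI => //; have := coboundB Bv (cobound_map g Bu).
  by rewrite mulmxBl mulmxA opprB addrC subrK.
by exists (u *m rmap (cmap f (i + 1)) x); rewrite -mulmxA; split=> //; apply: cocycle_map.
Qed.

Lemma cone_mul X Y (f : Mor X Y) i x (u : 'rV_(rdim (X (i + 1)) x)) (v : 'rV_(rdim (Y i) x)) :
  row_mx u v *m rmap (cd (cone f) i) x =
  row_mx (- (u *m rmap (cd X (i + 1)) x))
         (u *m rmap (cmap f (i + 1)) x + v *m rmap (cd Y i) x).
Proof.
rewrite [cd _ _]/(rcol _ _) rmap_col !rmap_row rmap0 rmapN.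
by rewrite mul_row_col !mul_mx_row add_row_mx mulmx0 addr0 mulmxN.
Qed.

Lemma zmod_swap (U : zmodType) (a b c : U) : c = a - b + (b + c - a).
Proof. by rewrite [RHS]addrC addrA subrK [RHS]addrC addKr. Qed.

Lemma cone_acyclic X Y (f : Mor X Y) i x (w : 'rV_(rdim (cone f (i + 1)) x)) :
  quasi_iso f -> cocycle w -> coboundary w.
Proof.
move=> Qf; rewrite -[w]hsubmxK; set u := lsubmx w; set v := rsubmx w.
rewrite /cocycle cone_mul -[0]row_mx0 => /eq_row_mx[/eqP]; rewrite oppr_eq0 => /eqP Zu E.
have [|p Hp] := (Qf (i + 1) x).1 u Zu.
  by exists (- v); rewrite mulNmx; apply/eqP; rewrite -addr_eq0 E.
have [|q [Zq [r Hr]]] := (Qf i x).2 (p *m rmap (cmap f (i + 1)) x + v).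
  by rewrite /cocycle mulmxDl -mulmxA -rcmapC mulmxA -Hp.
exists (row_mx (q - p) r); rewrite cone_mul; congr row_mx.
  by rewrite mulmxBl Zq sub0r opprK.
by rewrite mulmxBl -Hr; apply: zmod_swap.
Qed.

Lemma crow_subproof X Y Z (f : Mor X Y) (g : Mor X Z) :
  @chain_cond X (cdsum Y Z) (fun i => rrow (cmap f i) (cmap g i)).
Proof.
move=> i; apply: rhomP => x; rewrite !rmapM rmap_col !rmap_row !rmap0.
by rewrite mul_row_col !mul_mx_row add_row_mx !mulmx0 addr0 add0r !rcmapC.
Qed.
Definition crow X Y Z (f : Mor X Y) (g : Mor X Z) : @Mor k cplx_cat X (cdsum Y Z) :=
  mk_chom (crow_subproof f g).

Lemma cmap_crow X Y Z (f : Mor X Y) (g : Mor X Z) i :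
  cmap (crow f g) i = rrow (cmap f i) (cmap g i).
Proof. by []. Qed.
Lemma cmap_cone_in X Y (f : Mor X Y) i : cmap (cone_in f) i = rrow 0 (idm (Y i)).
Proof. by []. Qed.

Lemma row3P m n p (w : 'rV[k]_(m + (n + p))) :
  exists u v z, w = row_mx u (row_mx v z).
Proof. by exists (lsubmx w), (lsubmx (rsubmx w)), (rsubmx (rsubmx w)); rewrite !hsubmxK. Qed.

Lemma row3_eq0 m n p (u : 'rV[k]_m) (v : 'rV[k]_n) (z : 'rV[k]_p) :
  row_mx u (row_mx v z) = 0 -> [/\ u = 0, v = 0 & z = 0].
Proof.
rewrite -[0]row_mx0 => /eq_row_mx[-> E]; rewrite -[0]row_mx0 in E.
by case/eq_row_mx: E => -> ->.
Qed.

Lemma qis_ore_chain X Y Z (s : Mor X Y) (f : Mor X Z) : quasi_iso s ->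
  exists (T : cplx_cat) (g : Mor Y T) (t : Mor Z T),
    quasi_iso t /\ null_homotopic (s ;; g - f ;; t).
Proof.
move=> Qs; pose j := crow s (- f).
pose g : @Mor k cplx_cat Y (cone j) := crow (idm Y) (0 : Mor Y Z) ;; cone_in j.
pose t : @Mor k cplx_cat Z (cone j) := crow (0 : Mor Z Y) (idm Z) ;; cone_in j.
have gE i x : rmap (cmap g i) x = row_mx 0 (row_mx 1%:M 0).
  rewrite cmapM rmapM cmap_crow cmap_cone_in !rmap_row cmap0 cmap1 !rmap0 !rmap1.
  by rewrite mul_mx_row mulmx0 mulmx1.
have tE i x : rmap (cmap t i) x = row_mx 0 (row_mx 0 1%:M).
  rewrite cmapM rmapM cmap_crow cmap_cone_in !rmap_row cmap0 cmap1 !rmap0 !rmap1.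
  by rewrite mul_mx_row mulmx0 mulmx1.
have dE i x (u : 'rV_(rdim (X (i + 1)) x)) (v : 'rV_(rdim (Y i) x)) (w : 'rV_(rdim (Z i) x)) :
    row_mx u (row_mx v w) *m rmap (cd (cone j) i) x =
    row_mx (- (u *m rmap (cd X (i + 1)) x))
      (row_mx (u *m rmap (cmap s (i + 1)) x + v *m rmap (cd Y i) x)
              (- (u *m rmap (cmap f (i + 1)) x) + w *m rmap (cd Z i) x)).
  apply: etrans (cone_mul _ _ _) _; congr row_mx.
  rewrite cmap_crow [cd (cdsum _ _) _]/(rcol _ _) rmap_col !rmap_row !rmap0 cmapN rmapN.
  by rewrite mul_row_col !mul_mx_row !add_row_mx !mulmx0 addr0 add0r mulmxN.
exists (cone j), g, t; split.
  move=> i x; rewrite tE; split=> [z Zz|w].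
    rewrite !mul_mx_row !mulmx0 mulmx1 => -[w].
    have [u [v [z' ->]]] := row3P w.
    rewrite dE => /eq_row_mx[Zu /eq_row_mx[E1 E2]].
    move/esym/eqP: Zu; rewrite oppr_eq0 => /eqP Zu.
    have [|p Hp] := (Qs i x).1 u Zu.
      by exists (- v); rewrite mulNmx; apply/eqP; rewrite -addr_eq0 -E1.
    exists (z' - p *m rmap (cmap f i) x).
    by rewrite E2 mulmxBl -mulmxA -rcmapC mulmxA -Hp; apply: addrC.
  have [u [v [z ->]]] := row3P w.
  rewrite /cocycle dE => /row3_eq0[Zu E1 E2].
  move/eqP: Zu; rewrite oppr_eq0 => /eqP Zu.
  have [|p Hp] := (Qs (i + 1) x).1 u Zu.
    by exists (- v); rewrite mulNmx; apply/eqP; rewrite -addr_eq0 E1.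
  have [|q [Zq [r Hr]]] := (Qs i x).2 (p *m rmap (cmap s (i + 1)) x + v).
    by rewrite /cocycle mulmxDl -mulmxA -rcmapC mulmxA -Hp.
  exists (z + (q - p) *m rmap (cmap f (i + 1)) x); split.
    rewrite /cocycle mulmxDl -mulmxA -rcmapC mulmxA mulmxBl Zq sub0r -Hp mulNmx [LHS]addrC.
    exact: E2.
  exists (row_mx (q - p) (row_mx r 0)); rewrite dE mul0mx addr0.
  rewrite !mul_mx_row !mulmx0 mulmx1 opp_row_mx opp_row_mx !add_row_mx !oppr0 !addr0.
  congr row_mx; first by rewrite mulmxBl Zq sub0r opprK.
  congr row_mx; last by rewrite opprD addNKr.
  by rewrite mulmxBl -Hr; apply: zmod_swap.
exists (fun i => rrow (idm (X (i + 1))) 0) => i.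
apply: rhomP => x; rewrite cmapB (cmapM s g) (cmapM f t) rmapD rmapN.
rewrite (rmapM (cmap s _) (cmap g _)) (rmapM (cmap f _) (cmap t _)) gE tE.
rewrite rmapD !rmapM !rmap_row rmap1 !rmap0.
rewrite [cd (cone j) _]/(rcol _ _) rmap_col !rmap_row !rmap0 rmapN.
rewrite mul_row_col mul1mx mul0mx addr0 !mul_mx_row !mulmx0 !mulmx1.
by rewrite cmapN rmapN !opp_row_mx !add_row_mx !oppr0 !addr0 addNr add0r.
Qed.

Lemma qis_cancel_chain X Y Z (s : Mor X Y) (f : Mor Y Z) :
  quasi_iso s -> null_homotopic (s ;; f) ->
  exists (T : cplx_cat) (t : Mor Z T), quasi_iso t /\ null_homotopic (f ;; t).
Proof.
move=> Qs [h Hh].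
have Cp : @chain_cond (cone s) Z (fun i => rcol (h i) (cmap f i)).
  move=> i; apply: rhomP => x; rewrite !rmapM !rmap_col !rmap_row rmap0 rmapN.
  rewrite mul_col_mx !mul_row_col mul0mx add0r mul_col_mx rcmapC mulNmx -!rmapM -cmapM Hh.
  by congr col_mx; rewrite rmapD [LHS]addrC addrK.
pose p : @Mor k cplx_cat (cone s) Z := mk_chom Cp.
have Q0 : quasi_iso (0 : @Mor k cplx_cat (cone s) (cone s)).
  move=> i x; split=> [u Zu _|v Zv]; first exact: cone_acyclic.
  exists 0; split; first by rewrite /cocycle mul0mx.
  by rewrite mul0mx subr0; apply: cone_acyclic.
have [T [g [t [Qt Ht]]]] := qis_ore_chain p Q0.
exists T, t; split=> //.
have -> : f ;; t = - (cone_in s : @Mor k cplx_cat Y (cone s)) ;; (0 ;; g - p ;; t).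
  rewrite comp0m sub0r compNl compNr opprK compA; congr (_ ;; _).
  apply: chomP => i; apply: rhomP => x; rewrite cmapM rmapM.
  rewrite cmap_cone_in [cmap p i]/(rcol _ _) rmap_row rmap_col.
  by rewrite rmap0 rmap1 mul_row_col mul0mx mul1mx add0r.
exact: nullhMr.
Qed.

Definition kqis X Y (f : @Mor k homotopy_cat X Y) : Prop := quasi_iso (repr f).

Lemma kqisE X Y (f : Mor X Y) : kqis (qcls null_ideal f) <-> quasi_iso f.
Proof.
have H := qreprP (imem null_ideal X Y) f.
split; first exact: qis_htpy.
by apply: qis_htpy; rewrite -opprB; apply: (@smemN _ _ (imem null_ideal X Y)).
Qed.

Lemma kqis_id X : kqis (@idm k homotopy_cat X).
Proof. by apply/kqisE; apply: qis_id. Qed.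
Lemma kqis_comp X Y Z (s : @Mor k homotopy_cat X Y) (t : @Mor k homotopy_cat Y Z) :
  kqis s -> kqis t -> kqis (s ;; t).
Proof. by move=> Qs Qt; apply/kqisE; apply: qis_comp. Qed.
Lemma kqis_cancel X Y Z (s : @Mor k homotopy_cat X Y) (t : @Mor k homotopy_cat Y Z) :
  kqis s -> kqis (s ;; t) -> kqis t.
Proof. by move=> Qs /kqisE; apply: qis_cancel. Qed.
Lemma kqis_ore X Y Z (s : @Mor k homotopy_cat X Y) (f : @Mor k homotopy_cat X Z) :
  kqis s -> exists T (g : @Mor k homotopy_cat Y T) (t : @Mor k homotopy_cat Z T),
    kqis t /\ s ;; g = f ;; t.
Proof.
elim/qpiW: s => s; elim/qpiW: f => f /kqisE Qs.
have [T [g [t [Qt H]]]] := qis_ore_chain f Qs.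
exists T, (qcls null_ideal g), (qcls null_ideal t); split; first exact/kqisE.
rewrite [LHS]qcompE [RHS]qcompE; exact/qpiP.
Qed.
Lemma kqis_wcancel X Y Z (s : @Mor k homotopy_cat X Y) (f : @Mor k homotopy_cat Y Z) :
  kqis s -> s ;; f = 0 ->
  exists T (t : @Mor k homotopy_cat Z T), kqis t /\ f ;; t = 0.
Proof.
elim/qpiW: s => s; elim/qpiW: f => f /kqisE Qs.
rewrite [X in X = _]qcompE => /qpiP; rewrite subr0 => H.
have [T [t [Qt Ht]]] := qis_cancel_chain Qs H.
exists T, (qcls null_ideal t); split; first exact/kqisE.
by rewrite [X in X = _]qcompE; apply/qpiP; rewrite subr0.
Qed.

Definition quasi_isos : left_system homotopy_cat :=
  @LeftSystem k homotopy_cat kqis kqis_id kqis_comp kqis_cancel kqis_ore kqis_wcancel.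

Definition Db : lincat k := localization quasi_isos.

Definition in_Db X Y (f : chom X Y) : @Mor k Db X Y :=
  loc quasi_isos (qcls null_ideal f).

(* The identity transported along i = j; the junk value 0 is never used. *)
Definition eqr X i j : @Mor k rep_cat (X i) (X j) :=
  match i =P j with
  | ReflectT e => eq_rect i (fun j => @Mor k rep_cat (X i) (X j) : Type) (idm (X i)) j e
  | ReflectF _ => 0
  end.

Lemma eqr_id X i : eqr X i i = idm (X i).
Proof.
by rewrite /eqr; case: eqP => // e; rewrite (eq_irrelevance e erefl).
Qed.

Lemma shift_dd X (c c' : k) a b d : a + 1 = b ->
  (c *: (cd X a ;; eqr X (a + 1) b)) ;; (c' *: (cd X b ;; eqr X (b + 1) d)) = 0.
Proof.
move=> <-; rewrite eqr_id compm1 compZl compZr compA cdd comp0m.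
by rewrite !scaler0.
Qed.
Lemma shift_C X Y (f : Mor X Y) (c : k) a b : a + 1 = b ->
  (c *: (cd X a ;; eqr X (a + 1) b)) ;; cmap f b =
  cmap f a ;; (c *: (cd Y a ;; eqr Y (a + 1) b)).
Proof. by move=> <-; rewrite !eqr_id !compm1 compZl compZr cmapC. Qed.
Lemma shift_qis X Y (f : Mor X Y) (c : k) a b d x :
  c != 0 -> a + 1 = b -> b + 1 = d -> quasi_iso f ->
  (forall u : 'rV_(rdim (X b) x), u *m rmap (c *: (cd X b ;; eqr X (b + 1) d)) x = 0 ->
     (exists w : 'rV_(rdim (Y a) x),
        u *m rmap (cmap f b) x = w *m rmap (c *: (cd Y a ;; eqr Y (a + 1) b)) x) ->
     exists w : 'rV_(rdim (X a) x), u = w *m rmap (c *: (cd X a ;; eqr X (a + 1) b)) x) /\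
  (forall v : 'rV_(rdim (Y b) x), v *m rmap (c *: (cd Y b ;; eqr Y (b + 1) d)) x = 0 ->
     exists u : 'rV_(rdim (X b) x), u *m rmap (c *: (cd X b ;; eqr X (b + 1) d)) x = 0 /\
     exists w : 'rV_(rdim (Y a) x),
       v - u *m rmap (cmap f b) x = w *m rmap (c *: (cd Y a ;; eqr Y (a + 1) b)) x).
Proof.
move=> c0 <- <- Qf; have [fI fS] := Qf a x; rewrite !eqr_id !compm1 !rmapZ.
have Zc (T : cplx) i (u : 'rV_(rdim (T i) x)) :
    u *m (c *: rmap (cd T i) x) = 0 <-> @cocycle T i x u.
  rewrite /cocycle -scalemxAr; split=> [/eqP|->]; last exact: scaler0.
  by rewrite scaler_eq0 (negPf c0) => /eqP.
have Bc (T : cplx) i (u : 'rV_(rdim (T (i + 1)) x)) :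
    (exists w, u = w *m (c *: rmap (cd T i) x)) <-> @coboundary T i x u.
  split=> -[w ->]; first by exists (c *: w); rewrite -scalemxAr -scalemxAl.
  by exists (c^-1 *: w); rewrite -scalemxAr -scalemxAl scalerA divff // scale1r.
split=> [u /Zc Zu /Bc Bu|v /Zc/fS[u [Zu Bu]]]; first by apply/Bc; apply: fI.
by exists u; split; [apply/Zc | apply/Bc].
Qed.

Lemma shift_idx (i n : int) : i + n + 1 = i + 1 + n.
Proof. exact: addrAC. Qed.

Lemma cshift_dd X (n : int) i :
  (((-1) ^+ `|n| : k) *: (cd X (i + n) ;; eqr X (i + n + 1) (i + 1 + n))) ;;
  (((-1) ^+ `|n| : k) *: (cd X (i + 1 + n) ;; eqr X (i + 1 + n + 1) (i + 1 + 1 + n))) = 0.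
Proof. by apply: shift_dd; apply: shift_idx. Qed.
Lemma cshift_bnd X (n : int) : exists b : nat, forall i, (b < `|i|)%N ->
  forall x, rdim (X (i + n)) x = 0%N.
Proof.
have [b Hb] := cbnd X; exists (b + `|n|)%N => i hi x; apply: Hb; lia.
Qed.
Definition cshift X (n : int) : cplx :=
  @Cplx (fun i => X (i + n))
    (fun i => ((-1) ^+ `|n| : k) *: (cd X (i + n) ;; eqr X (i + n + 1) (i + 1 + n)))
    (@cshift_dd X n) (cshift_bnd X n).

Lemma cshift_map_subproof X Y (f : Mor X Y) n :
  @chain_cond (cshift X n) (cshift Y n) (fun i => cmap f (i + n)).
Proof. by move=> i; exact: (shift_C f ((-1) ^+ `|n|) (shift_idx i n)). Qed.
Definition cshift_map X Y (f : Mor X Y) n : chom (cshift X n) (cshift Y n) :=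
  mk_chom (cshift_map_subproof f n).

Lemma cshift_qis X Y (f : Mor X Y) n :
  quasi_iso f -> quasi_iso (cshift_map f n : @Mor k cplx_cat _ _).
Proof.
move=> Qf i x; have c0 : ((-1) ^+ `|n| : k) != 0 by rewrite signr_eq0.
exact: (shift_qis x c0 (shift_idx i n) (shift_idx (i + 1) n) Qf).
Qed.

Definition kshift X Y (f : @Mor k homotopy_cat X Y) n :
    @Mor k homotopy_cat (cshift X n) (cshift Y n) :=
  qcls null_ideal (cshift_map (repr f) n).
Lemma shift_nullh X Y (f : Mor X Y) (h : forall i, @Mor k rep_cat (X (i + 1)) (Y i))
    (c : k) a b d :
  c * c = 1 -> a + 1 = b -> b + 1 = d ->
  (forall i, cmap f (i + 1) = h i ;; cd Y i + cd X (i + 1) ;; h (i + 1)) ->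
  cmap f b =
    (c *: (eqr X b (a + 1) ;; h a)) ;; (c *: (cd Y a ;; eqr Y (a + 1) b)) +
    (c *: (cd X b ;; eqr X (b + 1) d)) ;; (c *: (eqr X d (b + 1) ;; h b)).
Proof.
move=> cc <- <- Hh; rewrite !eqr_id !compm1 !comp1m !(compZl, compZr) !scalerA cc.
by rewrite !scale1r.
Qed.
Lemma cshift_nullh X Y (f : Mor X Y) n : null_homotopic f ->
  null_homotopic (cshift_map f n : @Mor k cplx_cat _ _).
Proof.
case=> h Hh; have cc : ((-1) ^+ `|n| : k) * (-1) ^+ `|n| = 1 by rewrite -expr2 sqrr_sign.
exists (fun i => ((-1) ^+ `|n| : k) *: (eqr X (i + 1 + n) (i + n + 1) ;; h (i + n))) => i.
exact: (shift_nullh cc (shift_idx i n) (shift_idx (i + 1) n) Hh).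
Qed.
Lemma kshiftE X Y (f : Mor X Y) n :
  kshift (qcls null_ideal f) n = qcls null_ideal (cshift_map f n).
Proof.
apply/qpiP; have := cshift_nullh n (qreprP (imem null_ideal X Y) f).
congr null_homotopic; apply: chomP => i; rewrite cmapB.
exact: (cmapB (repr (qcls null_ideal f)) f (i + n)).
Qed.
Lemma kshiftM X Y Z (f : @Mor k homotopy_cat X Y) (g : @Mor k homotopy_cat Y Z) n :
  kshift (f ;; g) n = kshift f n ;; kshift g n.
Proof.
elim/qpiW: f => f; elim/qpiW: g => g.
have qcM X' Y' Z' (f' : Mor X' Y') (g' : Mor Y' Z') :
    qcls null_ideal f' ;; qcls null_ideal g' = qcls null_ideal (f' ;; g').
  exact: qcompE.
change (kshift (qcls null_ideal f ;; qcls null_ideal g) n =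
        kshift (qcls null_ideal f) n ;; kshift (qcls null_ideal g) n).
rewrite qcM !kshiftE qcM; congr qcls.
exact: chomP.
Qed.
Lemma kshift_qis X Y (f : @Mor k homotopy_cat X Y) n :
  wmem quasi_isos f -> wmem quasi_isos (kshift f n).
Proof. by move=> Qf; apply/kqisE; apply: cshift_qis. Qed.

Definition shift (X : Db) (n : int) : Db := cshift X n.
Definition shift_map (X Y : Db) (f : Mor X Y) n : Mor (shift X n) (shift Y n) :=
  mkl (kshift (num (repr f)) n) (kshift_qis n (denW (repr f))).

Lemma shift_mapE (X Y M : cplx) (f : @Mor k homotopy_cat X M)
    (s : @Mor k homotopy_cat Y M) (Ws : wmem quasi_isos s) n :
  @shift_map X Y (mkl f Ws) n = mkl (kshift f n) (kshift_qis n Ws).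
Proof.
rewrite /shift_map; set r := repr _.
have : mkl (num r) (denW r) = mkl f Ws.
  by rewrite /mkl; case: r (reprK (mkl f Ws) : cls r = _).
case/mkl_eq=> T [u [u' [Wu Wu' e1 e2]]].
have WP := kshift_qis n (wmemM Ws Wu').
transitivity (mkl (kshift (f ;; u') n) WP).
  by apply: (@mkl_ext _ _ _ _ _ _ _ _ _ _ (kshift u n)); rewrite -kshiftM ?e2 ?e1.
by apply/esym; apply: (@mkl_ext _ _ _ _ _ _ _ _ _ _ (kshift u' n)); rewrite -kshiftM.
Qed.

Lemma cone_out_subproof X Y (f : Mor X Y) :
  @chain_cond (cone f) (cshift X 1) (fun i => rcol (idm (X (i + 1))) 0).
Proof.
move=> i; have -> : cd (cshift X 1) i = - cd X (i + 1).
  have E : ((-1) ^+ 1 : k) *: (cd X (i + 1) ;; eqr X (i + 1 + 1) (i + 1 + 1)) = - cd X (i + 1).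
    by rewrite eqr_id compm1 expr1 scaleN1r.
  exact: E.
apply: rhomP => x; rewrite !rmapM !rmap_col !rmap_row !rmap0 !rmapN !rmap1.
by rewrite !mul_col_mx !mul_row_col !mul0mx !mulmx0 !mulmx1 !mul1mx !addr0.
Qed.
Definition cone_out X Y (f : Mor X Y) : chom (cone f) (cshift X 1) :=
  mk_chom (cone_out_subproof f).

Definition distinguished (A B C : Db) (f : Mor A B) (g : Mor B C) (h : Mor C (shift A 1)) :
    Prop :=
  exists (X Y : cplx) (u : chom X Y)
         (a : @Mor k Db A X) (b : @Mor k Db B Y) (c : @Mor k Db C (cone u)),
    [/\ is_iso a, is_iso b & is_iso c] /\
    [/\ f ;; b = a ;; in_Db u, g ;; c = b ;; in_Db (cone_in u)
      & h ;; shift_map a 1 = c ;; in_Db (cone_out u)].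

Definition dsum (A B : Db) : Db := cdsum A B.

Definition indecomposable (X : Db) : Prop :=
  ~ is_zero X /\
  forall Y Z : Db, isomorphic X (dsum Y Z) -> is_zero Y \/ is_zero Z.

Definition AR_triangle (A B C : Db) (f : Mor A B) (g : Mor B C) (h : Mor C (shift A 1)) :
    Prop :=
  [/\ distinguished f g h, indecomposable A, indecomposable C, h <> 0
    & forall (X : Db) (t : Mor X C), ~ (exists s : Mor C X, s ;; t = idm C) ->
        exists t' : Mor X B, t' ;; g = t].

Definition AR_translate (C A : Db) : Prop :=
  exists (B : Db) (f : Mor A B) (g : Mor B C) (h : Mor C (shift A 1)), AR_triangle f g h.

Definition dim_vector (X : Db) (x : V) : int :=
  \sum_(i \in [set: int]) (-1) ^+ `|i| * (rdim (cob X i) x)%:Z.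

Definition hdim (X Y : Db) (i : int) : nat := dimk [set: Mor X (shift Y i)]%classic.

Definition trunc_euler (X Y : Db) : int :=
  \sum_(i \in [set i : int | i <= 0]%classic) (-1) ^+ `|i| * (hdim X Y i)%:Z.

End Representations.

Definition gdist (V : finType) (e : rel V) (a b : V) : nat :=
  find (fun n => [exists s : n.-tuple V, path e a s && (last a s == b)]) (iota 0 #|V|).

Section MeshCategory.
Variables (V : finType) (e : rel V) (x0 : V).

Definition parity_eq (u w : int * V) : bool :=
  ~~ odd `|(w.1 - u.1 + (gdist e u.2 w.2)%:Z)%R|.

Definition zvertex := {u : int * V | parity_eq (0, x0) u}.
Definition zmesh := {u : int * V | ~~ parity_eq (0, x0) u}.

Definition zarrow (x y : zvertex) : bool :=
  e (val x).2 (val y).2 && ((val y).1 == (val x).1 + 1).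

Lemma mesh_src_subproof (m : zmesh) : parity_eq (0, x0) ((val m).1 - 1, (val m).2).
Proof. by case: m => -[p a]; rewrite /parity_eq /=; lia. Qed.
Lemma mesh_tgt_subproof (m : zmesh) : parity_eq (0, x0) ((val m).1 + 1, (val m).2).
Proof. by case: m => -[p a]; rewrite /parity_eq /=; lia. Qed.
Definition mesh_src (m : zmesh) : zvertex := Sub _ (mesh_src_subproof m).
Definition mesh_tgt (m : zmesh) : zvertex := Sub _ (mesh_tgt_subproof m).

Definition mesh_mid (m : zmesh) :=
  {y : zvertex | zarrow (mesh_src m) y && zarrow y (mesh_tgt m)}.
Definition mesh_mids (m : zmesh) : seq (mesh_mid m) :=
  pmap insub (pmap (insub : int * V -> option zvertex) [seq ((val m).1, b) | b <- enum V]).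

Lemma mid_in (m : zmesh) (y : mesh_mid m) : zarrow (mesh_src m) (val y).
Proof. by case/andP: (valP y). Qed.
Lemma mid_out (m : zmesh) (y : mesh_mid m) : zarrow (val y) (mesh_tgt m).
Proof. by case/andP: (valP y). Qed.

Variable k : fieldType.

(* Morphisms of the mesh category are written as expressions in the arrows,
   identified by [mesh_eq], the least congruence of linear categories
   containing the mesh relations. *)
Inductive mesh_expr : zvertex -> zvertex -> Type :=
| MId x : mesh_expr x x
| MArr x y of zarrow x y : mesh_expr x y
| MComp x y z of mesh_expr x y & mesh_expr y z : mesh_expr x z
| MZero x y : mesh_expr x y
| MAdd x y of mesh_expr x y & mesh_expr x y : mesh_expr x y
| MScale x y of k & mesh_expr x y : mesh_expr x y.

Definition mesh_sum (m : zmesh) : mesh_expr (mesh_src m) (mesh_tgt m) :=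
  foldr (@MAdd _ _) (MZero _ _)
    [seq MComp (MArr (mid_in y)) (MArr (mid_out y)) | y <- mesh_mids m].

Inductive mesh_eq : forall x y, mesh_expr x y -> mesh_expr x y -> Prop :=
| mesh_rel m : mesh_eq (mesh_sum m) (MZero _ _)
| mesh_refl x y (s : mesh_expr x y) : mesh_eq s s
| mesh_sym x y (s t : mesh_expr x y) : mesh_eq s t -> mesh_eq t s
| mesh_trans x y (s t u : mesh_expr x y) : mesh_eq s t -> mesh_eq t u -> mesh_eq s u
| mesh_congM x y z (s s' : mesh_expr x y) (t t' : mesh_expr y z) :
    mesh_eq s s' -> mesh_eq t t' -> mesh_eq (MComp s t) (MComp s' t')
| mesh_congD x y (s s' t t' : mesh_expr x y) :
    mesh_eq s s' -> mesh_eq t t' -> mesh_eq (MAdd s t) (MAdd s' t')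
| mesh_congZ x y c (s s' : mesh_expr x y) :
    mesh_eq s s' -> mesh_eq (MScale c s) (MScale c s')
| mesh_compA x y z w (s : mesh_expr x y) (t : mesh_expr y z) (u : mesh_expr z w) :
    mesh_eq (MComp s (MComp t u)) (MComp (MComp s t) u)
| mesh_comp1m x y (s : mesh_expr x y) : mesh_eq (MComp (MId x) s) s
| mesh_compm1 x y (s : mesh_expr x y) : mesh_eq (MComp s (MId y)) s
| mesh_compPl x y z c (s s' : mesh_expr x y) (t : mesh_expr y z) :
    mesh_eq (MComp (MAdd (MScale c s) s') t) (MAdd (MScale c (MComp s t)) (MComp s' t))
| mesh_compPr x y z c (s : mesh_expr x y) (t t' : mesh_expr y z) :
    mesh_eq (MComp s (MAdd (MScale c t) t')) (MAdd (MScale c (MComp s t)) (MComp s t'))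
| mesh_addA x y (s t u : mesh_expr x y) :
    mesh_eq (MAdd s (MAdd t u)) (MAdd (MAdd s t) u)
| mesh_addC x y (s t : mesh_expr x y) : mesh_eq (MAdd s t) (MAdd t s)
| mesh_add0 x y (s : mesh_expr x y) : mesh_eq (MAdd (MZero x y) s) s
| mesh_addN x y (s : mesh_expr x y) : mesh_eq (MAdd (MScale (-1) s) s) (MZero x y)
| mesh_scaleA x y a b (s : mesh_expr x y) :
    mesh_eq (MScale a (MScale b s)) (MScale (a * b) s)
| mesh_scale1 x y (s : mesh_expr x y) : mesh_eq (MScale 1 s) s
| mesh_scaleDr x y a (s t : mesh_expr x y) :
    mesh_eq (MScale a (MAdd s t)) (MAdd (MScale a s) (MScale a t))
| mesh_scaleDl x y a b (s : mesh_expr x y) :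
    mesh_eq (MScale (a + b) s) (MAdd (MScale a s) (MScale b s)).

Fixpoint mesh_eval (C : lincat k) (v : zvertex -> C)
    (phi : forall x y, zarrow x y -> Mor (v x) (v y)) x y (s : mesh_expr x y) :
    Mor (v x) (v y) :=
  match s with
  | MId x => idm (v x)
  | MArr x y h => phi x y h
  | MComp x y z s t => mesh_eval phi s ;; mesh_eval phi t
  | MZero x y => 0
  | MAdd x y s t => mesh_eval phi s + mesh_eval phi t
  | MScale x y c s => c *: mesh_eval phi s
  end.

Variable Q : quiver V.

(* [phi] defines an equivalence from the mesh category to the category of
   indecomposable objects of the derived category, given on objects by [v]. *)
Definition mesh_equivalence (v : zvertex -> Db k Q)
    (phi : forall x y, zarrow x y -> Mor (v x) (v y)) : Prop :=
  [/\ forall x y (s t : mesh_expr x y), mesh_eq s t -> mesh_eval phi s = mesh_eval phi t,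
      forall x y (s t : mesh_expr x y), mesh_eval phi s = mesh_eval phi t -> mesh_eq s t,
      forall x y (f : Mor (v x) (v y)), exists s, mesh_eval phi s = f,
      forall x, indecomposable (v x)
    & forall X : Db k Q, indecomposable X -> exists x, isomorphic X (v x)].

Definition mesh_identification (v : zvertex -> Db k Q) : Prop :=
  [/\ exists phi, mesh_equivalence (v := v) phi,
      forall x y, isomorphic (v x) (v y) -> x = y
    & forall x y : zvertex, val y = ((val x).1 - 2, (val x).2) ->
        AR_translate (v x) (v y)].

Definition delta_triangle (v : zvertex -> Db k Q) (A C : Db k Q)
    (h : Mor C (shift A 1)) (m : zmesh) : int :=
  (rk_Hom (v (mesh_tgt m)) h)%:Z.

Definition delta_pair (v : zvertex -> Db k Q) (M N : Db k Q) (m : zmesh) : int :=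
  trunc_euler (v (mesh_tgt m)) N - trunc_euler (v (mesh_tgt m)) M.

End MeshCategory.

Inductive dynkin :=
| DynkinA n of (1 <= n)%N
| DynkinD n of (4 <= n)%N
| DynkinE n of (6 <= n <= 8)%N.

Definition dynkin_rank (D : dynkin) : nat :=
  match D with DynkinA n _ => n | DynkinD n _ => n | DynkinE n _ => n end.

(* In types D and E, the vertices 0, ..., n - 2 form a chain and the vertex n - 1
   is attached to n - 3 in type D and to 2 in type E. *)
Definition dynkin_edge (D : dynkin) (i j : nat) : bool :=
  match D with
  | DynkinA n _ => j == i.+1
  | DynkinD n _ => if j == n.-1 then i == n - 3 else j == i.+1
  | DynkinE n _ => if j == n.-1 then i == 2 else j == i.+1
  end%N.

Definition dynkin_graph (D : dynkin) : rel 'I_(dynkin_rank D) :=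
  fun i j => dynkin_edge D i j || dynkin_edge D j i.
Arguments dynkin_graph D : clear implicits.

(* Main.v *)
From HB Require Import structures.
From mathcomp Require Import all_boot all_order all_algebra.
From mathcomp Require Import zify ring.
From mathcomp Require Import boolp classical_sets functions fsbigop.
Require Import Defs.

(** For every object [W] the functor [Hom(W, -)] turns the triangle into a long
    exact sequence; shifting [W] instead of the triangle, the rank [r(W)] of
    [Hom(W, gamma)] satisfies
      [dim Hom(W, A) - dim Hom(W, B) + dim Hom(W, C) = r(W) + r(W[1])],
    and the alternating sum of these identities over [W = V[n]], [n >= 0],
    telescopes to [r(V)] because [Hom(V[n], -)] vanishes for large [n].

    The dimensions only add up if the Hom spaces are finite dimensional.  This is
    where the mesh category enters: a morphism between the [v x] is a combination
    of paths of bounded length, and every object is a finite direct sum of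
    indecomposables, by induction on the total dimension of its cohomology.

    The class of an object is recovered from the dimensions of its cohomology,
    which are invariant under isomorphism in the derived category. *)

Set Implicit Arguments.
Unset Strict Implicit.
Unset Printing Implicit Defensive.

Import Order.TTheory GRing.Theory Num.Theory.
Local Open Scope ring_scope.

(** * Dimension of subspaces *)

(** [dimk] and the sums over [\in] return 0 on infinite input, so every counting step has to carry a
    proof of finite dimension or of bounded support. The main obstacle is exactness in a category of
    fractions, where a composite of chain maps that vanishes becomes null-homotopic only after a
    further quasi-isomorphism. One construction on the level of complexes deals with this, for
    morphisms into the target of the map whose cone is taken; exactness at the other two places
    follows by rotating the triangle. The term r(W[1]) arises because, by exactness at A[1], the
    kernel of Hom(W, A) -> Hom(W, B) becomes, after a shift by one, the image of Hom(W[1], gamma).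
    Shifting the test object instead of the triangle lets one fixed cone serve in all degrees and
    avoids the signs in the differential of a shifted cone. *)

Section LinearAlgebra.
Variable k : fieldType.
Implicit Types V U T : lmodType k.

Lemma linear_pack V U (f : V -> U) : linear f -> exists g : {linear V -> U}, g =1 f.
Proof.
move=> lf; pose m := GRing.isLinear.Build k V U *:%R f lf.
pose g : {linear V -> U} := HB.pack f m.
by exists g.
Qed.

Lemma has_dimP V (S : set V) n (f : 'rV[k]_n -> V) :
  linear f -> injective f -> range f = S -> has_dim S n.
Proof.
move=> lf; have [g gE] := linear_pack lf.
have {gE}-> : f = g by apply: funext => x; rewrite gE.
by exists g.
Qed.

Lemma linear_inj_leq m n (f : 'rV[k]_m -> 'rV[k]_n) :
  linear f -> injective f -> (m <= n)%N.
Proof.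
move=> lf If; have [g gE] := linear_pack lf.
have kg u : u *m lin1_mx g = f u by rewrite mul_rV_lin1 gE.
have : row_free (lin1_mx g).
  apply/inj_row_free => u; rewrite kg => u0; apply: If; rewrite u0 -gE.
  by rewrite raddf0.
by move=> /eqP <-; apply: rank_leq_col.
Qed.

(** One parametrisation factors through the other by an injective linear map. Since [dimk] is a
    choice by [xget], this uniqueness is what makes it computable. *)
Lemma has_dim_uniq V (S : set V) m n : has_dim S m -> has_dim S n -> m = n.
Proof.
suff H a b : has_dim S a -> has_dim S b -> (a <= b)%N.
  by move=> Sm Sn; apply/eqP; rewrite eqn_leq !H.
move=> [f [If fS]] [g [Ig gS]].
have H u : exists w, g w = f u.
  have : (range g) (f u) by rewrite gS -fS; exists u.
  by case=> w _ <-; exists w.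
pose h u := projT1 (boolp.cid (H u)).
have hE u : g (h u) = f u by rewrite /h; case: boolp.cid.
apply: (@linear_inj_leq _ _ h).
- by move=> c u w; apply: Ig; rewrite linearP !hE linearP.
- by move=> u w e; apply: If; rewrite -!hE e.
Qed.

Lemma dimkE V (S : set V) n : has_dim S n -> dimk S = n.
Proof.
move=> Sn; rewrite /dimk; case: xgetP => [m _ /= Sm|/(_ n)//].
exact: has_dim_uniq Sm Sn.
Qed.

Definition fin_dim V := exists n, has_dim [set: V] n.

Lemma fin_dimP V : fin_dim V -> has_dim [set: V] (dimk [set: V]).
Proof. by case=> n Vn; rewrite (dimkE Vn). Qed.

(** The codomain is an arbitrary module, so [f] has no matrix whose [kermx] could be taken. A
    subspace of maximal rank among those killed by [f] contains every killed vector, since adjoining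
    one cannot raise the rank. *)
Lemma kernel_mx n V (f : 'rV[k]_n -> V) : linear f ->
  exists U : 'M[k]_n, forall u, f u = 0 <-> (u <= U)%MS.
Proof.
move=> lf; have [g gE] := linear_pack lf.
have f0 : f 0 = 0 by rewrite -gE raddf0.
have lfE c u w : f (c *: u + w) = c *: f u + f w by rewrite -!gE linearP.
pose P (m : nat) := `[< exists U : 'M[k]_n, \rank U = m /\
   forall u : 'rV_n, (u <= U)%MS -> f u = 0 >].
have exP : exists m, P m.
  exists 0%N; apply/asboolP; exists 0; split; first exact: mxrank0.
  by move=> u; rewrite submx0 => /eqP->.
have leP m : P m -> (m <= n)%N.
  by move=> /asboolP[U [<- _]]; apply: rank_leq_row.
case: (ex_maxnP exP leP) => m /asboolP[U [rU kU]] maxm.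
exists U => u; split=> [fu|]; last exact: kU.
have : P (\rank (U + u)%MS).
  apply/asboolP; exists (U + u)%MS; split=> // w /sub_addsmxP[[a b] /= ->].
  rewrite -[a *m U]scale1r lfE (kU _ (submxMl _ _)) scaler0 add0r.
  by rewrite [b]mx11_scalar mul_scalar_mx -[_ *: u]addr0 lfE fu f0 scaler0 addr0.
move=> /maxm; rewrite -rU => le_rank.
apply: submx_trans (addsmxSr U u) _.
by rewrite -(mxrank_leqif_sup (addsmxSl U u)) eqn_leq mxrankS ?addsmxSl.
Qed.

(** A complement of the kernel is mapped bijectively onto the image; [row_base] gives coordinates on
    both subspaces. *)
Lemma rank_nullity_mx n V (f : 'rV[k]_n -> V) : linear f ->
  exists r, [/\ (r <= n)%N, has_dim (range f) r & has_dim [set u | f u = 0]%classic (n - r)].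
Proof.
move=> lf; have [U kU] := kernel_mx lf; have [g gE] := linear_pack lf.
have lfE c u w : f (c *: u + w) = c *: f u + f w by rewrite -!gE linearP.
have rC := mxrank_compl U.
exists (\rank (U^C)%MS); split; first exact: rank_leq_row.
- apply: (@has_dimP _ _ _ (fun u => f (u *m row_base (U^C)%MS))).
  + by move=> c u w; rewrite mulmxDl -scalemxAl lfE.
  + move=> u w e; apply/eqP; rewrite -subr_eq0.
    have /kU sU : f ((u - w) *m row_base (U^C)%MS) = 0.
      by rewrite mulmxBl -scaleN1r addrC lfE e scaleN1r addNr.
    have : ((u - w) *m row_base (U^C)%MS <= (U :&: U^C))%MS.
      rewrite sub_capmx sU; apply: submx_trans (submxMl _ _) _.
      by rewrite eq_row_base.
    rewrite capmx_compl submx0 -(inj_eq (@oppr_inj _)) oppr0 oppr_eq0.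
    by rewrite mulmx_free_eq0 // row_base_free.
  + apply/seteqP; split=> [_ [u _ <-]|_ [u _ <-]]; first by exists (u *m row_base (U^C)%MS).
    have : (u <= U + U^C)%MS by apply: submx_full; apply: addsmx_compl_full.
    case/sub_addsmxP=> [[a b] /= uE].
    have : (b *m (U^C)%MS <= row_base (U^C)%MS)%MS by rewrite eq_row_base submxMl.
    case/submxP=> d dE; exists d => //.
    rewrite -dE uE -[a *m U]scale1r lfE; have -> : f (a *m U) = 0 by apply/kU/submxMl.
    by rewrite scaler0 add0r.
- have -> : (n - \rank (U^C)%MS)%N = \rank U.
    by rewrite rC subKn // rank_leq_row.
  apply: (@has_dimP _ _ _ (fun u => u *m row_base U)).
  + by move=> c u w; rewrite mulmxDl -scalemxAl.
  + by apply: row_free_inj; apply: row_base_free.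
  + apply/seteqP; split=> [_ [u _ <-]|u /= /kU].
      by apply/kU; rewrite (submx_trans (submxMl _ _)) // eq_row_base.
    by rewrite -(eq_row_base U) => /submxP[d ->]; exists d.
Qed.

Lemma has_dim_image V U (f : V -> U) (S : set V) n :
  linear f -> injective f -> has_dim S n -> has_dim (f @` S)%classic n.
Proof.
move=> lf If [b [Ib bS]]; apply: (@has_dimP _ _ _ (f \o b)).
- by move=> c u w /=; rewrite linearP lf.
- exact: inj_comp.
- by rewrite -bS image_comp.
Qed.

Lemma rank_nullity V U (f : V -> U) : linear f -> fin_dim V ->
  exists r, [/\ (r <= dimk [set: V])%N, has_dim (range f) r
    & has_dim [set u | f u = 0]%classic (dimk [set: V] - r)].
Proof.
move=> lf [n Vn]; rewrite (dimkE Vn); case: Vn => b [Ib bT].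
have lfb : linear (f \o b) by move=> c u w /=; rewrite linearP lf.
have [r [ler Hr Hk]] := rank_nullity_mx lfb; exists r; split=> //.
  suff <- : range (f \o b) = range f by [].
  by rewrite -[RHS]/(f @` setT)%classic -bT image_comp.
have := has_dim_image (@linearP _ _ _ _ b) Ib Hk; congr has_dim.
apply/seteqP; split=> [_ [u fu <-]//|u /= fu].
have : range b u by rewrite bT.
by case=> w _ e; exists w; rewrite //= e.
Qed.

Lemma has_dim_range V U (f : V -> U) : linear f -> fin_dim V ->
  has_dim (range f) (dimk (range f)).
Proof.
by move=> lf fV; have [r [_ Hr _]] := rank_nullity lf fV; rewrite (dimkE Hr).
Qed.

Lemma dimk_ker V U (f : V -> U) : linear f -> fin_dim V ->
  (dimk (range f) + dimk [set u | f u = 0%R]%classic)%N = dimk [set: V].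
Proof.
move=> lf fV; have [r [ler Hr Hk]] := rank_nullity lf fV.
by rewrite (dimkE Hr) (dimkE Hk) subnKC.
Qed.

Lemma fin_dim_surj V U (f : V -> U) : linear f -> (forall u, exists w, f w = u) ->
  fin_dim V -> fin_dim U.
Proof.
move=> lf Sf fV; exists (dimk (range f)); move: (has_dim_range lf fV); congr has_dim.
by apply/seteqP; split=> // u _; have [w <-] := Sf u; exists w.
Qed.

Lemma dimk_bij V U (f : V -> U) : linear f -> injective f -> (forall u, exists w, f w = u) ->
  fin_dim V -> dimk [set: U] = dimk [set: V].
Proof.
move=> lf If Sf fV; apply: dimkE; have := has_dim_image lf If (fin_dimP fV).
by congr has_dim; apply/seteqP; split=> // u _; have [w <-] := Sf u; exists w.
Qed.

Lemma has_dim_prod V U m n : has_dim [set: V] m -> has_dim [set: U] n ->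
  has_dim [set: V * U] (m + n).
Proof.
move=> [a [Ia aT]] [b [Ib bT]].
apply: (@has_dimP _ _ _ (fun u => (a (lsubmx u), b (rsubmx u)) : V * U)).
- by move=> c u w; rewrite !linearP.
- by move=> u w [/Ia e /Ib e']; rewrite -[u]hsubmxK -[w]hsubmxK e e'.
- apply/seteqP; split=> // -[x y] _.
  have : range a x by rewrite aT.
  have : range b y by rewrite bT.
  case=> w _ <- [u _ <-]; exists (row_mx u w) => //.
  by rewrite row_mxKl row_mxKr.
Qed.

Lemma fin_dim_prod V U : fin_dim V -> fin_dim U -> fin_dim (V * U)%type.
Proof. by move=> [m Vm] [n Un]; exists (m + n)%N; apply: has_dim_prod. Qed.

Lemma has_dim0 V (S : set V) : S = [set 0]%classic -> has_dim S 0.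
Proof.
move=> ->; apply: (@has_dimP _ _ _ (fun=> 0)).
- by move=> c u w; rewrite scaler0 addr0.
- by move=> u w _; apply/rowP => -[].
- by apply/seteqP; split=> [_ [u _ <-]//|_ ->]; exists 0.
Qed.

End LinearAlgebra.

(** * The derived category as a category of fractions *)

Section Isomorphisms.
Variables (k : fieldType) (C : lincat k).
Implicit Types X Y Z : C.

Lemma is_isoM X Y Z (f : Mor X Y) (g : Mor Y Z) : is_iso f -> is_iso g -> is_iso (f ;; g).
Proof.
move=> [f' [ff f'f]] [g' [gg g'g]]; exists (g' ;; f'); split.
  by rewrite compA -(compA f) gg compm1.
by rewrite compA -(compA g') f'f compm1.
Qed.

Lemma iso_cancel X Y Z (f f' : Mor X Y) (g : Mor Y Z) :
  is_iso g -> f ;; g = f' ;; g -> f = f'.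
Proof.
move=> [h [gh _]] e; have := congr1 (mcomp^~ h) e.
by rewrite -!compA gh !compm1.
Qed.

Lemma iso_cancel0 X Y Z (f : Mor X Y) (g : Mor Y Z) : is_iso g -> f ;; g = 0 -> f = 0.
Proof. by move=> ig e; apply: (iso_cancel ig); rewrite e comp0m. Qed.

Lemma iso_divr X Y Z (f : Mor X Z) (g : Mor Y Z) : is_iso g -> exists h, h ;; g = f.
Proof. by case=> g' [_ e]; exists (f ;; g'); rewrite -compA e compm1. Qed.

Lemma isomorphic_sym X Y : isomorphic X Y -> isomorphic Y X.
Proof. by move=> [f [g [fg gf]]]; exists g, f. Qed.

Lemma linear_compr W X Y (f : Mor X Y) : linear (fun u : Mor W X => u ;; f).
Proof. by move=> c u w; rewrite compPl. Qed.

Lemma linear_compl W X Y (f : Mor W X) : linear (fun u : Mor X Y => f ;; u).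
Proof. by move=> c u w; rewrite compPr. Qed.

Lemma iso_compr_bij W X Y (f : Mor X Y) : is_iso f ->
  injective (fun u : Mor W X => u ;; f) /\ forall u : Mor W Y, exists w, w ;; f = u.
Proof.
move=> If; split=> [u w|u]; first exact: iso_cancel.
exact: iso_divr.
Qed.

Lemma iso_compl_bij W X Y (f : Mor W X) : is_iso f ->
  injective (fun u : Mor X Y => f ;; u) /\ forall u : Mor W Y, exists w, f ;; w = u.
Proof.
move=> [g [fg gf]]; split=> [u w e|u]; last by exists (g ;; u); rewrite compA fg comp1m.
by have := congr1 (mcomp g) e; rewrite !compA gf !comp1m.
Qed.

Lemma fin_dim_isor W X Y : isomorphic X Y -> fin_dim (Mor W X) -> fin_dim (Mor W Y).
Proof.
by case=> f /(iso_compr_bij W)[_ Sf]; apply: (fin_dim_surj (@linear_compr W _ _ f)).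
Qed.

Lemma dimk_isor W X Y : isomorphic X Y -> fin_dim (Mor W X) ->
  dimk [set: Mor W Y] = dimk [set: Mor W X].
Proof.
by case=> f /(iso_compr_bij W)[If Sf]; apply: (dimk_bij (@linear_compr W _ _ f)).
Qed.

End Isomorphisms.

(** * From chain maps to morphisms of the derived category *)

Section DerivedInterface.
Variables (k : fieldType) (V : finType) (Q : quiver V).
Local Notation D := (Db k Q).
Local Notation Ch := (cplx_cat k Q).
Implicit Types X Y Z M : Ch.

Lemma in_DbM X Y Z (f : Mor X Y) (g : Mor Y Z) : in_Db (f ;; g) = in_Db f ;; in_Db g.
Proof.
have E : @idm k (homotopy_cat k Q) Y ;; qcls (null_ideal k Q) g
       = qcls (null_ideal k Q) g ;; @idm k (homotopy_cat k Q) Z by rewrite comp1m compm1.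
rewrite /in_Db /loc.
rewrite [RHS](lcompE (L := quasi_isos k Q) (qcls (null_ideal k Q) f) (wmem1 (quasi_isos k Q) Y)
  (wmem1 (quasi_isos k Q) Z) (wmem1 (quasi_isos k Q) Z) E).
rewrite [X in mkl X _]/=; have -> : qcls (null_ideal k Q) (f ;; g) =
  @mcomp k (homotopy_cat k Q) _ _ _ (qcls (null_ideal k Q) f) (qcls (null_ideal k Q) g).
  by rewrite [RHS]qcompE.
by apply: mkl_pir; rewrite compm1.
Qed.

Lemma in_Db1 X : in_Db (idm X) = @idm k D X.
Proof. by []. Qed.

Lemma in_DbP X Y c (f g : Mor X Y) : in_Db (c *: f + g) = c *: in_Db f + in_Db g.
Proof. by rewrite /in_Db /qcls qpiD qpiZ /loc -[LHS]/(mkl _ _) mklD mklZ. Qed.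

Lemma in_Db0 X Y : in_Db (0 : Mor X Y) = 0.
Proof. by have := in_DbP (-1) (0 : Mor X Y) 0; rewrite scaler0 addr0 scaleN1r addNr. Qed.

Lemma in_DbN X Y (f : Mor X Y) : in_Db (- f) = - in_Db f.
Proof. by have := in_DbP (-1) f 0; rewrite in_Db0 !addr0 !scaleN1r. Qed.

Lemma in_DbD X Y (f g : Mor X Y) : in_Db (f + g) = in_Db f + in_Db g.
Proof. by have := in_DbP 1 f g; rewrite !scale1r. Qed.

Lemma in_Db_nullh X Y (f : Mor X Y) : null_homotopic f -> in_Db f = 0.
Proof.
move=> Hf; rewrite -(in_Db0 X Y) /in_Db; congr (loc _ _).
by apply/qpiP; rewrite subr0.
Qed.

Lemma in_Db_htpy X Y (f g : Mor X Y) : null_homotopic (f - g) -> in_Db f = in_Db g.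
Proof. by move=> /in_Db_nullh; rewrite in_DbD in_DbN => /subr0_eq. Qed.

Lemma mkl_den X Y M (f : @Mor k (homotopy_cat k Q) X M) (s : @Mor k (homotopy_cat k Q) Y M)
    (Ws : wmem (quasi_isos k Q) s) :
  @mcomp k D _ _ _ (mkl f Ws) (loc (quasi_isos k Q) s) = loc (quasi_isos k Q) f.
Proof.
have E : s ;; @idm k (homotopy_cat k Q) M = s ;; @idm k (homotopy_cat k Q) M by [].
rewrite [LHS](lcompE (L := quasi_isos k Q) f Ws (wmem1 (quasi_isos k Q) M)
  (wmem1 (quasi_isos k Q) M) E).
by rewrite compm1; apply: mkl_pir; rewrite compm1.
Qed.

Lemma iso_in_Db X Y (s : Mor X Y) : quasi_iso s -> is_iso (in_Db s).
Proof.
move=> Qs; have Ws : wmem (quasi_isos k Q) (qcls (null_ideal k Q) s) by apply/kqisE.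
exists (mkl (idm _) Ws); split; last exact: mkl_den.
have E : @idm k (homotopy_cat k Q) Y ;; @idm k (homotopy_cat k Q) Y
       = @idm k (homotopy_cat k Q) Y ;; @idm k (homotopy_cat k Q) Y by [].
rewrite [LHS](lcompE (L := quasi_isos k Q) (qcls (null_ideal k Q) s)
   (wmem1 (quasi_isos k Q) Y) Ws (wmem1 (quasi_isos k Q) Y) E).
apply/esym; apply: (@mkl_ext _ _ _ _ _ _ _ _ _ _ (qcls (null_ideal k Q) s));
  by rewrite ?comp1m ?compm1.
Qed.

Lemma mkl_fracE X Y (f : @Mor k D X Y) M (n : Mor X M) (s : Mor Y M)
    (Ws : wmem (quasi_isos k Q) (qcls (null_ideal k Q) s)) :
  f ;; in_Db s = in_Db n -> f = mkl (qcls (null_ideal k Q) n) Ws.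
Proof.
move=> e; have Qs : quasi_iso s by apply/kqisE.
by apply: (iso_cancel (iso_in_Db Qs)); rewrite e mkl_den.
Qed.

(** Morphisms are handled below mostly through the equation [f ;; in_Db s = in_Db n] between images
    of chain maps, instead of through representatives of a class of fractions. *)
Lemma Db_frac X Y (f : @Mor k D X Y) :
  exists M (n : Mor X M) (s : Mor Y M), quasi_iso s /\ f ;; in_Db s = in_Db n.
Proof.
have [M [n [s [Ws ->]]]] := lhomW f.
elim/qpiW: n => n; elim/qpiW: s Ws => s Ws.
by exists M, n, s; split; [apply/kqisE|exact: mkl_den].
Qed.

Lemma in_Db_eq0 X Y (f : Mor X Y) : in_Db f = 0 ->
  exists M (t : Mor Y M), quasi_iso t /\ null_homotopic (f ;; t).
Proof.
rewrite -(in_Db0 X Y) => /mkl_inj[M [t [Wt]]].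
elim/qpiW: t Wt => t Wt; rewrite comp0m [X in X = _]qcompE => /qpiP.
by rewrite subr0 => H; exists M, t; split=> //; apply/kqisE.
Qed.

Lemma qis_ore X Y Z (s : Mor X Y) (f : Mor X Z) : quasi_iso s ->
  exists T (g : Mor Y T) (t : Mor Z T), quasi_iso t /\ in_Db s ;; in_Db g = in_Db f ;; in_Db t.
Proof.
move=> /(qis_ore_chain f)[T [g [t [Qt H]]]]; exists T, g, t; split=> //.
by rewrite -!in_DbM; apply: in_Db_htpy.
Qed.

(** On an acyclic complex the zero endomorphism is a quasi-isomorphism, hence invertible in the
    derived category, which forces the identity to vanish. *)
Lemma acyclic_zero X :
  (forall i x (u : 'rV[k]_(rdim (X (i + 1)) x)), cocycle u -> coboundary u) ->
  @is_zero k D X.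
Proof.
move=> aX; have Q0 : quasi_iso (0 : Mor X X).
  move=> i x; split=> [u Zu _|v Zv]; first exact: aX.
  exists 0; split; first by rewrite /cocycle mul0mx.
  by rewrite mul0mx subr0; apply: aX.
have [g [e _]] := iso_in_Db Q0.
by rewrite /is_zero -e in_Db0 comp0m.
Qed.

End DerivedInterface.

(** * The shift functor *)

Section Shift.
Variables (k : fieldType) (V : finType) (Q : quiver V).
Local Notation D := (Db k Q).
Local Notation Ch := (cplx_cat k Q).
Implicit Types X Y Z M : Ch.
Implicit Types m n p : int.

Definition cshiftf X Y (f : Mor X Y) n : @Mor k Ch (cshift X n) (cshift Y n) :=
  cshift_map f n.

Lemma cshiftfM X Y Z (f : Mor X Y) (g : Mor Y Z) n :
  cshiftf (f ;; g) n = cshiftf f n ;; cshiftf g n.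
Proof. exact: chomP. Qed.

(** [shift_map] is defined through a chosen representative; this computes it from any fraction. *)
Lemma shift_frac X Y (f : @Mor k D X Y) M (g : Mor X M) (s : Mor Y M) n :
  quasi_iso s -> f ;; in_Db s = in_Db g ->
  shift_map f n ;; in_Db (cshiftf s n) = in_Db (cshiftf g n).
Proof.
move=> Qs e; have Ws : wmem (quasi_isos k Q) (qcls (null_ideal k Q) s) by apply/kqisE.
rewrite (mkl_fracE Ws e) shift_mapE /in_Db -!kshiftE.
exact: mkl_den.
Qed.

Lemma shift_in_Db X Y (f : Mor X Y) n : shift_map (in_Db f) n = in_Db (cshiftf f n).
Proof.
have e : in_Db f ;; in_Db (idm Y) = in_Db f by rewrite in_Db1 compm1.
have := shift_frac n (qis_id Y) e; rewrite (_ : cshiftf _ n = idm (cshift Y n : Ch)).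
  by rewrite in_Db1 compm1.
exact: chomP.
Qed.

Lemma cshiftf_iso X Y (s : Mor X Y) n : quasi_iso s -> is_iso (in_Db (cshiftf s n)).
Proof. by move=> Qs; apply: iso_in_Db; apply: cshift_qis. Qed.

(** With f = f' s^-1 and g = g' t^-1, an Ore square s a = g' b writes the composite as (f' a) (t
    b)^-1, and shifting preserves the square. *)
Lemma shift_mapM X Y Z (f : @Mor k D X Y) (g : @Mor k D Y Z) n :
  shift_map (f ;; g) n = shift_map f n ;; shift_map g n.
Proof.
have [M [f' [s [Qs ef]]]] := Db_frac f; have [N [g' [t [Qt eg]]]] := Db_frac g.
have [T [a [b [Qb e]]]] := qis_ore g' Qs.
have Qtb : quasi_iso (t ;; b) by apply: qis_comp.
apply: (iso_cancel (cshiftf_iso n Qtb)).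
rewrite (@shift_frac _ _ _ _ (f' ;; a)) //; last first.
  by rewrite !in_DbM -compA (compA g) eg -e compA ef.
rewrite !cshiftfM !in_DbM -compA (compA _ (in_Db (cshiftf t n))) (shift_frac n Qt eg).
have := congr1 (fun f => shift_map f n) e.
rewrite -!in_DbM !shift_in_Db !cshiftfM !in_DbM => <-.
by rewrite compA (shift_frac n Qs ef).
Qed.

Lemma shift_mapP X Y n c (f g : @Mor k D X Y) :
  shift_map (c *: f + g) n = c *: shift_map f n + shift_map g n.
Proof.
have [M [f' [s [Qs ef]]]] := Db_frac f; have [N [g' [t [Qt eg]]]] := Db_frac g.
have [T [a [b [Qb e]]]] := qis_ore t Qs.
have Qtb : quasi_iso (t ;; b) by apply: qis_comp.
have ef' : f ;; in_Db (t ;; b) = in_Db (f' ;; a).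
  by rewrite !in_DbM -e compA ef.
have eg' : g ;; in_Db (t ;; b) = in_Db (g' ;; b) by rewrite !in_DbM compA eg.
apply: (iso_cancel (cshiftf_iso n Qtb)).
rewrite (@shift_frac _ _ _ _ (c *: (f' ;; a) + g' ;; b)) //; last first.
  by rewrite in_DbP compPl ef' eg'.
rewrite compPl (shift_frac n Qtb ef') (shift_frac n Qtb eg') -in_DbP.
by congr in_Db; apply: chomP.
Qed.

Lemma shift_map1 X n : shift_map (@idm k D X) n = @idm k D (cshift X n).
Proof. by rewrite -in_Db1 shift_in_Db -in_Db1; congr in_Db; apply: chomP. Qed.

Lemma shift_map0 X Y n : shift_map (0 : @Mor k D X Y) n = 0.
Proof.
by have := shift_mapP n (-1) (0 : @Mor k D X Y) 0; rewrite scaler0 addr0 scaleN1r addNr.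
Qed.

Lemma shift_iso X Y (f : @Mor k D X Y) n : is_iso f -> is_iso (shift_map f n).
Proof.
case=> g [fg gf]; exists (shift_map g n).
by rewrite -!shift_mapM fg gf !shift_map1.
Qed.

(** Degrees such as [i + n + m] and [i + (m + n)] are equal without being convertible, so shifted
    complexes are compared along the transports [eqr]. The degrees are kept as variables here:
    substituting their equations turns each [eqr] into an identity. *)
Lemma eqr_comp X a b c : a = b -> eqr X a b ;; eqr X b c = eqr X a c.
Proof. by move=> ->; rewrite eqr_id comp1m. Qed.

Lemma eqr_compV X a b : a = b -> eqr X a b ;; eqr X b a = idm (X a).
Proof. by move=> ->; rewrite eqr_id comp1m. Qed.

Lemma eqr_nat X Y (f : Mor X Y) a b : a = b ->
  eqr X a b ;; cmap f b = cmap f a ;; eqr Y a b.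
Proof. by move=> ->; rewrite !eqr_id comp1m compm1. Qed.

Lemma eqr_shiftC X (c : k) a b a' b' : a + 1 = b -> a = a' -> b = b' ->
  (c *: (cd X a ;; eqr X (a + 1) b)) ;; eqr X b b' =
  eqr X a a' ;; (c *: (cd X a' ;; eqr X (a' + 1) b')).
Proof. by move=> <- <- <-; rewrite !eqr_id !comp1m !compm1. Qed.

Lemma shift_zero_subproof X : @chain_cond _ _ _ X (cshift X 0) (fun i => eqr X i (i + 0)).
Proof.
move=> i; have := @eqr_shiftC X 1 i (i + 1) (i + 0) (i + 1 + 0) erefl (esym (addr0 _))
  (esym (addr0 _)); rewrite eqr_id compm1 scale1r => ->.
by [].
Qed.
Definition shift_zero X : @Mor k Ch X (cshift X 0) := mk_chom (@shift_zero_subproof X).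

Lemma shift_zero_iso X : is_iso (in_Db (shift_zero X)).
Proof.
have C : @chain_cond _ _ _ (cshift X 0) X (fun i => eqr X (i + 0) i).
  move=> i; have := @eqr_shiftC X 1 (i + 0) (i + 1 + 0) i (i + 1) (shift_idx _ _) (addr0 _)
    (addr0 _); rewrite eqr_id compm1 [in RHS]scale1r => <-.
  by [].
pose g : @Mor k Ch (cshift X 0) X := mk_chom C.
exists (in_Db g); rewrite -!in_DbM -!in_Db1; split; congr in_Db; apply: chomP => i.
  exact: (eqr_compV X (esym (addr0 i))).
exact: (eqr_compV X (addr0 i)).
Qed.

(** Only the parity of the exponents counts, and [m + n] has the same parity as the sum of the two
    absolute values. *)
Lemma signz_add m n : ((-1) ^+ `|m + n| : k) = (-1) ^+ `|n| * (-1) ^+ `|m|.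
Proof. by rewrite -exprD -signr_odd -[RHS]signr_odd; congr (_ ^+ _); congr nat_of_bool; lia. Qed.

Lemma eqr_cshift X m a b : a = b -> eqr (cshift X m) a b = eqr X (a + m) (b + m).
Proof. by move=> ->; rewrite !eqr_id. Qed.

Lemma eqr_shift2 X (c c' d : k) a b1 b2 a' b' : a + 1 = b1 -> b1 = b2 -> a = a' -> b2 = b' ->
  c' * c = d ->
  (d *: (cd X a' ;; eqr X (a' + 1) b')) ;; eqr X b' b2 =
  eqr X a' a ;; (c' *: ((c *: (cd X a ;; eqr X (a + 1) b1)) ;; eqr X b1 b2)).
Proof. by move=> <- <- <- <- <-; rewrite !eqr_id !compm1 !comp1m scalerA. Qed.

Lemma eqr_shift2V X (c c' d : k) a b1 b2 a' b' : a + 1 = b1 -> b1 = b2 -> a = a' -> b2 = b' ->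
  c' * c = d ->
  (c' *: ((c *: (cd X a ;; eqr X (a + 1) b1)) ;; eqr X b1 b2)) ;; eqr X b2 b' =
  eqr X a a' ;; (d *: (cd X a' ;; eqr X (a' + 1) b')).
Proof. by move=> <- <- <- <- <-; rewrite !eqr_id !compm1 !comp1m scalerA. Qed.

Lemma cd_shift2 X m n i : cd (cshift (cshift X m) n) i =
  ((-1) ^+ `|n| : k) *: ((((-1) ^+ `|m| : k) *:
    (cd X (i + n + m) ;; eqr X (i + n + m + 1) (i + n + 1 + m))) ;;
    eqr X (i + n + 1 + m) (i + 1 + n + m)).
Proof. by rewrite -(@eqr_cshift X m) // shift_idx. Qed.

Lemma shift_add_subproof X m n p : p = m + n ->
  @chain_cond _ _ _ (cshift X p) (cshift (cshift X m) n) (fun i => eqr X (i + p) (i + n + m)).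
Proof.
move=> ep i; rewrite cd_shift2.
have [E1 E2] : i + n + m + 1 = i + n + 1 + m /\ i + n + 1 + m = i + 1 + n + m by lia.
have [E3 E4] : i + n + m = i + p /\ i + 1 + n + m = i + 1 + p by lia.
have E5 : (-1) ^+ `|n| * (-1) ^+ `|m| = (-1) ^+ `|p| :> k by rewrite ep signz_add.
exact: (eqr_shift2 X E1 E2 E3 E4 E5).
Qed.
Definition shift_add X m n p (e : p = m + n) : @Mor k Ch (cshift X p) (cshift (cshift X m) n) :=
  mk_chom (shift_add_subproof X e).

Lemma shift_add_iso X m n p (e : p = m + n) : is_iso (in_Db (shift_add X e)).
Proof.
have C : @chain_cond _ _ _ (cshift (cshift X m) n) (cshift X p)
    (fun i => eqr X (i + n + m) (i + p)).
  move=> i; rewrite cd_shift2.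
  have [E1 E2] : i + n + m + 1 = i + n + 1 + m /\ i + n + 1 + m = i + 1 + n + m by lia.
  have [E3 E4] : i + n + m = i + p /\ i + 1 + n + m = i + 1 + p by lia.
  have E5 : (-1) ^+ `|n| * (-1) ^+ `|m| = (-1) ^+ `|p| :> k by rewrite e signz_add.
  exact: (eqr_shift2V X E1 E2 E3 E4 E5).
pose g : @Mor k Ch (cshift (cshift X m) n) (cshift X p) := mk_chom C.
exists (in_Db g); rewrite -!in_DbM -!in_Db1; split; congr in_Db; apply: chomP => i.
  have E : i + p = i + n + m by lia.
  exact: (eqr_compV X E).
have E : i + n + m = i + p by lia.
exact: (eqr_compV X E).
Qed.

Lemma shift_shift_iso X m n p : p = m + n ->
  @isomorphic k D (cshift X p) (cshift (cshift X m) n).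
Proof. by move=> e; exists (in_Db (shift_add X e)); apply: shift_add_iso. Qed.

Definition shiftK_map X n : @Mor k Ch X (cshift (cshift X n) (- n)) :=
  shift_zero X ;; shift_add X (esym (subrr n)).

Lemma shiftK_iso X n : is_iso (in_Db (shiftK_map X n)).
Proof. by rewrite in_DbM; apply: is_isoM (shift_zero_iso X) (shift_add_iso _ _). Qed.

Lemma shiftK_nat X Y (f : Mor X Y) n :
  shiftK_map X n ;; cshiftf (cshiftf f n) (- n) = f ;; shiftK_map Y n.
Proof.
apply: chomP => i; rewrite !cmapM.
have K Z : cmap (shiftK_map Z n) i = eqr Z i (i - n + n).
  by apply: eqr_comp; rewrite addr0.
transitivity (eqr X i (i - n + n) ;; cmap f (i - n + n)).
  exact: (congr1 (fun h => h ;; cmap f (i - n + n)) (K X)).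
rewrite eqr_nat ?subrK //.
exact: (congr1 (mcomp (cmap f i)) (esym (K Y))).
Qed.

Lemma shiftK_natD X Y (f : @Mor k D X Y) n :
  in_Db (shiftK_map X n) ;; shift_map (shift_map f n) (- n) = f ;; in_Db (shiftK_map Y n).
Proof.
have [M [g [s [Qs e]]]] := Db_frac f.
have I : is_iso (in_Db (cshiftf (cshiftf s n) (- n))).
  by apply: cshiftf_iso; apply: cshift_qis.
apply: (iso_cancel I).
have e1 := shift_frac n Qs e.
have Qs1 : quasi_iso (cshiftf s n) by apply: cshift_qis.
have e2 := shift_frac (- n) Qs1 e1.
rewrite -[LHS]compA -[RHS]compA; apply: etrans (congr1 (mcomp _) e2) _.
rewrite -[LHS]in_DbM (shiftK_nat g) in_DbM -e -[LHS]compA; congr (_ ;; _).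
by rewrite -[LHS]in_DbM -[RHS]in_DbM (shiftK_nat s).
Qed.

(** Shifting back by [- n] and conjugating with the natural isomorphism from X to X[n][-n] recovers
    [f]. *)
Lemma shift_map_inj X Y n : injective (fun f : @Mor k D X Y => shift_map f n).
Proof.
move=> f g /= e; apply: (iso_cancel (shiftK_iso Y n)).
by rewrite -!shiftK_natD e.
Qed.

(** The preimage is the conjugate of g[-n]; that its shift is [g] is tested after a further shift by
    [- n], which is injective. *)
Lemma shift_map_surj X Y n (g : @Mor k D (cshift X n) (cshift Y n)) :
  exists f : @Mor k D X Y, shift_map f n = g.
Proof.
have [f fE] := iso_divr (in_Db (shiftK_map X n) ;; shift_map g (- n)) (shiftK_iso Y n).
exists f; apply: (@shift_map_inj _ _ (- n)) => /=.
have [h [_ hK]] := shiftK_iso X n.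
by rewrite -[LHS]comp1m -[RHS]comp1m -hK -!compA shiftK_natD fE.
Qed.

Lemma linear_shift_map X Y n : linear (fun f : @Mor k D X Y => shift_map f n).
Proof. by move=> c f g; apply: shift_mapP. Qed.

(** [hdim] shifts the second argument, whereas the exact sequence of a fixed cone is used with a
    shifted first argument; this passes from one to the other. *)
Lemma shift_adj X Y n : fin_dim (@Mor k D X (shift Y n)) ->
  fin_dim (@Mor k D (shift X (- n)) Y) /\
  dimk [set: @Mor k D (shift X (- n)) Y] = dimk [set: @Mor k D X (shift Y n)].
Proof.
move=> fXY; have lS := @linear_shift_map X (shift Y n) (- n).
have fS := fin_dim_surj lS (@shift_map_surj X (shift Y n) (- n)) fXY.
have I : @isomorphic k D (cshift (cshift Y n) (- n)) Y.
  by apply: isomorphic_sym; exists (in_Db (shiftK_map Y n)); apply: shiftK_iso.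
split; first exact: fin_dim_isor I fS.
rewrite (dimk_isor I fS).
exact: (dimk_bij lS (@shift_map_inj _ _ _) (@shift_map_surj X (shift Y n) (- n)) fXY).
Qed.

End Shift.

(** * The long exact sequence of a cone *)

Section Exactness.
Variables (k : fieldType) (V : finType) (Q : quiver V).
Local Notation D := (Db k Q).
Local Notation Ch := (cplx_cat k Q).
Implicit Types W X Y Z M T : Ch.

(** Allows identities between maps of cones to be checked on row vectors, on which the block
    matrices act by explicit formulas. *)
Lemma mx_rowP m n (A B : 'M[k]_(m, n)) : (forall u : 'rV_m, u *m A = u *m B) -> A = B.
Proof. by move=> e; apply/row_matrixP => i; rewrite !rowE. Qed.

Lemma cd_shift1 X i : cd (cshift X 1) i = - cd X (i + 1).
Proof.
have E : ((-1) ^+ 1 : k) *: (cd X (i + 1) ;; eqr X (i + 1 + 1) (i + 1 + 1)) = - cd X (i + 1).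
  by rewrite eqr_id compm1 expr1 scaleN1r.
exact: E.
Qed.

Lemma shift1_mul X i x (u : 'rV[k]_(rdim (X (i + 1)) x)) :
  u *m rmap (cd (cshift X 1) i) x = - (u *m rmap (cd X (i + 1)) x).
Proof. by rewrite cd_shift1 rmapN mulmxN. Qed.

Lemma chain_cond_row X Y (f : forall i, @Mor k (rep_cat k Q) (X i) (Y i)) :
  (forall i x (u : 'rV_(rdim (X i) x)),
     u *m rmap (cd X i) x *m rmap (f (i + 1)) x = u *m rmap (f i) x *m rmap (cd Y i) x) ->
  chain_cond f.
Proof.
move=> H i; apply: rhomP => x; apply: mx_rowP => u.
by rewrite !rmapM !mulmxA.
Qed.

Lemma cone_in_mul X Y (f : Mor X Y) i x (v : 'rV[k]_(rdim (Y i) x)) :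
  v *m rmap (cmap (cone_in f) i) x = row_mx 0 v.
Proof. by rewrite cmap_cone_in rmap_row rmap0 rmap1 mul_mx_row mulmx0 mulmx1. Qed.

Lemma cone_out_mul X Y (f : Mor X Y) i x (u : 'rV[k]_(rdim (X (i + 1)) x))
    (v : 'rV[k]_(rdim (Y i) x)) :
  row_mx u v *m rmap (cmap (cone_out f) i) x = u.
Proof.
have -> : cmap (cone_out f) i = rcol (idm (X (i + 1))) 0 by [].
by rewrite rmap_col rmap0 rmap1 mul_row_col mulmx0 mulmx1 addr0.
Qed.

Lemma rcmapC_mul X Y (f : Mor X Y) i x (v : 'rV[k]_(rdim (X i) x)) :
  v *m rmap (cmap f i) x *m rmap (cd Y i) x =
  v *m rmap (cd X i) x *m rmap (cmap f (i + 1)) x.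
Proof. by rewrite -!mulmxA rcmapC. Qed.

Section ConePost.
Variables (X Y M : Ch) (u : Mor X Y) (s : Mor Y M).
(** The map of cones induced by the identity of [X] and [s]. It replaces the target of [u] by the
    denominator of a fraction. *)
Lemma cone_post_subproof : @chain_cond _ _ _ (cone u) (cone (u ;; s))
  (fun i => rcol (rrow (idm (X (i + 1))) 0) (rrow 0 (cmap s i))).
Proof.
apply: chain_cond_row => i x w; rewrite -[w]hsubmxK cone_mul.
rewrite !rmap_col !rmap_row !rmap0 !rmap1 !mul_row_col !mul_mx_row !mulmx0 !mulmx1.
rewrite !add_row_mx !addr0 !add0r cone_mul cmapM rmapM mulmxDl !mulmxA.
by congr (row_mx _ (_ + _)); rewrite -!mulmxA rcmapC.
Qed.
Definition cone_post : @Mor k Ch (cone u) (cone (u ;; s)) := mk_chom cone_post_subproof.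

Lemma cone_in_post : (cone_in u : @Mor k Ch _ _) ;; cone_post = s ;; cone_in (u ;; s).
Proof.
apply: chomP => i; apply: rhomP => x; apply: mx_rowP => w.
rewrite !cmapM !rmapM !mulmxA !cone_in_mul.
have -> : cmap cone_post i = rcol (rrow (idm (X (i + 1))) 0) (rrow 0 (cmap s i)) by [].
rewrite rmap_col !rmap_row !rmap0 !rmap1 !mul_row_col !mul_mx_row !mulmx0 !mulmx1.
by rewrite add_row_mx addr0 add0r.
Qed.
End ConePost.

(* When t is a quasi-isomorphism, M -> cone j -> T has, up to shift, the same fibre
   X -> M as M -> cone j; this lets one lift along j maps that die only after t. *)
Section Cocone.
Variables (X M T : Ch) (j : Mor X M) (t : @Mor k Ch (cone j) T).
Let w : @Mor k Ch M T := (cone_in j : @Mor k Ch _ _) ;; t.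

Lemma cocone_tE i x (m : 'rV[k]_(rdim (M i) x)) :
  m *m rmap (cmap w i) x = row_mx 0 m *m rmap (cmap t i) x.
Proof. by rewrite cmapM rmapM mulmxA cone_in_mul. Qed.

(** The composite [j ;; w] is null-homotopic: the homotopy [a |-> (a, 0)] for [j ;; cone_in j] is
    followed by [t]. A map together with a null-homotopy of its composite with [w] is a map from the
    shift into [cone w], and this is the one so obtained. *)
Definition cocone_fun i : @Mor k (rep_cat k Q) (cshift X 1 i) (cone w i) :=
  rrow (cmap j (i + 1)) (- (@mcomp k (rep_cat k Q) _ (cone j i) _
                              (rrow (idm (X (i + 1))) 0) (cmap t i))).

Lemma cocone_mul i x (a : 'rV[k]_(rdim (X (i + 1)) x)) :
  a *m rmap (cocone_fun i) x =
  row_mx (a *m rmap (cmap j (i + 1)) x) (- (row_mx a 0 *m rmap (cmap t i) x)).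
Proof.
rewrite rmap_row mul_mx_row rmapN rmapM mulmxN mulmxA rmap_row.
by rewrite rmap1 rmap0 mul_mx_row mulmx1 mulmx0.
Qed.

Lemma cocone_subproof : @chain_cond _ _ _ (cshift X 1) (cone w) cocone_fun.
Proof.
apply: chain_cond_row => i x a; rewrite shift1_mul !cocone_mul cone_mul !mulNmx.
congr row_mx; first by rewrite -!mulmxA rcmapC.
rewrite cocone_tE (rcmapC_mul t) cone_mul mul0mx addr0.
rewrite -mulmxBl opp_row_mx add_row_mx opprK add0r subrr -mulNmx opp_row_mx opprK.
by rewrite oppr0.
Qed.
Definition cocone_map : @Mor k Ch (cshift X 1) (cone w) := mk_chom cocone_subproof.

Lemma cocone_out : cocone_map ;; cone_out w = cshiftf j 1.
Proof.
apply: chomP => i; apply: rhomP => x; apply: mx_rowP => a.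
rewrite cmapM rmapM mulmxA.
have -> : cmap cocone_map i = cocone_fun i by [].
by rewrite cocone_mul; apply: cone_out_mul.
Qed.

(** A five-lemma argument on elements: injectivity uses that of [t] in the same degree, surjectivity
    uses injectivity of [t] one degree higher and its surjectivity in the same degree. *)
Lemma cocone_qis : quasi_iso t -> quasi_iso cocone_map.
Proof.
move=> Qt i x; have [tI tS] := Qt i x.
have cE n : cmap cocone_map n = cocone_fun n by [].
rewrite !cE; split=> [a|b].
  rewrite /cocycle (@shift1_mul X (i + 1)) => /eqP; rewrite oppr_eq0 => /eqP Za.
  case=> b; rewrite cocone_mul -[b]hsubmxK cone_mul => /eq_row_mx[e1 e2].
  rewrite cocone_tE in e2.
  set m := lsubmx b in e1 e2; set z := rsubmx b in e2.
  (* That (m, z) bounds the image of [a] says that (a, m) is a cocycle of [cone j] and that [t]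
     sends it to the coboundary of [- z]. *)
  have [||c] := tI (row_mx a m).
  - by rewrite /cocycle cone_mul Za oppr0 e1 addNr row_mx0.
  - exists (- z); rewrite mulNmx; apply/eqP; rewrite -subr_eq0 opprK.
    have -> : row_mx a m = row_mx a 0 + row_mx 0 m by rewrite add_row_mx addr0 add0r.
    by rewrite mulmxDl -addrA -e2 subrr.
  - rewrite -[c]hsubmxK cone_mul => /eq_row_mx[e3 _].
    by exists (lsubmx c); rewrite (@shift1_mul X i).
rewrite -[b]hsubmxK; set m := lsubmx b; set z := rsubmx b.
rewrite /cocycle cone_mul -[0]row_mx0 => /eq_row_mx[/eqP]; rewrite oppr_eq0 => /eqP Zm.
rewrite cocone_tE => Ez.
(* For a cocycle (m, z), the image of (0, m) under [t] is the coboundary of [- z], so (0, m) itself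
   bounds some (a, m'). *)
have [||c] := (Qt (i + 1) x).1 (row_mx 0 m).
- by rewrite /cocycle cone_mul !mul0mx Zm oppr0 addr0 row_mx0.
- by exists (- z); rewrite mulNmx; apply/eqP; rewrite -addr_eq0 Ez.
rewrite -[c]hsubmxK cone_mul; set a := lsubmx c; set m' := rsubmx c.
move=> /eq_row_mx[/esym/eqP]; rewrite oppr_eq0 => /eqP Za Em.
(* The sum of [z] and the image of (a, m') is a cocycle of [T]; subtracting a cocycle (a1, m1) of
   [cone j] that hits its class makes [a - a1] the required preimage. *)
have [|c' [Zc' [q Eq]]] := tS (z + row_mx a m' *m rmap (cmap t (i + 1)) x).
  rewrite /cocycle mulmxDl (rcmapC_mul t) cone_mul Za oppr0 -Em.
  by apply: etrans Ez; apply: addrC.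
move: Zc' Eq; rewrite -[c']hsubmxK; set a1 := lsubmx c'; set m1 := rsubmx c'.
rewrite /cocycle cone_mul -[0]row_mx0 => /eq_row_mx[/eqP]; rewrite oppr_eq0 => /eqP Za1 Em1 Eq.
exists (a - a1); split.
  by rewrite /cocycle (@shift1_mul X (i + 1)) mulmxBl Za Za1 subrr oppr0.
exists (row_mx (m1 - m') q); rewrite cone_mul cocone_mul cocone_tE opp_row_mx add_row_mx.
congr row_mx.
  have E : a1 *m rmap (cmap j (i + 1 + 1)) x = - (m1 *m rmap (cd M (i + 1)) x).
    by apply/eqP; rewrite -addr_eq0 Em1.
  by rewrite Em !mulmxBl !opprB E [LHS]addrC [LHS]addrA subrK addrC.
have E : row_mx 0 (m1 - m') + (row_mx a m' - row_mx a1 m1) = row_mx (a - a1) 0.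
  by rewrite opp_row_mx !add_row_mx add0r addrA subrK subrr.
by rewrite opprK -Eq -[z + _ - _]addrA -mulmxBl [RHS]addrCA -mulmxDl E.
Qed.
End Cocone.

(* The next triangle: cone (Y -> cone u) is X[1], up to the kernel cone (id_Y), and
   its map to Y[1] is -u[1] up to homotopy. *)
Section Rotation.
Variables (X Y : Ch) (u : Mor X Y).
Let io : @Mor k Ch Y (cone u) := cone_in u.

Definition rot_fun i : @Mor k (rep_cat k Q) (cone io i) (cshift X 1 i) :=
  @rcol k V Q _ _ (cone u i) 0 (rcol (idm (X (i + 1))) 0).

Lemma rot_mul i x (b : 'rV[k]_(rdim (Y (i + 1)) x)) (a : 'rV[k]_(rdim (X (i + 1)) x))
    (c : 'rV[k]_(rdim (Y i) x)) :
  row_mx b (row_mx a c) *m rmap (rot_fun i) x = a.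
Proof.
rewrite rmap_col mul_row_col rmap0 mulmx0 add0r rmap_col mul_row_col rmap1 rmap0.
by rewrite mulmx1 mulmx0 addr0.
Qed.

Lemma cone2_mul i x (b : 'rV[k]_(rdim (Y (i + 1)) x)) (a : 'rV[k]_(rdim (X (i + 1)) x))
    (c : 'rV[k]_(rdim (Y i) x)) :
  row_mx b (row_mx a c) *m rmap (cd (cone io) i) x =
  row_mx (- (b *m rmap (cd Y (i + 1)) x))
    (row_mx (- (a *m rmap (cd X (i + 1)) x))
            (b + (a *m rmap (cmap u (i + 1)) x + c *m rmap (cd Y i) x))).
Proof.
have E := cone_mul u a c; rewrite (cone_mul io); congr row_mx.
by rewrite E cone_in_mul add_row_mx add0r.
Qed.

Lemma cone2W i x (P : 'rV[k]_(rdim (cone io i) x) -> Prop) :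
  (forall b a c, P (row_mx b (row_mx a c))) -> forall w, P w.
Proof. by move=> H w; have [b [a [c ->]]] := row3P w. Qed.

Lemma rot_subproof : @chain_cond _ _ _ (cone io) (cshift X 1) rot_fun.
Proof.
apply: chain_cond_row => i x; elim/cone2W => b a c.
by rewrite cone2_mul !rot_mul shift1_mul.
Qed.
Definition rot_map : @Mor k Ch (cone io) (cshift X 1) := mk_chom rot_subproof.

Lemma rot_qis : quasi_iso rot_map.
Proof.
have cE n : cmap rot_map n = rot_fun n by [].
move=> i x; rewrite cE; split.
  elim/cone2W => b a c; rewrite /cocycle cone2_mul => /row3_eq0[_ _ E].
  rewrite rot_mul => -[a']; rewrite (@shift1_mul X i) => Ea.
  exists (row_mx (c - a' *m rmap (cmap u (i + 1)) x) (row_mx a' 0)).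
  rewrite cone2_mul mul0mx addr0 subrK -Ea; congr row_mx.
  rewrite mulmxBl rcmapC_mul -mulNmx -[a' *m _]opprK -Ea !mulNmx opprB.
  apply/eqP; rewrite -subr_eq0 opprB; apply/eqP; rewrite -[RHS]E.
  by rewrite opprK (addrC (c *m _)).
move=> a; rewrite /cocycle (@shift1_mul X (i + 1)) => /eqP; rewrite oppr_eq0 => /eqP Za.
(* With third component 0, the cocycle condition determines the first component. *)
exists (row_mx (- (a *m rmap (cmap u (i + 1 + 1)) x)) (row_mx a 0)); split.
  rewrite cone2_mul mul0mx addr0 addNr Za oppr0 mulNmx opprK.
  by rewrite (rcmapC_mul u) Za mul0mx !row_mx0.
by exists 0; rewrite rot_mul subrr mul0mx.
Qed.

Lemma cone_in_rot : (cone_in io : @Mor k Ch _ _) ;; rot_map = cone_out u.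
Proof.
apply: chomP => i; apply: rhomP => x; apply: mx_rowP => w.
rewrite cmapM rmapM mulmxA cone_in_mul -[w]hsubmxK.
have -> : cmap rot_map i = rot_fun i by [].
by rewrite rot_mul cone_out_mul.
Qed.

Lemma cone_out_rot : in_Db (cone_out io) = - (in_Db rot_map ;; in_Db (cshiftf u 1)).
Proof.
rewrite -in_DbM -in_DbN; apply: in_Db_htpy; rewrite opprK.
(* The homotopy sends (b, a, c) to [c]; the two differentials of [c] cancel and leave [b] plus the
   image of [a] under [u]. *)
exists (fun i => @rcol k V Q _ _ (cone u (i + 1)) 0 (rcol 0 (idm (Y (i + 1))))) => i.
apply: rhomP => x; apply: mx_rowP; elim/cone2W => b a c.
have cE n : cmap rot_map n = rot_fun n by [].
have hE n (b' : 'rV[k]_(rdim (Y (n + 1 + 1)) x)) (a' : 'rV[k]_(rdim (X (n + 1 + 1)) x))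
    (c' : 'rV[k]_(rdim (Y (n + 1)) x)) :
    row_mx b' (row_mx a' c') *m rmap (@rcol k V Q (Y (n + 1)) (Y (n + 1 + 1)) (cone u (n + 1))
       0 (rcol 0 (idm (Y (n + 1))))) x = c'.
  rewrite rmap_col mul_row_col rmap0 mulmx0 add0r rmap_col mul_row_col rmap1 rmap0.
  by rewrite mulmx1 mulmx0 add0r.
rewrite cmapD !rmapD !mulmxDr cone_out_mul cmapM !rmapM !mulmxA cE rot_mul.
rewrite cone2_mul !hE (@shift1_mul Y i) -[RHS]addrC -!addrA; congr (_ + _).
by rewrite subrr addr0.
Qed.

End Rotation.

Lemma cone_in_comp0 X Y (u : Mor X Y) : in_Db u ;; in_Db (cone_in u) = 0.
Proof.
rewrite -in_DbM; apply: in_Db_nullh.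
exists (fun i => rrow (idm (X (i + 1))) 0) => i; apply: rhomP => x; apply: mx_rowP => a.
have hE n (b : 'rV[k]_(rdim (X (n + 1)) x)) :
    b *m rmap (rrow (idm (X (n + 1))) (0 : @Mor k (rep_cat k Q) _ (Y n))) x = row_mx b 0.
  by rewrite rmap_row mul_mx_row rmap1 rmap0 mulmx1 mulmx0.
rewrite cmapM rmapD !rmapM mulmxDr !mulmxA !hE cone_mul cone_in_mul add_row_mx.
by rewrite addNr mul0mx !addr0.
Qed.

Lemma cone_out_comp0 X Y (u : Mor X Y) : in_Db (cone_in u) ;; in_Db (cone_out u) = 0.
Proof.
rewrite -in_DbM -in_Db0; congr in_Db; apply: chomP => i; apply: rhomP => x; apply: mx_rowP => b.
rewrite cmapM rmapM mulmxA cone_in_mul.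
have -> : row_mx 0 b *m rmap (cmap (cone_out u) i) x = 0 by apply: cone_out_mul.
by rewrite cmap0 rmap0 mulmx0.
Qed.

Lemma cone_exact1 X Y (u : Mor X Y) W (f : @Mor k D W Y) :
  f ;; in_Db (cone_in u) = 0 -> exists g, g ;; in_Db u = f.
Proof.
move=> f0; have [M [n [s [Qs fs]]]] := Db_frac f.
pose j : Mor X M := u ;; s.
have : in_Db (n ;; cone_in j) = 0.
  by rewrite in_DbM -fs -compA -in_DbM -cone_in_post in_DbM compA f0 comp0m.
(* The composite [n ;; cone_in j] vanishes only as a fraction: [t] is the quasi-isomorphism after
   which it becomes null-homotopic, and [h] is the homotopy. *)
move=> /in_Db_eq0[T [t [Qt [h Hh]]]].
pose w : @Mor k Ch M T := (cone_in j : @Mor k Ch _ _) ;; t.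
(* The pair (n, -h) lifts n[1] along [cone_out w]. *)
have C : @chain_cond _ _ _ (cshift W 1) (cone w) (fun i => rrow (cmap n (i + 1)) (- h i)).
  apply: chain_cond_row => i x a.
  rewrite shift1_mul !rmap_row !mul_mx_row cone_mul !rmapN !mulmxN !mulNmx opprK.
  rewrite (rcmapC_mul n); congr row_mx.
  have := congr1 (fun f => a *m rmap f x) (Hh i).
  rewrite -compA -/w cmapM rmapD !rmapM mulmxDr !mulmxA => ->.
  by rewrite [RHS]addrC addKr.
pose n' : @Mor k Ch (cshift W 1) (cone w) := mk_chom C.
have nE : in_Db n' ;; in_Db (cone_out w) = in_Db (cshiftf n 1).
  rewrite -in_DbM; congr in_Db; apply: chomP => i; apply: rhomP => x; apply: mx_rowP => a.
  rewrite cmapM rmapM mulmxA.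
  have -> : cmap n' i = rrow (cmap n (i + 1)) (- h i) by [].
  by rewrite rmap_row mul_mx_row; apply: cone_out_mul.
(* The quasi-isomorphism [cocone_map] identifies X[1] with [cone w] and turns [cone_out w] into
   j[1], so the lift yields g0 : W[1] -> X[1] with g0 j[1] = n[1]; it is the shift of the required
   morphism. *)
have Ir := iso_in_Db (cocone_qis Qt).
have [g0 g0E] := iso_divr (in_Db n') Ir.
have [g gE] := shift_map_surj g0.
exists g; apply: (@shift_map_inj _ _ _ _ _ 1).
rewrite shift_mapM gE shift_in_Db; apply: (iso_cancel (cshiftf_iso 1 Qs)).
rewrite (shift_frac 1 Qs fs) -nE -g0E -!compA; congr (_ ;; _).
by rewrite -in_DbM -cshiftfM -(cocone_out t) in_DbM.
Qed.

(** This is [cone_exact1] for the map from [Y] to [cone u], whose cone is X[1]. Rotating once more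
    gives [cone_exact3], where the sign of the rotated map is harmless. *)
Lemma cone_exact2 X Y (u : Mor X Y) W (f : @Mor k D W (cone u)) :
  f ;; in_Db (cone_out u) = 0 -> exists g, g ;; in_Db (cone_in u) = f.
Proof.
rewrite -cone_in_rot in_DbM compA => f0; apply: cone_exact1.
exact: (iso_cancel0 (iso_in_Db (rot_qis u)) f0).
Qed.

Lemma cone_exact3 X Y (u : Mor X Y) W (f : @Mor k D W (cshift X 1)) :
  f ;; in_Db (cshiftf u 1) = 0 -> exists g, g ;; in_Db (cone_out u) = f.
Proof.
move=> f0; have [f' f'E] := iso_divr f (iso_in_Db (rot_qis u)).
have [|g gE] := @cone_exact2 _ _ (cone_in u) W f'.
  by rewrite cone_out_rot compNr compA f'E f0 oppr0.
by exists g; rewrite -cone_in_rot in_DbM compA gE f'E.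
Qed.

Lemma cone_out_comp_shift X Y (u : Mor X Y) : in_Db (cone_out u) ;; in_Db (cshiftf u 1) = 0.
Proof.
rewrite -cone_in_rot in_DbM -compA -[_ ;; in_Db (cshiftf u 1)]opprK -cone_out_rot.
by rewrite compNr cone_out_comp0 oppr0.
Qed.

End Exactness.

(** * Cohomology *)

Section Cohomology.
Variables (k : fieldType) (V : finType) (Q : quiver V).
Local Notation D := (Db k Q).
Local Notation Ch := (cplx_cat k Q).
Implicit Types W X Y Z M T : Ch.

Section HomologyRank.
Variables (a b c a' b' c' : nat).
Variables (d1 : 'M[k]_(a, b)) (d2 : 'M[k]_(b, c)) (f : 'M[k]_(b, b')).
Variables (e1 : 'M[k]_(a', b')) (e2 : 'M[k]_(b', c')).
Hypotheses (dd : d1 *m d2 = 0) (ee : e1 *m e2 = 0) (fZ : kermx d2 *m f *m e2 = 0).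

(** On a complement [Z'] of the coboundaries in the cocycles, [f] is injective and its image meets
    the coboundaries of the target trivially. The ranks are compared by sums, which avoids forming
    quotient spaces. *)
Lemma rank_homology_inj :
  (forall u : 'rV_b, u *m d2 = 0 -> (u *m f <= e1)%MS -> (u <= d1)%MS) ->
  (\rank (kermx d2) + \rank e1 <= \rank (kermx e2) + \rank d1)%N.
Proof.
move=> H; set Z := kermx d2; set Z' := (Z :\: d1)%MS.
have Z'Z : (Z' <= Z)%MS by apply: diffmxSl.
have key (u : 'rV_b) : (u <= Z')%MS -> (u *m f <= e1)%MS -> u = 0.
  move=> uZ' uf; apply/eqP; rewrite -submx0 -(capmx_diff Z d1) sub_capmx uZ' H //.
  by apply/sub_kermxP; apply: submx_trans uZ' Z'Z.
have k0 : (Z' :&: kermx f)%MS = 0.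
  apply/eqP; rewrite -submx0; apply/rV_subP => u; rewrite sub_capmx => /andP[uZ' /sub_kermxP uf].
  by rewrite (key u uZ') ?sub0mx // uf sub0mx.
have c0 : (Z' *m f :&: e1)%MS = 0.
  apply/eqP; rewrite -submx0; apply/rV_subP => w; rewrite sub_capmx => /andP[/submxP[v ->]].
  by rewrite mulmxA => vf; rewrite (key (v *m Z')) ?submxMl // mul0mx sub0mx.
have rZ : (\rank Z <= \rank Z' + \rank d1)%N.
  by rewrite -(mxrank_cap_compl Z d1) addnC leq_add2l mxrankS // capmxSr.
have rZ' : \rank (Z' *m f) = \rank Z' by rewrite -[RHS](mxrank_mul_ker Z' f) k0 mxrank0 addn0.
have : (\rank (Z' *m f + e1)%MS <= \rank (kermx e2))%N.
  apply: mxrankS; rewrite addsmx_sub; apply/andP; split; apply/sub_kermxP => //.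
  by case/submxP: Z'Z => p ->; rewrite -!(mulmxA p) fZ mulmx0.
by rewrite mxrank_disjoint_sum // rZ'; lia.
Qed.

(** Dually, the image of the complement [Z'] and the coboundaries of the target together span all
    its cocycles. *)
Lemma rank_homology_surj :
  (forall v : 'rV_b', v *m e2 = 0 ->
     exists u : 'rV_b, u *m d2 = 0 /\ (v - u *m f <= e1)%MS) ->
  (d1 *m f <= e1)%MS ->
  (\rank (kermx e2) + \rank d1 <= \rank (kermx d2) + \rank e1)%N.
Proof.
move=> H df; set Z := kermx d2; set Z' := (Z :\: d1)%MS.
have dZ : (d1 <= Z)%MS by apply/sub_kermxP.
have rZ : \rank Z = (\rank d1 + \rank Z')%N.
  by rewrite -(mxrank_cap_compl Z d1) (capmx_idPr dZ).
have ZE : (Z <= Z' + d1)%MS.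
  by rewrite -{1}(addsmx_diff_cap_eq Z d1) addsmxS ?capmxSr.
have : (\rank (kermx e2) <= \rank (Z' *m f + e1)%MS)%N.
  apply: mxrankS; apply/rV_subP => v /sub_kermxP /H[u [/sub_kermxP uZ vu]].
  rewrite -[v](subrK (u *m f)) addmx_sub //; first exact: submx_trans vu (addsmxSr _ _).
  have /sub_addsmxP[[p q] /= ->] := submx_trans uZ ZE.
  rewrite mulmxDl -!mulmxA addmx_sub //.
    exact: submx_trans (submxMl _ _) (addsmxSl _ _).
  by apply: submx_trans (submxMl _ _) _; apply: submx_trans df (addsmxSr _ _).
have := mxrank_adds_leqif (Z' *m f) e1 => -[+ _].
have := mxrankM_maxl Z' f; lia.
Qed.
End HomologyRank.

(* The cohomology in degree [i + 1], not [i]. *)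
Definition hcoh X (i : int) (x : V) : nat :=
  (\rank (kermx (rmap (cd X (i + 1)) x)) - \rank (rmap (cd X i) x))%N.

Lemma hcohE X i x :
  (hcoh X i x + \rank (rmap (cd X i) x))%N = \rank (kermx (rmap (cd X (i + 1)) x)).
Proof. by rewrite subnK // mxrankS //; apply/sub_kermxP; apply: rcdd. Qed.

Lemma rdim_hcoh X i x : rdim (X (i + 1)) x =
  (hcoh X i x + \rank (rmap (cd X i) x) + \rank (rmap (cd X (i + 1)) x))%N.
Proof. by rewrite hcohE mxrank_ker subnK // rank_leq_row. Qed.

Lemma coboundaryP X i x (u : 'rV[k]_(rdim (X (i + 1)) x)) :
  coboundary u <-> (u <= rmap (cd X i) x)%MS.
Proof. by split=> [[w ->]|/submxP//]; apply: submxMl. Qed.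

Lemma ker_chain X Y (f : Mor X Y) i x :
  kermx (rmap (cd X i) x) *m rmap (cmap f i) x *m rmap (cd Y i) x = 0.
Proof. by rewrite -mulmxA -rcmapC mulmxA mulmx_ker mul0mx. Qed.

Lemma leq_hcoh (h r z h' r' z' : nat) :
  (h + r = z -> h' + r' = z' -> z + r' <= z' + r -> h <= h')%N.
Proof. by lia. Qed.

Lemma hcoh_inj X Y (f : Mor X Y) i x :
  (forall u : 'rV[k]_(rdim (X (i + 1)) x),
     cocycle u -> coboundary (u *m rmap (cmap f (i + 1)) x) -> coboundary u) ->
  (hcoh X i x <= hcoh Y i x)%N.
Proof.
move=> H; apply: leq_hcoh (hcohE X i x) (hcohE Y i x) _.
apply: (rank_homology_inj (rcdd Y i x) (ker_chain f (i + 1) x)).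
by move=> u Zu /coboundaryP Bu; apply/coboundaryP; apply: H.
Qed.

Lemma hcoh_qis X Y (f : Mor X Y) i x : quasi_iso f -> hcoh X i x = hcoh Y i x.
Proof.
move=> Qf; have [fI fS] := Qf i x; apply/eqP; rewrite eqn_leq (hcoh_inj fI).
apply: leq_hcoh (hcohE Y i x) (hcohE X i x) _.
apply: (rank_homology_surj (f := rmap (cmap f (i + 1)) x) (rcdd X i x)).
  by move=> v /fS[u [Zu /coboundaryP Bu]]; exists u.
by rewrite rcmapC submxMl.
Qed.

(** An isomorphism is a fraction whose denominator leaves [hcoh] unchanged. Its numerator [n] is
    invertible in the derived category, so some [n ;; m ;; t'] is homotopic to a quasi-isomorphism
    and [n] is injective on cohomology; the inverse isomorphism gives the opposite inequality. *)
Lemma hcoh_iso X Y i x : @isomorphic k D X Y -> hcoh X i x = hcoh Y i x.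
Proof.
suff H Z T : @isomorphic k D Z T -> (hcoh Z i x <= hcoh T i x)%N.
  move=> XY; apply/eqP; rewrite eqn_leq H // H //; exact: isomorphic_sym.
case=> f If; have [M [n [s [Qs fs]]]] := Db_frac f.
rewrite (hcoh_qis _ _ Qs); apply: (@hcoh_inj _ _ n).
have : is_iso (in_Db n) by rewrite -fs; apply: is_isoM (iso_in_Db Qs).
case=> g [ng _]; have [N [m [t [Qt gt]]]] := Db_frac g.
have : in_Db (n ;; m - t) = 0.
  by rewrite in_DbD in_DbN in_DbM -gt compA ng comp1m subrr.
move=> /in_Db_eq0[N' [t' [Qt' H]]].
have Q1 : quasi_iso (n ;; m ;; t').
  apply: (@qis_htpy _ _ _ _ _ (t ;; t')); last exact: qis_comp.
  rewrite -opprB -compBl; exact: (smemN (S := imem (null_ideal k Q) _ _) H).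
have [I _] := Q1 i x; move=> u Zu Bu; apply: I => //.
by rewrite !cmapM !rmapM !mulmxA; do 2 apply: cobound_map.
Qed.

Lemma hcoh_dsum X Y i x : hcoh (cdsum X Y) i x = (hcoh X i x + hcoh Y i x)%N.
Proof.
have H j : \rank (rmap (cd (cdsum X Y) j) x) =
    (\rank (rmap (cd X j) x) + \rank (rmap (cd Y j) x))%N.
  by rewrite -(rank_diag_block_mx (rmap (cd X j) x)).
have := rdim_hcoh (cdsum X Y) i x; have := rdim_hcoh X i x; have := rdim_hcoh Y i x.
by rewrite !H /=; lia.
Qed.

Lemma hcoh_eq0 X i x : hcoh X i x = 0%N ->
  forall u : 'rV[k]_(rdim (X (i + 1)) x), cocycle u -> coboundary u.
Proof.
move=> h0 u Zu; apply/coboundaryP.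
have dZ : (rmap (cd X i) x <= kermx (rmap (cd X (i + 1)) x))%MS.
  by apply/sub_kermxP; apply: rcdd.
have : (kermx (rmap (cd X (i + 1)) x) <= rmap (cd X i) x)%MS.
  by rewrite -(mxrank_leqif_sup dZ) -hcohE h0 add0n.
by apply: submx_trans; apply/sub_kermxP.
Qed.

Lemma hcoh0_zero X : (forall i x, hcoh X i x = 0%N) -> @is_zero k D X.
Proof. by move=> h0; apply: acyclic_zero => i x; apply: hcoh_eq0. Qed.

End Cohomology.

(** * Euler characteristic *)

Section BoundedSums.
Implicit Types F G : int -> int.

(** Sums over [\in] take the value 0 when the support is infinite, so their additivity requires such
    a bound. *)
Definition bounded_supp F := exists b : nat, forall i, (b < `|i|)%N -> F i = 0.

(** The list enumerates the integers from -b to b, so that two sums can be compared over one common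
    list. *)
Lemma fsum_bounded (P : set int) F (b : nat) :
  (forall i, (b < `|i|)%N -> F i = 0) ->
  \sum_(i \in P) F i = \sum_(i <- [seq j%:Z - b%:Z | j <- iota 0 b.*2.+1] | i \in P) F i.
Proof.
move=> Fb; set r := map _ _.
have ur : uniq r by rewrite map_inj_uniq ?iota_uniq // => i j /=; lia.
rewrite fsbig_mkcond (fsbigE r) //; first last.
- move=> i _ ir; rewrite /patch; case: ifP => // _; apply: Fb.
  case: leqP => // ib; exfalso; move/negP: ir; apply; apply/mapP.
  by exists `|(i + b%:Z)%R|%N; [rewrite mem_iota; lia | lia].
by rewrite [RHS]big_mkcond; apply: eq_big => i; rewrite ?in_setT.
Qed.

Lemma bounded_max F G : bounded_supp F -> bounded_supp G ->
  exists b : nat, forall i, (b < `|i|)%N -> F i = 0 /\ G i = 0.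
Proof.
move=> [b Fb] [b' Gb]; exists (maxn b b') => i; rewrite gtn_max => /andP[hb hb'].
by rewrite Fb ?Gb.
Qed.

Lemma fsum_boundedD (P : set int) F G : bounded_supp F -> bounded_supp G ->
  \sum_(i \in P) (F i + G i) = \sum_(i \in P) F i + \sum_(i \in P) G i.
Proof.
move=> Fb Gb; have [b H] := bounded_max Fb Gb.
rewrite !(@fsum_bounded _ _ b) => [|i /H[]//|i /H[]//|i /H[-> ->]]; last exact: addr0.
exact: big_split.
Qed.

Lemma fsumN (P : set int) F : \sum_(i \in P) - F i = - \sum_(i \in P) F i.
Proof.
by rewrite -mulN1r mulr_fsumr; apply: eq_fsbigr => i _; rewrite mulN1r.
Qed.

Lemma fsum_shift F : \sum_(i \in [set: int]) F (i + 1) = \sum_(i \in [set: int]) F i.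
Proof.
rewrite [RHS](reindex_fsbigT (fun i => i + 1)) //.
by exists (fun i => i - 1) => i; rewrite ?addrK ?subrK.
Qed.

End BoundedSums.

Section EulerCharacteristic.
Variables (k : fieldType) (V : finType) (Q : quiver V).
Local Notation D := (Db k Q).
Local Notation Ch := (cplx_cat k Q).
Implicit Types W X Y Z M T : Ch.

Local Notation sg i := ((-1) ^+ absz i%R : int).

Lemma sgS (i : int) : sg (i + 1) = - sg i.
Proof.
rewrite -signr_odd -[in RHS]signr_odd (_ : odd `|(i + 1)%R|%N = ~~ odd `|i|%N); last by lia.
by case: (odd _); rewrite /= ?expr1 ?expr0 ?opprK.
Qed.

Lemma bounded_sg (F : int -> nat) : (exists b : nat, forall i, (b < `|i|)%N -> F i = 0%N) ->
  bounded_supp (fun i => sg i * (F i)%:Z).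
Proof. by case=> b Fb; exists b => i /Fb ->; rewrite mulr0. Qed.

Lemma rank_bounded X x : exists b : nat, forall i, (b < `|i|)%N -> \rank (rmap (cd X i) x) = 0%N.
Proof.
have [b Xb] := cbnd X; exists b => i /Xb/(_ x) X0; apply/eqP; rewrite -leqn0 -X0.
exact: rank_leq_row.
Qed.

Lemma hcoh_bounded X : exists b : nat, forall i, (b < `|i|)%N -> forall x, hcoh X i x = 0%N.
Proof.
have [b Xb] := cbnd X; exists b.+1 => i hi x; apply/eqP; rewrite -leqn0.
have <- : rdim (X (i + 1)) x = 0%N by apply: Xb; lia.
by rewrite rdim_hcoh -addnA leq_addr.
Qed.

(** The Euler-Poincare formula: the dimension in degree i + 1 is that of the cohomology plus two
    ranks, and the ranks cancel after reindexing. The minus sign reflects that [hcoh X i] sits in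
    degree i + 1. *)
Lemma dim_vector_hcoh X x :
  dim_vector X x = - \sum_(i \in [set: int]) sg i * (hcoh X i x)%:Z.
Proof.
have rb := rank_bounded X x; pose r i := \rank (rmap (cd X i) x).
have hb : exists b : nat, forall i, (b < `|i|)%N -> hcoh X i x = 0%N.
  by have [b Hb] := hcoh_bounded X; exists b => i /Hb.
rewrite /dim_vector -fsum_shift.
transitivity (\sum_(i \in [set: int])
    (- (sg i * (hcoh X i x)%:Z) + (- (sg i * (r i)%:Z) + sg (i + 1) * (r (i + 1))%:Z))).
  apply: eq_fsbigr => i _; rewrite sgS rdim_hcoh !PoszD -/(r i) -/(r (i + 1)); ring.
have bN F : bounded_supp F -> bounded_supp (fun i => - F i).
  by case=> b Fb; exists b => i /Fb ->; rewrite oppr0.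
have b1 := bN _ (bounded_sg hb); have b2 := bN _ (bounded_sg rb).
have b3 : bounded_supp (fun i => sg (i + 1) * (r (i + 1))%:Z).
  by have [b Hb] := bounded_sg rb; exists b.+1 => i hi; apply: Hb; lia.
have b4 : bounded_supp (fun i => - (sg i * (r i)%:Z) + sg (i + 1) * (r (i + 1))%:Z).
  by have [b H] := bounded_max b2 b3; exists b => i /H[-> ->]; rewrite addr0.
rewrite fsum_boundedD // fsum_boundedD // !fsumN.
by rewrite (fsum_shift (fun i => sg i * (r i)%:Z)) addNr addr0.
Qed.

Lemma dim_vector_iso X Y : @isomorphic k D X Y -> dim_vector X = dim_vector Y.
Proof.
move=> XY; apply: funext => x; rewrite !dim_vector_hcoh; congr (- _).
by apply: eq_fsbigr => i _; rewrite (hcoh_iso _ _ XY).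
Qed.

Lemma rdim_bounded X x : exists b : nat, forall i, (b < `|i|)%N -> rdim (X i) x = 0%N.
Proof. by have [b Hb] := cbnd X; exists b => i /Hb. Qed.

Lemma dim_vector_dsum X Y x : dim_vector (dsum X Y) x = dim_vector X x + dim_vector Y x.
Proof.
rewrite /dim_vector -fsum_boundedD; try exact: bounded_sg (rdim_bounded _ x).
by apply: eq_fsbigr => i _; rewrite /= PoszD mulrDr.
Qed.

Lemma dim_vector_cone X Y (u : chom X Y) x :
  dim_vector (cone u) x = dim_vector Y x - dim_vector X x.
Proof.
rewrite /dim_vector -[X in _ - X]fsum_shift -fsumN -fsum_boundedD; first last.
- have [b Hb] := bounded_sg (rdim_bounded X x); exists b.+1 => i hi.
  by rewrite Hb ?oppr0 //; lia.
- exact: bounded_sg (rdim_bounded _ x).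
by apply: eq_fsbigr => i _; rewrite /= PoszD mulrDr sgS mulNr opprK addrC.
Qed.

End EulerCharacteristic.

(** * Vanishing of Hom spaces *)

Section Vanishing.
Variables (k : fieldType) (V : finType) (Q : quiver V).
Local Notation D := (Db k Q).
Local Notation Ch := (cplx_cat k Q).

(** * Subrepresentations and subcomplexes *)

Section Subrep.
Variables (M : rep k Q) (U : forall x, 'M[k]_(rdim M x)).
Hypothesis sU : forall h, (U (src h) *m ract M h <= U (tgt h))%MS.

(** The rows of [U x] need not be independent, so coordinates refer to [row_base (U x)]; [pinvmx]
    expresses the restricted action in them. *)
Definition subrep : rep k Q := @Rep k V Q (fun x => \rank (U x))
  (fun h => row_base (U (src h)) *m ract M h *m pinvmx (row_base (U (tgt h)))).

Lemma subrep_inj_subproof : @rep_commutes k V Q subrep M (fun x => row_base (U x)).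
Proof.
move=> h; rewrite mulmxKpV //.
rewrite (eqmxMr _ (eq_row_base _)) eq_row_base; exact: sU.
Qed.
Definition subrep_inj : @Mor k (rep_cat k Q) subrep M := mk_rhom subrep_inj_subproof.

Lemma rmap_subrep x : rmap subrep_inj x = row_base (U x).
Proof. by []. Qed.

Lemma subrep_inj_mono (N : rep_cat k Q) (f g : Mor N subrep) :
  f ;; subrep_inj = g ;; subrep_inj -> f = g.
Proof.
move=> e; apply: rhomP => x; apply: (row_free_inj (row_base_free (U x))).
exact: (congr1 (fun h => rmap h x) e).
Qed.

Lemma subrep_lift (N : rep_cat k Q) (f : @Mor k (rep_cat k Q) N M) :
  (forall x, (rmap f x <= U x)%MS) -> exists g : Mor N subrep, g ;; subrep_inj = f.
Proof.
move=> fU; have K x : rmap f x *m pinvmx (row_base (U x)) *m row_base (U x) = rmap f x.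
  by rewrite mulmxKpV // eq_row_base.
have C : @rep_commutes k V Q N subrep (fun x => rmap f x *m pinvmx (row_base (U x))).
  move=> h; apply: (row_free_inj (row_base_free (U (tgt h)))).
  apply: etrans (_ : ract N h *m rmap f (tgt h) = _); first by rewrite /= -[LHS]mulmxA K.
  rewrite rmapC -[in LHS](K (src h)) /= -[LHS]mulmxA -[RHS]mulmxA; congr (_ *m _).
  exact: (esym (subrep_inj_subproof h)).
by exists (mk_rhom C); apply: rhomP => x; rewrite rmapM; apply: K.
Qed.
End Subrep.

Section Subcomplex.
Variables (M : cplx_cat k Q) (U : forall i x, 'M[k]_(rdim (M i) x)).
Hypothesis sU : forall i h, (U i (src h) *m ract (M i) h <= U i (tgt h))%MS.
Hypothesis dU : forall i x, (U i x *m rmap (cd M i) x <= U (i + 1) x)%MS.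

Let S i : rep_cat k Q := subrep (U i).
Let inj i : Mor (S i) (M i) := subrep_inj (sU i).

Lemma subcplx_exd i : exists g : Mor (S i) (S (i + 1)), g ;; inj (i + 1) = inj i ;; cd M i.
Proof.
apply: subrep_lift => x; rewrite rmapM rmap_subrep.
by rewrite (eqmxMr _ (eq_row_base _)); apply: dU.
Qed.

Let d i := projT1 (boolp.cid (subcplx_exd i)).
Let dE i : d i ;; inj (i + 1) = inj i ;; cd M i.
Proof. by rewrite /d; case: boolp.cid. Qed.

Lemma subcplx_dd i : d i ;; d (i + 1) = 0.
Proof.
apply: (@subrep_inj_mono _ _ (sU _)).
by rewrite -/(inj _) -compA dE compA dE -compA cdd compm0 comp0m.
Qed.

Lemma subcplx_bnd : exists b : nat, forall i, (b < `|i|)%N -> forall x, rdim (S i) x = 0%N.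
Proof.
have [b Mb] := cbnd M; exists b => i /Mb M0 x; apply/eqP; rewrite -leqn0 -(M0 x).
exact: rank_leq_row.
Qed.

Definition subcplx : cplx_cat k Q := Cplx subcplx_dd subcplx_bnd.

Lemma subcplx_inj_subproof : @chain_cond k V Q subcplx M inj.
Proof. by move=> i; apply: dE. Qed.
Definition subcplx_inj : Mor subcplx M := mk_chom subcplx_inj_subproof.

Lemma subcplx_lift N (f : Mor N M) :
  (forall i x, (rmap (cmap f i) x <= U i x)%MS) -> exists g, g ;; subcplx_inj = f.
Proof.
move=> fU; have H i := subrep_lift (sU i) (fU i).
pose g i := projT1 (boolp.cid (H i)).
have gE i : g i ;; inj i = cmap f i by rewrite /g; case: boolp.cid.
have C : @chain_cond k V Q N subcplx g.
  move=> i; apply: (@subrep_inj_mono _ _ (sU _)); rewrite -/(inj _).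
  by rewrite -!compA [_ ;; inj (i + 1)]gE [cd subcplx i ;; _]dE compA gE cmapC.
by exists (mk_chom C); apply: chomP => i; apply: gE.
Qed.

Lemma subcplx_cocycle i x (u : 'rV[k]_(rdim (subcplx i) x)) :
  cocycle u -> @cocycle _ _ _ M i x (u *m row_base (U i x)).
Proof. exact: (cocycle_map subcplx_inj). Qed.

Lemma subcplx_coboundary i x (u : 'rV[k]_(rdim (subcplx (i + 1)) x)) (w : 'rV[k]_(rdim (M i) x)) :
  (w <= U i x)%MS -> u *m row_base (U (i + 1) x) = w *m rmap (cd M i) x -> coboundary u.
Proof.
rewrite -(eq_row_base (U i x)) => /submxP[w' ->] e; exists w'.
apply: (row_free_inj (row_base_free (U (i + 1) x))); rewrite /= e.
have E : rmap (inj i) x *m rmap (cd M i) x = rmap (d i) x *m rmap (inj (i + 1)) x.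
  by rewrite -!rmapM dE.
by rewrite -[LHS]mulmxA -[RHS]mulmxA; congr (_ *m _); apply: E.
Qed.
End Subcomplex.

(** Write f = g s^-1 with s : Y -> M. Since [Y] vanishes up to degree [n], [M] is acyclic there.
    Since [X] lives below degree [n], [g] factors through the canonical truncation of [M]
    (everything below [n], cocycles in degree [n], zero above), which is acyclic and hence zero. *)
Lemma Hom_vanish (X Y : cplx_cat k Q) (n : int) :
  (forall i, n <= i -> forall x, rdim (X i) x = 0%N) ->
  (forall i, i <= n -> forall x, rdim (Y i) x = 0%N) ->
  forall f : @Mor k D X Y, f = 0.
Proof.
move=> X0 Y0 f; have [M [g [s [Qs fs]]]] := Db_frac f.
have M0 i x (w : 'rV[k]_(rdim (M (i + 1)) x)) : i + 1 <= n -> cocycle w -> coboundary w.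
  move=> le_in; have [_ sS] := Qs i x; case/sS=> u [_].
  have -> : u = 0 by apply/rowP => j; have := ltn_ord j; rewrite {2}(Y0 _ le_in).
  by rewrite mul0mx subr0.
pose U i x : 'M[k]_(rdim (M i) x) :=
  if i < n then 1%:M else if i == n then kermx (rmap (cd M i) x) else 0.
have sU i h : (U i (src h) *m ract (M i) h <= U i (tgt h))%MS.
  rewrite /U; case: ifP => _; first exact: submx1.
  case: ifP => _; last by rewrite mul0mx sub0mx.
  by apply/sub_kermxP; rewrite -mulmxA rmapC mulmxA mulmx_ker mul0mx.
have dU i x : (U i x *m rmap (cd M i) x <= U (i + 1)%R x)%MS.
  rewrite /U; case: ifP => lt_in; last first.
    by case: ifP => _; rewrite ?mulmx_ker ?mul0mx sub0mx.
  rewrite mul1mx; case: ifP => ge_in; first exact: submx1.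
  have -> : i + 1 == n by lia.
  by apply/sub_kermxP; apply: rcdd.
have [|g' g'E] := subcplx_lift sU dU (f := g).
  move=> i x; rewrite /U; case: ifP => lt_in; first exact: submx1.
  apply/row_subP => j; have := ltn_ord j; rewrite {2}X0 //; lia.
have K0 : @is_zero k D (subcplx sU dU).
  apply: acyclic_zero => i x u /subcplx_cocycle Zu.
  have [le_in|lt_ni] := leP (i + 1) n; last first.
    have e : \rank (U (i + 1) x) = 0%N.
      rewrite /U ifN ?ifN ?mxrank0 //; lia.
    exists 0; rewrite mul0mx; apply/rowP => j; have := ltn_ord j.
    by rewrite {2}[rdim _ _]e.
  have [w e] := M0 _ _ _ le_in Zu; apply: (@subcplx_coboundary _ _ sU dU _ _ _ w) => //.
  by rewrite /U ifT ?submx1 //; lia.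
apply: (iso_cancel0 (iso_in_Db Qs)).
by rewrite fs -g'E in_DbM -[in_Db g']compm1 K0 compm0 comp0m.
Qed.

End Vanishing.

(** * Finiteness of Hom spaces *)

Section Biproduct.
Variables (k : fieldType) (V : finType) (Q : quiver V).
Local Notation D := (Db k Q).
Local Notation Ch := (cplx_cat k Q).
Implicit Types W X Y : Ch.

Lemma ccol_subproof W X Y (f : Mor X W) (g : Mor Y W) :
  @chain_cond _ _ _ (cdsum X Y) W (fun i => rcol (cmap f i) (cmap g i)).
Proof.
move=> i; apply: rhomP => x; rewrite !rmapM !rmap_col !rmap_row !rmap0.
by rewrite !mul_col_mx !mul_row_col !mul0mx addr0 add0r !rcmapC.
Qed.
Definition ccol W X Y (f : Mor X W) (g : Mor Y W) : @Mor k Ch (cdsum X Y) W :=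
  mk_chom (ccol_subproof f g).

Lemma crow_ccol W X Y Z (f : Mor Z X) (g : Mor Z Y) (f' : Mor X W) (g' : Mor Y W) :
  crow f g ;; ccol f' g' = f ;; f' + g ;; g'.
Proof.
apply: chomP => i; apply: rhomP => x; rewrite cmapD !cmapM rmapD !rmapM.
exact: mul_row_col.
Qed.

Lemma ccol_crow_id X Y :
  ccol (idm X) 0 ;; crow (idm X) 0 + ccol 0 (idm Y) ;; crow 0 (idm Y)
  = idm (cdsum X Y : Ch).
Proof.
apply: chomP => i; apply: rhomP => x.
have E : col_mx 1%:M 0 *m row_mx 1%:M 0 + col_mx 0 1%:M *m row_mx 0 1%:M
       = 1%:M :> 'M[k]_(rdim (X i) x + rdim (Y i) x).
  rewrite !mul_col_row !mulmx1 !mulmx0 ?mul0mx.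
  by rewrite add_block_mx !addr0 !add0r -scalar_mx_block.
exact: E.
Qed.

Definition dsum_hom W X Y (p : @Mor k D W X * @Mor k D W Y) : @Mor k D W (dsum X Y) :=
  p.1 ;; in_Db (crow (idm X) 0) + p.2 ;; in_Db (crow 0 (idm Y)).

Lemma dsum_hom_linear W X Y : linear (@dsum_hom W X Y).
Proof. by move=> c p q; rewrite /dsum_hom !compPl scalerDr addrACA. Qed.

Lemma dsum_hom_inj W X Y : injective (@dsum_hom W X Y).
Proof.
move=> [f g] [f' g']; rewrite /dsum_hom /= => e.
have p1 h h' : (h ;; in_Db (crow (idm X) 0) + h' ;; in_Db (crow 0 (idm Y))) ;;
    in_Db (ccol (idm X) 0) = h :> @Mor k D W X.
  rewrite compDl -!compA -!in_DbM !crow_ccol !comp1m !comp0m !addr0 in_Db0 in_Db1.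
  by rewrite compm0 compm1 addr0.
have p2 h h' : (h ;; in_Db (crow (idm X) 0) + h' ;; in_Db (crow 0 (idm Y))) ;;
    in_Db (ccol 0 (idm Y)) = h' :> @Mor k D W Y.
  rewrite compDl -!compA -!in_DbM !crow_ccol !comp1m !comp0m !add0r in_Db0 in_Db1.
  by rewrite compm0 compm1 add0r.
by congr pair; [rewrite -(p1 f g) e p1 | rewrite -(p2 f g) e p2].
Qed.

Lemma dsum_hom_surj W X Y (f : @Mor k D W (dsum X Y)) : exists p, dsum_hom p = f.
Proof.
exists (f ;; in_Db (ccol (idm X) 0), f ;; in_Db (ccol 0 (idm Y))).
transitivity (f ;; in_Db (ccol (idm X) 0) ;; in_Db (crow (idm X) 0) +
              f ;; in_Db (ccol 0 (idm Y)) ;; in_Db (crow 0 (idm Y))) => //.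
by rewrite -!compA -compDr -!in_DbM -in_DbD ccol_crow_id in_Db1 compm1.
Qed.

Lemma fin_dim_dsum W X Y : fin_dim (@Mor k D W X) -> fin_dim (@Mor k D W Y) ->
  fin_dim (@Mor k D W (dsum X Y)).
Proof.
move=> fX fY; apply: (fin_dim_surj (@dsum_hom_linear W X Y) (@dsum_hom_surj W X Y)).
exact: fin_dim_prod.
Qed.

Lemma dimk_dsum W X Y : fin_dim (@Mor k D W X) -> fin_dim (@Mor k D W Y) ->
  dimk [set: @Mor k D W (dsum X Y)] =
  (dimk [set: @Mor k D W X] + dimk [set: @Mor k D W Y])%N.
Proof.
move=> fX fY.
rewrite (dimk_bij (@dsum_hom_linear W X Y) (@dsum_hom_inj W X Y) (@dsum_hom_surj W X Y)).
  by apply: dimkE; apply: has_dim_prod; apply: fin_dimP.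
exact: fin_dim_prod.
Qed.

(** * Reduction to indecomposable objects *)

Section KrullSchmidt.
Variable W : Ch.
Hypothesis fin_indec : forall X : Ch, indecomposable X -> fin_dim (@Mor k D W X).

(** A decomposable object has two non-zero summands, each with non-zero cohomology by [hcoh0_zero],
    so additivity makes both strictly smaller. The window from -b to b stays fixed, as the
    cohomology of a summand is bounded by that of the whole. *)
Lemma fin_dim_Hom (Y : Ch) : fin_dim (@Mor k D W Y).
Proof.
have [b Yb] := hcoh_bounded Y.
pose tot (X : Ch) := (\sum_(j < b.*2.+1) \sum_x hcoh X (j%:Z - b%:Z) x)%N.
have [n leYn] := ubnP (tot Y); elim: n => // n IHn in Y Yb leYn *.
have [Y0|Y0] := pselect (@is_zero k D Y).
  exists 0%N; apply: has_dim0; apply/seteqP; split=> // f _ /=.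
  by rewrite -[f]compm1 Y0 compm0.
have [/fin_indec//|Yd] := pselect (indecomposable Y).
have [X [Z [YXZ [X0 Z0]]]] : exists X Z : Ch,
    @isomorphic k D Y (dsum X Z) /\ ~ @is_zero k D X /\ ~ @is_zero k D Z.
  apply: contrapT => H; apply: Yd; split=> // X Z YXZ.
  apply: contrapT => /not_orP XZ; apply: H; exists X, Z; split=> //.
have hE i x : hcoh Y i x = (hcoh X i x + hcoh Z i x)%N.
  by rewrite (hcoh_iso _ _ YXZ) hcoh_dsum.
have Xb i : (b < `|i|)%N -> forall x, hcoh X i x = 0%N.
  by move=> /Yb H x; have := H x; rewrite hE; lia.
have Zb i : (b < `|i|)%N -> forall x, hcoh Z i x = 0%N.
  by move=> /Yb H x; have := H x; rewrite hE; lia.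
have totE : tot Y = (tot X + tot Z)%N.
  rewrite /tot -big_split; apply: eq_bigr => j _; rewrite -big_split.
  by apply: eq_bigr => x _; apply: hE.
have pos T : (forall i, (b < `|i|)%N -> forall x, hcoh T i x = 0%N) ->
    ~ @is_zero k D T -> (0 < tot T)%N.
  move=> Tb T0; rewrite lt0n; apply/negP => /eqP t0; apply: T0; apply: hcoh0_zero => i x.
  have [/Tb//|leib] := ltnP b `|i|.
  have lt_ib : (`|(i + b%:Z)%R| < b.*2.+1)%N by lia.
  move/eqP: t0; rewrite sum_nat_eq0 => /forallP/(_ (Ordinal lt_ib)) /=.
  rewrite sum_nat_eq0 => /forallP/(_ x) /=.
  by rewrite (_ : _ - b%:Z = i) => [/eqP|]; last lia.
have := pos X Xb X0; have := pos Z Zb Z0 => pZ pX.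
apply: (fin_dim_isor (isomorphic_sym YXZ)); apply: fin_dim_dsum.
  by apply: IHn => //; lia.
by apply: IHn => //; lia.
Qed.
End KrullSchmidt.
End Biproduct.

(** * Hom spaces of the mesh category *)

Section MeshFinite.
Variables (k : fieldType) (V : finType) (e : rel V) (x0 : V) (C : lincat k).
Local Notation ver := (zvertex e x0).
Variable v : ver -> C.
Variable phi : forall x y : ver, zarrow x y -> Mor (v x) (v y).
Implicit Types x y z : ver.

(** A Kronecker symbol: the scalar part of an expression can then be written for any pair of
    vertices. *)
Definition mesh_one x y : Mor (v x) (v y) :=
  match x =P y with
  | ReflectT exy => eq_rect x (fun y => Mor (v x) (v y) : Type) (idm (v x)) y exy
  | ReflectF _ => 0
  end.

Lemma mesh_one_id x : mesh_one x x = idm (v x).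
Proof. by rewrite /mesh_one; case: eqP => // exx; rewrite (eq_irrelevance exx erefl). Qed.

Lemma mesh_one_neq x y : x <> y -> mesh_one x y = 0.
Proof. by rewrite /mesh_one; case: eqP. Qed.

Definition mesh_arr x y : Mor (v x) (v y) :=
  match @idP (zarrow x y) with ReflectT h => phi h | ReflectF _ => 0 end.

Lemma mesh_arrE x y (h : zarrow x y) : mesh_arr x y = phi h.
Proof.
rewrite /mesh_arr; case: {-}_ / idP => // h'; congr phi; exact: bool_irrelevance.
Qed.

(** All vertices of the next column are listed, adjacent to [x] or not; [mesh_arr] is 0 where there
    is no arrow. *)
Definition mesh_succ x : seq ver :=
  pmap (insub : int * V -> option ver) [seq ((val x).1 + 1, b) | b <- enum V].

Lemma mesh_succ_uniq x : uniq (mesh_succ x).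
Proof. by rewrite pmap_sub_uniq // map_inj_uniq ?enum_uniq // => a b []. Qed.

Lemma mem_mesh_succ x y : (y \in mesh_succ x) = ((val y).1 == (val x).1 + 1).
Proof.
rewrite mem_pmap_sub; apply/mapP/eqP => [[b _ ->]//|e1].
by exists (val y).2; rewrite ?mem_enum // -e1; case: (val y).
Qed.

(** Every path is either trivial or starts with an arrow, so a morphism is a scalar part plus
    morphisms factoring through the next column. *)
Lemma mesh_eval_factor x y (s : mesh_expr k x y) :
  exists (c : k) (g : forall z, Mor (v z) (v y)),
    mesh_eval phi s = c *: mesh_one x y + \sum_(z <- mesh_succ x) mesh_arr x z ;; g z.
Proof.
have sum0 (a b : ver) : \sum_(z <- mesh_succ a) mesh_arr a z ;; (0 : Mor (v z) (v b)) = 0.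
  by rewrite big1 // => z _; rewrite compm0.
elim: {x y} s => [x|x y h|x y z s [c [g sE]] t [c' [g' tE]]|x y
                 |x y s [c [g sE]] t [c' [g' tE]]|x y a s [c [g sE]]] /=.
- by exists 1, (fun=> 0); rewrite sum0 addr0 scale1r mesh_one_id.
- exists 0, (fun z => mesh_one z y); rewrite scale0r add0r.
  rewrite (bigD1_seq y) ?mesh_succ_uniq //=; last by rewrite mem_mesh_succ; case/andP: h.
  rewrite mesh_one_id compm1 (mesh_arrE h) big1 ?addr0 // => z /eqP zy.
  by rewrite mesh_one_neq ?compm0.
- have H (g1 : forall w, Mor (v w) (v y)) :
      (\sum_(w <- mesh_succ x) mesh_arr x w ;; g1 w) ;; mesh_eval phi t =
      \sum_(w <- mesh_succ x) mesh_arr x w ;; (g1 w ;; mesh_eval phi t).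
    elim: (mesh_succ x) => [|w l IH]; first by rewrite !big_nil comp0m.
    by rewrite !big_cons compDl IH compA.
  rewrite sE compDl compZl H.
  (* The scalar part of the first factor survives only if its ends coincide; then the second factor
     is expanded as well. *)
  have [exy|nxy] := eqVneq x y; last first.
    exists 0, (fun w => g w ;; mesh_eval phi t).
    by rewrite mesh_one_neq ?comp0m ?scaler0 ?scale0r //; apply/eqP.
  subst y.
  exists (c * c'), (fun w => c *: g' w + g w ;; mesh_eval phi t).
  rewrite mesh_one_id comp1m {1}tE scalerDr scalerA -addrA; congr (_ + _).
  rewrite scaler_sumr -big_split; apply: eq_bigr => w _ /=.
  by rewrite compPr.
- by exists 0, (fun=> 0); rewrite sum0 addr0 scale0r.
- exists (c + c'), (fun w => g w + g' w); rewrite sE tE addrACA -scalerDl; congr (_ + _).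
  by rewrite -big_split; apply: eq_bigr => w _; rewrite compDr.
- exists (a * c), (fun w => a *: g w); rewrite sE scalerDr scalerA; congr (_ + _).
  by rewrite scaler_sumr; apply: eq_bigr => w _; rewrite compZr.
Qed.

(** Arrows raise the first coordinate. In a composite that lowers it, one of the two factors lowers
    it too. *)
Lemma mesh_eval_back x y (s : mesh_expr k x y) : (val y).1 < (val x).1 -> mesh_eval phi s = 0.
Proof.
elim: {x y} s => [x|x y h|x y z s IHs t IHt|x y|x y s IHs t IHt|x y a s IHs] //=.
- by rewrite ltxx.
- by case/andP: (h) => _ /eqP->; rewrite ltNge lerDl ler01.
- move=> zx; have [yx|xy] := ltP (val y).1 (val x).1; first by rewrite IHs ?comp0m.
  by rewrite IHt ?compm0 //; apply: lt_le_trans zx xy.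
- by move=> yx; rewrite IHs ?IHt ?addr0.
- by move=> yx; rewrite IHs ?scaler0.
Qed.

Hypothesis surj_phi : forall x y (f : Mor (v x) (v y)), exists s, mesh_eval phi s = f.

(** Induction on a bound [n] for how far [y] lies to the right of [x]: passing to a successor of [x]
    decreases [n], and at n = 0 there are no non-zero morphisms. *)
Lemma fin_dim_mesh x y : fin_dim (Mor (v x) (v y)).
Proof.
have [n] : exists n : nat, (val y).1 < (val x).1 + n%:Z.
  by exists (absz ((val y).1 - (val x).1)).+1; move: (val y).1 (val x).1 => p q; lia.
elim: n => [|n IHn] in x *; rewrite ?addr0 => yx.
  exists 0%N; apply: has_dim0; apply/seteqP; split=> // f _ /=.
  by have [s <-] := surj_phi f; apply: mesh_eval_back.
have fz z : z \in mesh_succ x -> fin_dim (Mor (v z) (v y)).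
  by rewrite mem_mesh_succ => /eqP ez; apply: IHn; rewrite ez -addrA -intS.
(* [L] reads off one row vector the scalar and the coordinates of [g z] for all successors [z]; it
   is built along the list of successors. *)
have [m [L [lL SL]]] : exists m (L : 'rV[k]_m -> Mor (v x) (v y)), linear L /\
    forall c (g : forall z, Mor (v z) (v y)), exists u,
      L u = c *: mesh_one x y + \sum_(z <- mesh_succ x) mesh_arr x z ;; g z.
  elim: (mesh_succ x) fz => [|z l IHl] fz.
    exists 1%N, (fun u => u 0 0 *: mesh_one x y); split.
      by move=> c u w; rewrite !mxE scalerDl scalerA.
    by move=> c g; exists (c%:M); rewrite big_nil addr0 mxE mulr1n.
  have [|m [L [lL SL]]] := IHl; first by move=> w wl; apply: fz; rewrite inE wl orbT.
  have [p [b [_ bT]]] := fz z (mem_head _ _).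
  exists (m + p)%N, (fun u => L (lsubmx u) + mesh_arr x z ;; b (rsubmx u)); split.
    by move=> c u w; rewrite !linearP lL compPr scalerDr addrACA.
  move=> c g; have [u uE] := SL c g; have : range b (g z) by rewrite bT.
  case=> w _ wE; exists (row_mx u w); rewrite row_mxKl row_mxKr uE wE big_cons.
  by rewrite -addrA; congr (_ + _); rewrite addrC.
apply: (fin_dim_surj lL).
  move=> f; have [s <-] := surj_phi f; have [c [g ->]] := mesh_eval_factor s.
  exact: SL.
exists m; apply: (@has_dimP _ _ _ _ id) => //.
by apply/seteqP; split=> // u _; exists u.
Qed.

End MeshFinite.

(** * The truncated Euler form on a triangle *)

Section RankHom.
Variables (k : fieldType) (C : lincat k).
Implicit Types W X Y : C.

Lemma has_dim_range_Hom W X Y (f : Mor X Y) : fin_dim (Mor W X) ->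
  has_dim (range (fun u : Mor W X => u ;; f)) (rk_Hom W f).
Proof. by move=> fW; apply: has_dim_range => //; apply: linear_compr. Qed.

Lemma rk_Hom_isol W W' X Y (f : Mor X Y) : isomorphic W W' -> fin_dim (Mor W X) ->
  rk_Hom W' f = rk_Hom W f.
Proof.
move=> /isomorphic_sym[g Ig] fW; have [gI _] := iso_compl_bij Y Ig.
apply: dimkE; have := has_dim_image (linear_compl g) gI (has_dim_range_Hom f fW).
congr has_dim; apply/seteqP; split=> [_ [_ [u _ <-] <-]|_ [u _ <-]].
  by exists (g ;; u); rewrite ?compA.
have [_ /(_ u)[w <-]] := iso_compl_bij X Ig.
by exists (w ;; f); [exists w | rewrite compA].
Qed.

Lemma rk_Hom_isor W X Y X' Y' (f : Mor X Y) (f' : Mor X' Y') (c : Mor X X') (a : Mor Y Y') :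
  is_iso c -> is_iso a -> f ;; a = c ;; f' -> fin_dim (Mor W X) ->
  rk_Hom W f' = rk_Hom W f.
Proof.
move=> Ic Ia e fW; have [aI _] := iso_compr_bij W Ia.
apply: dimkE; have := has_dim_image (@linear_compr _ _ W _ _ a) aI (has_dim_range_Hom f fW).
congr has_dim; apply/seteqP; split=> [_ [_ [u _ <-] <-]|_ [u _ <-]].
  by exists (u ;; c); rewrite // -!compA e.
have [w <-] := iso_divr u Ic.
by exists (w ;; f); [exists w | rewrite -!compA e].
Qed.

Lemma rk_Hom_le W X Y (f : Mor X Y) : fin_dim (Mor W X) ->
  (rk_Hom W f <= dimk [set: Mor W X])%N.
Proof. by move=> fW; rewrite -(dimk_ker (@linear_compr _ _ W _ _ f) fW) leq_addr. Qed.

End RankHom.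

Section EulerForm.
Variables (k : fieldType) (V : finType) (Q : quiver V).
Local Notation D := (Db k Q).
Local Notation Ch := (cplx_cat k Q).
Local Notation rk W f := (@rk_Hom k D W _ _ f).
Local Notation h W X := (dimk [set: @Mor k D W X]).

(** Rank-nullity is applied to the three consecutive maps out of Hom(W, X), Hom(W, Y) and Hom(W,
    cone u). *)
Lemma cone_rank (X Y : Ch) (u : Mor X Y) (W : Ch) :
  (forall T, fin_dim (@Mor k D W T)) ->
  (h W X + h W (cone u) =
   h W Y + (rk W (in_Db (cone_out u)) + rk (shift W 1%R) (in_Db (cone_out u))))%N.
Proof.
move=> fW; set r1 := rk (shift W 1) _.
pose al (f : @Mor k D W X) : @Mor k D W Y := f ;; in_Db u.
pose be (f : @Mor k D W Y) : @Mor k D W (cone u) := f ;; in_Db (cone_in u).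
pose ga (f : @Mor k D W (cone u)) : @Mor k D W (cshift X 1) := f ;; in_Db (cone_out u).
have kal := dimk_ker (f := al) (@linear_compr k D W X Y (in_Db u)) (fW _).
have kbe := dimk_ker (f := be) (@linear_compr k D W Y (cone u) (in_Db (cone_in u))) (fW _).
have kga := dimk_ker (f := ga)
  (@linear_compr k D W (cone u) (cshift X 1) (in_Db (cone_out u))) (fW _).
have ebe : [set f | be f = 0]%classic = range al.
  apply/seteqP; split=> [f /cone_exact1[g gE]|_ [g _ <-]]; first by exists g.
  by rewrite /= /be /al -compA cone_in_comp0 compm0.
have ega : [set f | ga f = 0]%classic = range be.
  apply/seteqP; split=> [f /cone_exact2[g gE]|_ [g _ <-]]; first by exists g.
  by rewrite /= /be /ga -compA cone_out_comp0 compm0.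
(* By exactness at X[1] the image of Hom(W[1], cone u) consists of the morphisms killed by u[1], and
   the shift identifies these with the kernel of [al]. *)
have er1 : r1 = dimk [set f | al f = 0]%classic.
  have [r [_ _ hk]] := rank_nullity (f := al) (@linear_compr k D W X Y (in_Db u)) (fW _).
  rewrite (dimkE hk); apply: dimkE.
  have := has_dim_image (@linear_shift_map _ _ _ W X 1) (@shift_map_inj _ _ _ W X 1) hk.
  congr has_dim; apply/seteqP; split=> [_ [f /= f0 <-]|_ [g _ <-]].
    have [|g gE] := @cone_exact3 _ _ _ _ _ u (shift W 1) (shift_map f 1); last by exists g.
    by rewrite -shift_in_Db -shift_mapM [X in shift_map X]f0 shift_map0.
  have [f fE] := shift_map_surj (g ;; in_Db (cone_out u) : @Mor k D (cshift W 1) (cshift X 1)).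
  exists f => //; apply: (@shift_map_inj _ _ _ _ _ 1).
  by rewrite /= shift_mapM fE shift_in_Db -compA cone_out_comp_shift compm0 shift_map0.
rewrite ebe in kbe; rewrite ega in kga; rewrite er1.
have arith (ra ka hX rb hY rg hC : nat) :
  (ra + ka = hX -> rb + ra = hY -> rg + rb = hC -> hX + hC = hY + (rg + ka))%N by lia.
exact: arith kal kbe kga.
Qed.

Lemma shift_vanish (X Y : Ch) :
  exists N : nat, forall n, (N <= n)%N -> h (shift X n%:Z) Y = 0%N.
Proof.
(* [Y] vanishes up to degree -(b' + 1), and for n >= b + b' + 2 the complex X[n] vanishes from that
   degree on. *)
have [b Xb] := cbnd X; have [b' Yb] := cbnd Y; exists (b + b').+2 => n le_n.
apply: dimkE; apply: has_dim0; apply/seteqP; split=> // f _ /=.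
apply: (@Hom_vanish _ _ _ _ _ (- (b'.+1)%:Z)) => i hi x /=; first by apply: Xb; lia.
by apply: Yb; lia.
Qed.

Lemma trunc_euler_sum (X Y : Ch) (N : nat) :
  (forall n, (N <= n)%N -> hdim X Y (- n%:Z) = 0%N) ->
  trunc_euler X Y = \sum_(n < N) (-1) ^+ n * (hdim X Y (- n%:Z))%:Z.
Proof.
move=> h0; rewrite /trunc_euler.
rewrite (reindex_fsbig (fun n : nat => - n%:Z) [set: nat]%classic); last first.
  split=> [n _ /=|m n _ _|i /= le_i0]; [by lia|by lia|].
  by exists `|i|%N => //; lia.
rewrite (eq_fsbigr (fun n : nat => (-1) ^+ n * (hdim X Y (- n%:Z))%:Z)); last first.
  by move=> n _; rewrite abszN absz_nat.
rewrite (fsbig_ord _ _ (fun n : nat => (-1) ^+ n * (hdim X Y (- n%:Z))%:Z)).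
apply/esym/fsbig_widen => // n [_ /= /negP]; rewrite -leqNgt => /h0 ->.
by rewrite mulr0.
Qed.

Lemma alternating_telescope (r : nat -> nat) N :
  \sum_(n < N) (-1) ^+ n * (r n + r n.+1)%:Z = (r 0%N)%:Z - (-1) ^+ N * (r N)%:Z.
Proof.
elim: N => [|N IH]; first by rewrite big_ord0 expr0 mul1r subrr.
by rewrite big_ord_recr IH PoszD exprS /=; ring.
Qed.

Lemma euler_triangle (A B C W : D) (f : Mor A B) (g : Mor B C) (s : Mor C (shift A 1)) :
  (forall T : D, fin_dim (Mor W T)) -> distinguished f g s ->
  trunc_euler W (dsum A C) - trunc_euler W B = (rk_Hom W s)%:Z.
Proof.
move=> fW [X [Y [u [a [b [c [[Ia Ib Ic] [_ _ es]]]]]]]].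
have adj n T : fin_dim (@Mor k D (shift W n%:Z) T) /\
    h (shift W n%:Z) T = hdim W T (- n%:Z).
  by have := @shift_adj _ _ _ W T (- n%:Z) (fW _); rewrite opprK.
have fn n T := (adj n T).1.
pose r n := rk (shift W n%:Z) (in_Db (cone_out u)).
have rE n : (hdim W A (- n%:Z) + hdim W C (- n%:Z) = hdim W B (- n%:Z) + (r n + r n.+1))%N.
  have iA : isomorphic A X by exists a.
  have iB : isomorphic B Y by exists b.
  have iC : isomorphic C (cone u : D) by exists c.
  rewrite -!(adj n _).2 -(dimk_isor iA) // -(dimk_isor iB) // -(dimk_isor iC) //.
  rewrite (cone_rank u (fn n)); congr (_ + (_ + _))%N.
  apply: rk_Hom_isol (fn _ _).
  by apply: shift_shift_iso; lia.
have [N1 hA] := shift_vanish W A; have [N2 hB] := shift_vanish W B.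
have [N3 hC] := shift_vanish W C; have [N4 hc] := shift_vanish W (cone u).
pose N := (N1 + N2 + N3 + N4)%N.
have hdA n : (N <= n)%N -> hdim W A (- n%:Z) = 0%N.
  by move=> le_n; rewrite -(adj n _).2 hA //; lia.
have hdB n : (N <= n)%N -> hdim W B (- n%:Z) = 0%N.
  by move=> le_n; rewrite -(adj n _).2 hB //; lia.
have hdC n : (N <= n)%N -> hdim W C (- n%:Z) = 0%N.
  by move=> le_n; rewrite -(adj n _).2 hC //; lia.
have hdAC n : hdim W (dsum A C) (- n%:Z) = (hdim W A (- n%:Z) + hdim W C (- n%:Z))%N.
  by rewrite -!(adj n _).2 dimk_dsum.
rewrite !(@trunc_euler_sum _ _ N) => [|n /hdB//|n le_n]; last by rewrite hdAC hdA ?hdC.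
rewrite -sumrB (eq_bigr (fun n : 'I_N => (-1) ^+ n * (r n + r n.+1)%:Z)); last first.
  by move=> n _; rewrite hdAC rE !PoszD; ring.
rewrite alternating_telescope.
(* The boundary term is at most the dimension of Hom(W[N], cone u), which is why [N] also exceeds
   [N4]. *)
have -> : r N = 0%N.
  by apply/eqP; rewrite -leqn0 -(hc N) ?rk_Hom_le //; lia.
rewrite mulr0 subr0; congr Posz.
(* The surviving rank is taken at W[0], which is only isomorphic to [W], and on the cone instead of
   the given triangle. *)
have iW : isomorphic W (shift W 0) by exists (in_Db (shift_zero W)); apply: shift_zero_iso.
apply: etrans (rk_Hom_isol _ iW (fW _)) _.
exact: (rk_Hom_isor Ic (shift_iso 1 Ia) es).
Qed.

Lemma dim_vector_triangle (A B C : D) (f : Mor A B) (g : Mor B C) (s : Mor C (shift A 1)) :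
  distinguished f g s -> dim_vector B = dim_vector (dsum A C).
Proof.
move=> [X [Y [u [a [b [c [[Ia Ib Ic] _]]]]]]]; apply: funext => x.
rewrite dim_vector_dsum (@dim_vector_iso _ _ _ A X); last by exists a.
rewrite (@dim_vector_iso _ _ _ B Y); last by exists b.
rewrite (@dim_vector_iso _ _ _ C (cone u)); last by exists c.
by rewrite dim_vector_cone addrC subrK.
Qed.

End EulerForm.

(** The first conjunct is the equality of classes under which $\delta_{B,A\oplus C}$ is defined. *)
Theorem corollary2p12 (k : closedFieldType) (Delta : dynkin)
    (Q : quiver 'I_(dynkin_rank Delta))
    (hQ : underlying_graph Q (dynkin_graph Delta))
    (x0 : 'I_(dynkin_rank Delta))
    (v : zvertex (dynkin_graph Delta) x0 -> Db k Q)
    (hv : mesh_identification v)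
    (A B C : Db k Q)
    (alpha : Mor A B) (beta : Mor B C) (gamma : Mor C (shift A 1%R))
    (hsigma : distinguished alpha beta gamma) :
  dim_vector B = dim_vector (dsum A C) /\
  delta_triangle v gamma = delta_pair v B (dsum A C).
Proof.
split; first exact: dim_vector_triangle hsigma.
apply: funext => m; case: hv => -[phi [_ _ surj _ indec]] _ _.
apply/esym; apply: euler_triangle hsigma => T.
apply: fin_dim_Hom => X /indec[x Xx].
by apply: fin_dim_isor (isomorphic_sym Xx) _; apply: fin_dim_mesh surj _ _.
Qed.
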